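(* Let $\Phi$ be the bijection from vertices of the Apollonian kingdom to oriented Gaussian circles sending a vertex labelled by the lax lattice with ordered basis $(a,b)$ to $M(\mathbb{R})$, where $M$ has columns $a,b$. Then: (i) a set of four vertices is the vertex set of a chamber of the Apollonian kingdom if and only if its image under $\Phi$ is a Descartes quadruple, and this gives a bijection between chambers of the Apollonian kingdom and Descartes quadruples of Gaussian circles; (ii) two vertices are joined by an edge if and only if the corresponding circles are tangent and belong to a common Descartes quadruple of Gaussian circles; (iii) the connected components of the Apollonian kingdom are in bijection with the Apollonian palaces of Apollonian circle packings of Gaussian circles: for each component $K$, $\Phi$ maps the vertices of $K$ onto the circles of an Apollonian circle packing of Gaussian circles, the graph $K$ corresponding to its Apollonian palace, and each such packing arises from exactly one component.
   Context: Units of $\mathbb{Z}[i]$ are $\{\pm1,\pm i\}$. A lax vector is a primitive vector of $\mathbb{Z}[i]^2$ (coprime entries) up to multiplication by units. A basis is a pair of lax vectors whose representatives form a $\mathbb{Z}[i]$-basis of $\mathbb{Z}[i]^2$; a superbasis is a triple of lax vectors any two of which form a basis. An ultrabasis is a set of six lax vectors $u,v,w,x,y,z$ such that $\{u,v,w\},\{u,y,z\},\{v,x,z\},\{w,x,y\}$ are superbases; it is regarded as a chamber: a tetrahedron whose edges are labelled by the six lax vectors so that its four triangular faces (walls) carry these superbases. Every superbasis has representatives $u,v,w$ with $u+v+w=0$, and the chambers containing it as a wall are exactly the left standard chamber (edges $u,v,w,u+iv,v+iw,w+iu$; walls $\{u,v,w\},\{u,u+iv,w+iu\},\{v,v+iw,u+iv\},\{w,w+iu,v+iw\}$)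 and the right standard chamber (edges $u,v,w,u-iv,v-iw,w-iu$; walls $\{u,v,w\},\{u,u-iv,w-iu\},\{v,v-iw,u-iv\},\{w,w-iu,v-iw\}$). The Apollonian kingdom is the graph obtained from all chambers by gluing along common walls. Lax lattices: for an ordered $\mathbb{Z}[i]$-basis $(a,b)$ of $\mathbb{Z}[i]^2$, $L=\mathbb{Z}a+\mathbb{Z}b$ oriented by $(a,b)$; the lax lattice is $\{L,iL\}$. Vertex labels: in a left standard chamber with $u+v+w=0$ the vertex at edges $u,v,u+iv$ carries $(u,iv)$; at $v,w,v+iw$ carries $(v,iw)$; at $w,u,w+iu$ carries $(w,iu)$; at $u+iv,v+iw,w+iu$ carries $(w-iv,iu-v)$; in the right standard chamber the vertices of wall $\{u,v,w\}$ carry the same labels and the vertex at $u-iv,v-iw,w-iu$ carries $(w+iv,iu+v)$ (labels are independent of choices). Circles in $\mathbb{C}_\infty$ include lines; an oriented circle's interior is the region to the right of travel; $\mathbb{R}$ is oriented toward $+\infty$; $\mathrm{PGL}_2(\mathbb{Z}[i])$ acts by M\''obius transformations on oriented circles. A Gaussian circle is an oriented circle $M(\mathbb{R})$, $M\in\mathrm{PGL}_2(\mathbb{Z}[i])$. A Descartes quadruple is a set of four oriented circles, pairwise tangent with pairwise disjoint interiors. The Apollonian packing generated by a Descartes quadruple is obtained by repeatedly adding, for every triple of mutually tangent circles with disjoint interiors in the current collection, both circles completing it to a Descartes quadruple, and taking the union. The Apollonian palace of a packing is the graph with a vertex per circle and an edge per tangent pair. *)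

(* Defs.v *)
From HB Require Import structures.
From Stdlib Require Import Relation_Operators.
From mathcomp Require Import all_boot all_order all_algebra.
From mathcomp Require Import all_classical reals.
From mathcomp Require Import complex ring.

Set Implicit Arguments.
Unset Strict Implicit.
Unset Printing Implicit Defensive.
Import Order.TTheory GRing.Theory Num.Theory.
Local Open Scope ring_scope.
Local Open Scope classical_set_scope.
Local Open Scope card_scope.

(* The library puts a ring structure on [complex R] only when [R] is a field. *)
Definition gint : Type := complex int.

HB.instance Definition _ := Choice.copy gint (complex int).
HB.instance Definition _ := GRing.Zmodule.copy gint (complex int).

Definition gint1 : gint := Complex 1 0.
Definition gi : gint := Complex 0 1.
Definition gint_mul : gint -> gint -> gint := @ComplexField.mulc int.

Lemma gint_mul1 : left_id gint1 gint_mul.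
Proof. by case=> a b; congr Complex; ring. Qed.

Lemma gint_mulDl : left_distributive gint_mul +%R.
Proof. by case=> [a b] [c d] [e f]; congr Complex; ring. Qed.

Lemma gint1_neq0 : gint1 != 0.
Proof. by []. Qed.

HB.instance Definition _ := GRing.Zmodule_isComNzRing.Build gint
  (@ComplexField.mulcA int) (@ComplexField.mulcC int)
  gint_mul1 gint_mulDl gint1_neq0.

Definition gint_norm (x : gint) : int := complex.Re x ^+ 2 + complex.Im x ^+ 2.
Definition gint_unit : pred gint := fun x => gint_norm x == 1.
Definition gint_inv (x : gint) : gint :=
  if gint_unit x then Complex (complex.Re x) (- complex.Im x) else x.

Lemma gint_normM x y : gint_norm (x * y) = gint_norm x * gint_norm y.
Proof. by case: x y => [a b] [c d]; rewrite /gint_norm /=; ring. Qed.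

Lemma gint_mulV : {in gint_unit, left_inverse 1 gint_inv *%R}.
Proof.
move=> x ux; have {}ux : gint_unit x by [].
rewrite /gint_inv ux; case: x ux => a b /eqP; rewrite /gint_norm /= => n1.
by congr Complex; [rewrite -n1 | ]; ring.
Qed.

Lemma gint_unitP x y : y * x = 1 -> gint_unit x.
Proof.
move=> yx1; have := gint_normM y x; rewrite yx1.
have ge0 z : 0 <= gint_norm z by rewrite addr_ge0 // sqr_ge0.
have -> : gint_norm 1 = 1 by [].
rewrite /gint_unit; move: (ge0 x) (ge0 y).
case: (gint_norm x) => // m _; case: (gint_norm y) => // n _.
by rewrite -PoszM => -[] /esym/eqP; rewrite muln_eq1 => /andP[_ /eqP ->].
Qed.

Lemma gint_inv_out : {in [predC gint_unit], gint_inv =1 id}.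
Proof. by move=> x /negbTE nux; rewrite /gint_inv; have -> : gint_unit x = false by []. Qed.

HB.instance Definition _ := GRing.ComNzRing_hasMulInverse.Build gint
  gint_mulV gint_unitP gint_inv_out.

Definition vec : Type := 'cV[gint]_2.

Definition primitive (a : vec) : Prop :=
  forall d : gint, (forall k, exists q, a k ord0 = q * d) ->
    d \is a GRing.unit.

(* A lax vector is encoded as the set of its representatives. *)
Definition laxv : Type := set vec.
Definition lax (a : vec) : laxv := [set e *: a | e in [set e | e \is a GRing.unit]].
Definition is_lax (A : laxv) : Prop := exists2 a, primitive a & A = lax a.

Definition zibasis (a b : vec) : Prop :=
  forall x : vec, exists! st : gint * gint, x = st.1 *: a + st.2 *: b.

Definition lax_basis (A B : laxv) : Prop :=
  [/\ is_lax A, is_lax B & exists a b, [/\ A a, B b & zibasis a b]].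

Definition superbasis (A B C : laxv) : Prop :=
  [/\ lax_basis A B, lax_basis B C & lax_basis A C].

(* A chamber is encoded as the set of its four walls, not as the set of its six
   edges: the six edges do not determine the tetrahedron, because the triples
   of edges meeting at the vertices of a chamber are superbases as well, and
   they are the walls of another chamber with the same six edges. *)
Definition walls (u v w x y z : laxv) : set (set laxv) :=
  [set [set u; v; w]; [set u; y; z]; [set v; x; z]; [set w; x; y]].

Definition chamber (W : set (set laxv)) : Prop :=
  exists u v w x y z : laxv,
    [/\ [set u; v; w; x; y; z] #= `I_6,
        superbasis u v w /\ superbasis u y z,
        superbasis v x z /\ superbasis w x y
      & W = walls u v w x y z].

Definition edges (W : set (set laxv)) : set laxv := \bigcup_(F in W) F.

(* A vertex of a single chamber is encoded by the three edges that meet there,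
   i.e. the edges outside the opposite wall. *)
Definition corner_of (W : set (set laxv)) (T : set laxv) : Prop :=
  exists2 F, W F & T = edges W `\` F.

Definition corner : Type := (set (set laxv) * set laxv)%type.

Definition is_corner (c : corner) : Prop := chamber c.1 /\ corner_of c.1 c.2.

(* Two chambers with a common wall [F] are glued along [F] so that the edge
   labels match: the vertex of [F] between two edges of [F] in one chamber is
   identified with the vertex between the same two edges in the other.  The
   corner opposite to [F] is the one that does not meet [F]. *)
Definition glued (c c' : corner) : Prop :=
  [/\ is_corner c, is_corner c' &
      exists F, [/\ c.1 F, c'.1 F, c.2 `&` F !=set0
                  & c.2 `&` F = c'.2 `&` F]].

Definition kclass (c : corner) : set corner :=
  [set c' | clos_refl_sym_trans corner glued c c'].

Definition kvertex : set (set corner) := [set kclass c | c in is_corner].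

Definition chamber_vertices (W : set (set laxv)) : set (set corner) :=
  [set kclass (W, T) | T in corner_of W].

Definition kedge (P Q : set corner) : Prop :=
  exists W T T', [/\ chamber W, corner_of W T /\ corner_of W T', T <> T'
    , P = kclass (W, T) & Q = kclass (W, T')].

Record graph (T : Type) :=
  Graph { gvert : set T ; gedge : T -> T -> Prop }.

Definition induced T (G : graph T) (A : set T) : graph T :=
  Graph A (fun x y => [/\ A x, A y & gedge G x y]).

Definition component T (G : graph T) : set (graph T) :=
  [set induced G [set y | clos_refl_sym_trans T (gedge G) x y] | x in gvert G].

Definition graph_iso T U (f : T -> U) (G : graph T) (H : graph U) : Prop :=
  set_bij (gvert G) (gvert H) f /\
  forall x y, gvert G x -> gvert G y ->
    (gedge G x y <-> gedge H (f x) (f y)).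

Definition kingdom : graph (set corner) := Graph kvertex kedge.

(* The oriented lattice [Za + Zb], encoded as the set of its positively
   oriented ordered Z-bases. *)
Definition olattice (a b : vec) : set (vec * vec) :=
  [set ab | exists p q r s : int, p * s - q * r = 1 /\
     ab = (a *~ p + b *~ q, a *~ r + b *~ s)].

Definition lax_lattice (a b : vec) : set (set (vec * vec)) :=
  [set olattice a b; olattice (gi *: a) (gi *: b)].

Definition std_walls (e : gint) (u v w : vec) : set (set laxv) :=
  walls (lax u) (lax v) (lax w)
        (lax (v + e *: w)) (lax (w + e *: u)) (lax (u + e *: v)).
Definition left_chamber := std_walls gi.
Definition right_chamber := std_walls (- gi).

Definition std_reps (u v w : vec) : Prop :=
  u + v + w = 0 /\ superbasis (lax u) (lax v) (lax w).

Variant carries : corner -> vec -> vec -> Prop :=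
| Left_uv u v w of std_reps u v w :
    carries (left_chamber u v w, [set lax u; lax v; lax (u + gi *: v)])
            u (gi *: v)
| Left_vw u v w of std_reps u v w :
    carries (left_chamber u v w, [set lax v; lax w; lax (v + gi *: w)])
            v (gi *: w)
| Left_wu u v w of std_reps u v w :
    carries (left_chamber u v w, [set lax w; lax u; lax (w + gi *: u)])
            w (gi *: u)
| Left_apex u v w of std_reps u v w :
    carries (left_chamber u v w,
             [set lax (u + gi *: v); lax (v + gi *: w); lax (w + gi *: u)])
            (w - gi *: v) (gi *: u - v)
| Right_uv u v w of std_reps u v w :
    carries (right_chamber u v w, [set lax u; lax v; lax (u - gi *: v)])
            u (gi *: v)
| Right_vw u v w of std_reps u v w :
    carries (right_chamber u v w, [set lax v; lax w; lax (v - gi *: w)])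
            v (gi *: w)
| Right_wu u v w of std_reps u v w :
    carries (right_chamber u v w, [set lax w; lax u; lax (w - gi *: u)])
            w (gi *: u)
| Right_apex u v w of std_reps u v w :
    carries (right_chamber u v w,
             [set lax (u - gi *: v); lax (v - gi *: w); lax (w - gi *: u)])
            (w + gi *: v) (gi *: u + v).

Definition labelled (P : set corner) (L : set (set (vec * vec))) : Prop :=
  exists c a b, [/\ P c, carries c a b & L = lax_lattice a b].

Section Circles.
Variable R : realType.
Local Notation C := (complex R).
Local Notation "x %:C" := (real_complex R x).

(* The extended complex plane, with [None] the point at infinity. *)
Definition Cinf : Type := option C.

(* An orientation amounts to the choice of the region lying to the right of
   travel, so an oriented circle is encoded by its points and its interior. *)
Record ocircle := OCircle { pts : set Cinf ; interior : set Cinf }.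

(* The disc is to the right of clockwise travel. *)
Definition cw_circle (c : C) (r : R) : ocircle :=
  OCircle [set Some z | z in [set z : C | `|z - c| = r%:C]]
          [set Some z | z in [set z : C | `|z - c| < r%:C]].

Definition ccw_circle (c : C) (r : R) : ocircle :=
  OCircle [set Some z | z in [set z : C | `|z - c| = r%:C]]
          (None |` [set Some z | z in [set z : C | r%:C < `|z - c|]]).

(* The line through [p] travelled in the direction [d]. *)
Definition oline (p d : C) : ocircle :=
  OCircle (None |` [set Some (p + t%:C * d) | t in [set: R]])
          [set Some z | z in [set z : C | complex.Im ((z - p) / d) < 0]].

Definition is_ocircle (c : ocircle) : Prop :=
  [\/ exists p r, 0 < r /\ c = cw_circle p r,
      exists p r, 0 < r /\ c = ccw_circle p r
    | exists p d, d != 0 /\ c = oline p d].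

Definition real_circle : ocircle := oline 0 1.

Definition moebius (M : 'M[C]_2) (z : Cinf) : Cinf :=
  let a := M ord0 ord0 in let b := M ord0 ord_max in
  let c := M ord_max ord0 in let d := M ord_max ord_max in
  match z with
  | Some z => if c * z + d == 0 then None else Some ((a * z + b) / (c * z + d))
  | None => if c == 0 then None else Some (a / c)
  end.

(* Invertible Moebius transformations are conformal, hence carry the region to
   the right of travel to the region to the right of travel. *)
Definition moebius_circle (M : 'M[C]_2) (c : ocircle) : ocircle :=
  OCircle (moebius M @` pts c) (moebius M @` interior c).

Definition gint_complex (x : gint) : C :=
  Complex (complex.Re x)%:~R (complex.Im x)%:~R.

Definition circle_of (M : 'M[gint]_2) : ocircle :=
  moebius_circle (map_mx gint_complex M) real_circle.

Definition gaussian_circle : set ocircle :=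
  [set circle_of M | M in [set M | M \in unitmx]].

Definition tangent (c d : ocircle) : Prop :=
  exists z, pts c `&` pts d = [set z].

Definition descartes (D : set ocircle) : Prop :=
  [/\ D #= `I_4, D `<=` is_ocircle &
      forall c d, D c -> D d -> c <> d ->
        tangent c d /\ interior c `&` interior d = set0].

Definition gaussian_descartes (D : set ocircle) : Prop :=
  descartes D /\ D `<=` gaussian_circle.

Fixpoint packing_stage (D : set ocircle) (n : nat) : set ocircle :=
  if n is m.+1 then
    packing_stage D m `|`
    [set d | exists a b c, [/\ packing_stage D m a, packing_stage D m b,
       packing_stage D m c & descartes [set a; b; c; d]]]
  else D.

Definition packing (D : set ocircle) : set ocircle :=
  \bigcup_n packing_stage D n.

Definition gaussian_packing (A : set ocircle) : Prop :=
  (exists2 D, descartes D & A = packing D) /\ A `<=` gaussian_circle.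

Definition palace (A : set ocircle) : graph ocircle :=
  Graph A (fun c d => [/\ A c, A d & tangent c d]).

End Circles.

(* Main.v *)
(**
A chamber is determined by two vectors [u], [v] forming a basis, the third one
being [w = - u - v]: it is the left standard chamber of [u], [v], [w], and the
neighbour across the wall [u], [v], [w] is obtained by exchanging [u] and [v].
To a basis [(a, b)] one attaches the Hermitian form of the circle M(R), where M
has columns [a], [b]. Two bases have the same circle exactly when they differ by
a unit and an element of SL2(Z); since SL2(Z) is generated by a rotation, which
fixes the corner of a chamber, and a flip, which crosses a wall, two corners are
identified in the kingdom exactly when their circles coincide.

Two circles are tangent with disjoint interiors when their forms pair to -1.
Moving one Gaussian circle to the real line shows that three mutually tangent
Gaussian circles always come from a wall, and the two circles completing them are
the fourth vertices of the two chambers containing that wall. This gives the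
correspondence of chambers with Descartes quadruples, and of wall crossings with
the steps of the construction of a packing.

Within a component all interiors are disjoint: for a point inside a circle, the
value of minus the forms at that point is nonnegative on the neighbours of the
circle and, because d + d' = 2 (a + b + c) across a wall, keeps growing along a
walk that does not turn back. Hence a circle of the packing touching a given one
is the neighbour of the latter at the tangency point, and tangency in a component
is adjacency.
*)
Require Import Defs.
From Stdlib Require Import Relation_Operators List.
From mathcomp Require Import all_boot all_order all_algebra.
From mathcomp Require Import all_classical reals.
From mathcomp Require Import complex ring lra zify.
Set Implicit Arguments.
Unset Strict Implicit.
Unset Printing Implicit Defensive.
Import Order.TTheory GRing.Theory Num.Theory.
Local Open Scope ring_scope.
Local Open Scope classical_set_scope.
Local Open Scope card_scope.

(** * Gaussian integers and lax vectors *)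

(** Tangency alone does not detect edges: the real line and the half plane Im z > 2 are Gaussian,
    tangent and have disjoint interiors, yet share no Descartes quadruple. Hence the tangency
    statement for components needs a global argument, while the one for pairs of vertices can stay
    inside one quadruple. Forms of Gaussian circles have integer coefficients, so identities between
    labels are polynomial and left to [ring]. The geometry is concentrated in one comparison: a
    circle tangent to the real line restricts to it as a binary quadratic form of discriminant zero,
    that is -k (p x - q y)^2 with p, q coprime. The tangency point is q/p, and k = 1 singles out the
    neighbours. A vertex has many presentations by pairs [u], [v], so its form must be shown
    independent both of the presentation of a corner and of the gluing. That a chamber is determined
    by its four circles rests on another reading of lax vectors: an edge with representative [a] is
    the point of Q(i), or infinity, with homogeneous coordinates [a], and the circles at the two
    ends of the edge touch there. *)

Lemma card_In_le (T : Type) (s : seq T) :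
  [set x | List.In x s] #<= `I_(size s).
Proof.
case: s => [|a s].
  by rewrite (_ : [set x | _] = set0) ?card_ge0 //; apply/seteqP; split.
rewrite (_ : [set x | _] = [set nth a (a :: s) k | k in `I_(size (a :: s))]).
  exact: card_image_le.
move: (a :: s) => t; apply/seteqP; split => [x|x /= [k kn <-]].
  elim: t => // b t IH [<-|/IH [k /= kt <-]]; first by exists 0%N.
  by exists k.+1.
elim: t k kn => // b t IH [|k] /= kt; first by left.
by right; apply: IH.
Qed.

Lemma NoDup_shorten (T : Type) (s : seq T) : ~ List.NoDup s ->
  exists2 t, (size t < size s)%N & [set x | List.In x s] = [set x | List.In x t].
Proof.
elim: s => [[]|a s IH nd]; first exact: NoDup_nil.
have [sa|nsa] := pselect (List.In a s).
  by exists s => //; apply/seteqP; split => x /=; [case=> [<-|] | right].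
have [t ts /seteqP[st st']] : exists2 t, (size t < size s)%N &
    [set x | List.In x s] = [set x | List.In x t].
  by apply: IH => nds; apply: nd; constructor.
exists (a :: t) => //; apply/seteqP; split=> x /= [|]; try by left.
  by move=> /st; right.
by move=> /st'; right.
Qed.

(** The cardinality conditions on six edges and on four circles become [List.NoDup], whose inversion
    yields the pairwise disequalities. A repeated entry would give a shorter list with the same
    elements. *)
Lemma card_In_eq (T : Type) (s : seq T) :
  [set x | List.In x s] #= `I_(size s) <-> List.NoDup s.
Proof.
split=> [cs|].
  apply: contrapT => /NoDup_shorten[t ts es].
  have := card_In_le t; rewrite -es (card_le_eql cs) card_le_II.
  by rewrite leqNgt ts.
elim: s => [_|a s IH nd].
  rewrite (_ : [set x | _] = set0); last by apply/seteqP; split.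
  by rewrite II0 card_eq_le !card_ge0.
apply/eq_cardSP; exists a; first by left.
inversion nd as [|? ? nsa nds]; subst.
rewrite (_ : _ `\ a = [set x | List.In x s]); first exact: IH.
apply/seteqP; split=> x /= => [[[<-|//]]|sx]; first by [].
by split; [right | move=> xa; apply: nsa; rewrite -xa].
Qed.

Lemma gi2 : gi * gi = -1 :> gint. Proof. by []. Qed.

Lemma gunitP (e : gint) : e \is a GRing.unit ->
  [\/ e = 1, e = -1, e = gi | e = - gi].
Proof.
case: e => a b /eqP; rewrite /gint_norm /= => n1.
have ha : -1 <= a <= 1 by nia.
have hb : -1 <= b <= 1 by nia.
have : [\/ a = 1 /\ b = 0, a = -1 /\ b = 0, a = 0 /\ b = 1 | a = 0 /\ b = -1].
  have [a0|[a1|a2]] : a = 0 \/ a = 1 \/ a = -1 by lia.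
  - have [b1|b1] : b = 1 \/ b = -1 by nia.
    + by constructor 3.
    + by constructor 4.
  - by constructor 1; split=> //; nia.
  - by constructor 2; split=> //; nia.
by case=> -[-> ->]; [constructor 1|constructor 2|constructor 3|constructor 4].
Qed.

Lemma unit_gi : gi \is a GRing.unit. Proof. by []. Qed.
Lemma unit_Ngi : - gi \is a GRing.unit. Proof. by []. Qed.

(** The determinant of the matrix with columns [x], [y]: a unit exactly on bases, zero on
    proportional vectors, so that it also separates lax vectors. *)
Definition crs (x y : vec) : gint :=
  x ord0 ord0 * y ord_max ord0 - x ord_max ord0 * y ord0 ord0.

Ltac vring := apply/matrixP => ? ?; rewrite !mxE; ring: gi2.
Ltac cring := rewrite /crs ?mxE; ring: gi2.

Lemma vecP (x y : vec) : x ord0 ord0 = y ord0 ord0 ->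
  x ord_max ord0 = y ord_max ord0 -> x = y.
Proof.
move=> h0 h1; apply/matrixP => k j; rewrite (ord1 j).
case: k => [[|[|//]] hk].
  by rewrite (_ : Ordinal hk = ord0) //; apply: val_inj.
by rewrite (_ : Ordinal hk = ord_max) //; apply: val_inj.
Qed.

Lemma laxxx (a : vec) : lax a a.
Proof. by exists 1; [exact: unitr1 | rewrite scale1r]. Qed.

Lemma lax_scale (e : gint) (a : vec) : e \is a GRing.unit -> lax (e *: a) = lax a.
Proof.
move=> ue; apply/seteqP; split => x [f /= uf <-].
  by exists (f * e); rewrite /= ?unitrM ?uf ?ue ?scalerA.
by exists (f / e); rewrite /= ?unitrM ?uf ?unitrV ?ue ?scalerA ?divrK.
Qed.

Lemma lax_inj (a b : vec) : lax a = lax b ->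
  exists2 e : gint, e \is a GRing.unit & b = e *: a.
Proof. by move=> ab; have := laxxx b; rewrite -ab => -[e ue <-]; exists e. Qed.

Lemma lax_crs (a b : vec) : lax a = lax b -> crs a b = 0.
Proof. by case/lax_inj=> e _ ->; cring. Qed.

Lemma lax_scaled (e : gint) (a b : vec) :
  e \is a GRing.unit -> a = e *: b -> lax a = lax b.
Proof. by move=> ue ->; rewrite lax_scale. Qed.

Lemma crsC (a b : vec) : crs b a = - crs a b. Proof. by cring. Qed.

Lemma crs_cramer (a b x : vec) : crs a b *: x = crs x b *: a + crs a x *: b.
Proof. by apply: vecP; rewrite !mxE /crs; ring. Qed.

Lemma crs_comb (s t s' t' : gint) (a b : vec) :
  crs (s *: a + t *: b) (s' *: a + t' *: b) = (s * t' - t * s') * crs a b.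
Proof. by cring. Qed.

(** Expanding the two standard vectors in [a], [b] exhibits 1 as a multiple of [crs a b]; conversely
    Cramer's rule gives the coordinates. *)
Lemma zibasisP (a b : vec) : zibasis a b <-> crs a b \is a GRing.unit.
Proof.
split=> [ab|uab x].
  have [[s t] [/= e0 _]] := ab (\col_k (k == ord0)%:R).
  have [[s' t'] [/= e1 _]] := ab (\col_k (k == ord_max)%:R).
  have : crs (\col_k (k == ord0)%:R) (\col_k (k == ord_max)%:R) = 1.
    by rewrite /crs !mxE /= mulr1 mulr0 subr0.
  rewrite e0 e1 crs_comb => h.
  have := unitr1 gint; rewrite -h.
  by rewrite unitrM => /andP[].
exists (crs x b / crs a b, crs a x / crs a b); split=> /= [|[s t] /= ->].
  have {1}-> : x = (crs a b)^-1 *: (crs a b *: x) by rewrite scalerA mulVr ?scale1r.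
  by rewrite crs_cramer scalerDr !scalerA !(mulrC _^-1).
rewrite (_ : crs (s *: a + t *: b) b = s * crs a b); last by cring.
rewrite (_ : crs a (s *: a + t *: b) = t * crs a b); last by cring.
by rewrite !mulrK.
Qed.

Lemma unit_crsC (a b : vec) : crs a b \is a GRing.unit -> crs b a \is a GRing.unit.
Proof. by rewrite crsC unitrN. Qed.

Lemma basis_primitive (a b : vec) : crs a b \is a GRing.unit -> primitive a.
Proof.
move=> uab d hd; have [q0 e0] := hd ord0; have [q1 e1] := hd ord_max.
move: uab; rewrite /crs e0 e1.
rewrite (_ : _ - _ = d * (q0 * b ord_max ord0 - q1 * b ord0 ord0)); last by ring.
by rewrite unitrM => /andP[].
Qed.

Lemma lax_basisP (a b : vec) :
  lax_basis (lax a) (lax b) <-> crs a b \is a GRing.unit.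
Proof.
split=> [[_ _ [_ [_ [[e ue <-] [f uf <-] /zibasisP]]]]|uab].
  rewrite (_ : crs _ _ = e * f * crs a b); last by cring.
  by rewrite !unitrM => /andP[_].
split.
- by exists a => //; exact: basis_primitive uab.
- by exists b => //; exact: basis_primitive (unit_crsC uab).
- by exists a, b; split; [exact: laxxx | exact: laxxx | exact/zibasisP].
Qed.

Lemma is_laxP (A : laxv) : is_lax A -> exists a, A = lax a.
Proof. by case=> a _ ->; exists a. Qed.

Lemma superbasisP (a b c : vec) : superbasis (lax a) (lax b) (lax c) <->
  [/\ crs a b \is a GRing.unit, crs b c \is a GRing.unit
    & crs a c \is a GRing.unit].
Proof. by split=> -[] /lax_basisP ? /lax_basisP ? /lax_basisP ?. Qed.

Lemma superbasis_std (u v : vec) : crs u v \is a GRing.unit ->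
  superbasis (lax u) (lax v) (lax (- u - v)).
Proof.
move=> uv; apply/superbasisP; split=> //.
  by rewrite (_ : crs v _ = crs u v) //; cring.
by rewrite (_ : crs u (_ - _) = - crs u v) ?unitrN //; cring.
Qed.

(** Cramer's rule writes [crs a b *: c] as a combination of [a] and [b] with unit coefficients;
    absorbing these units into the representatives makes the sum zero. *)
Lemma superbasis_reps (A B C : laxv) : superbasis A B C ->
  exists u v, [/\ crs u v \is a GRing.unit, A = lax u, B = lax v
                & C = lax (- u - v)].
Proof.
move=> sb; have [[/is_laxP[a eA] /is_laxP[b eB] _] [_ /is_laxP[c eC] _] _] := sb.
move: sb; rewrite eA eB eC => /superbasisP[uab ubc uac].
have cE := crs_cramer a b c.
have ua' : - crs c b \is a GRing.unit by rewrite unitrN unit_crsC.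
have ub' : - crs a c \is a GRing.unit by rewrite unitrN.
exists (- crs c b *: a), (- crs a c *: b); split.
- rewrite (_ : crs _ _ = (- crs c b) * (- crs a c) * crs a b); last by cring.
  by rewrite !unitrM ua' ub'.
- by rewrite lax_scale.
- by rewrite lax_scale.
- by rewrite !scaleNr !opprK -cE lax_scale.
Qed.

(** * Standard chambers *)

Lemma set3_rot (T : Type) (a b c : T) : [set a; b; c] = [set b; c; a].
Proof. by apply/seteqP; split=> t /=; tauto. Qed.

Lemma set3_swap (T : Type) (a b c : T) : [set a; b; c] = [set b; a; c].
Proof. by apply/seteqP; split=> t /=; tauto. Qed.

Lemma set3_swap' (T : Type) (a b c : T) : [set a; b; c] = [set a; c; b].
Proof. by apply/seteqP; split=> t /=; tauto. Qed.

(** Symmetries of the tetrahedron: here the rotation fixing the wall [u], [v], [w]; in [walls_swap]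
    a reflection exchanging two walls; in [walls_rho] the rotation fixing the wall [u], [y], [z]. *)
Lemma walls_cyc (u v w x y z : laxv) : walls u v w x y z = walls v w u y z x.
Proof.
rewrite /walls (set3_rot u v w) (set3_swap' v x z) (set3_swap' w x y).
by apply/seteqP; split=> t /=; tauto.
Qed.

Lemma walls_swap (u v w x y z : laxv) : walls u v w x y z = walls v u w y x z.
Proof.
rewrite /walls (set3_swap u v w) (set3_swap' w x y).
by apply/seteqP; split=> t /=; tauto.
Qed.

Lemma walls_rho (u v w x y z : laxv) : walls u v w x y z = walls z x v w u y.
Proof.
rewrite /walls (set3_rot u v w) -(set3_rot z u y) (set3_rot v x z).
rewrite (set3_swap x z v) (set3_swap w x y).
by apply/seteqP; split=> t /=; tauto.
Qed.

Definition ultra (u v w x y z : laxv) : Prop :=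
  [/\ List.NoDup [:: u; v; w; x; y; z],
      superbasis u v w /\ superbasis u y z
    & superbasis v x z /\ superbasis w x y].

Lemma lax_basisC (A B : laxv) : lax_basis A B -> lax_basis B A.
Proof.
case=> /is_laxP[a ->] /is_laxP[b ->] [_ [_ [[e ue <-] [f uf <-] /zibasisP]]].
rewrite (_ : crs _ _ = e * f * crs a b); last by cring.
by rewrite !unitrM => /andP[_ /unit_crsC /lax_basisP].
Qed.

Lemma superbasis_rot (A B C : laxv) : superbasis A B C -> superbasis B C A.
Proof. by case=> ab bc ac; split=> //; exact: lax_basisC. Qed.

Lemma superbasis_swap (A B C : laxv) : superbasis A B C -> superbasis B A C.
Proof. by case=> ab bc ac; split=> //; exact: lax_basisC. Qed.

Lemma superbasis_swap' (A B C : laxv) : superbasis A B C -> superbasis A C B.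
Proof. by move=> /superbasis_swap/superbasis_rot. Qed.

Lemma not_orE (A B : Prop) : ~ (A \/ B) -> ~ A /\ ~ B.
Proof. by tauto. Qed.

Ltac nodups :=
  repeat match goal with H : List.NoDup (_ :: _) |- _ =>
    inversion H; clear H; subst end; simpl in *;
  repeat match goal with
    | H : ~ (_ \/ _) |- _ => apply not_orE in H; destruct H
    | H : ~ False |- _ => clear H
    | H : List.NoDup nil |- _ => clear H
    end.

Ltac dcong :=
  repeat match goal with
    | H : _ \/ _ |- _ => destruct H
    | |- ~ _ => intro
    | |- _ /\ _ => split
    end; first [congruence | tauto].

Ltac mknodup := repeat (constructor; simpl); dcong.

Lemma ultra_cyc (u v w x y z : laxv) : ultra u v w x y z -> ultra v w u y z x.
Proof.
case=> nd [s1 s2] [s3 s4]; split.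
- by nodups; mknodup.
- split; first exact: superbasis_rot.
  exact: superbasis_swap'.
- split=> //.
  exact: superbasis_swap'.
Qed.

Lemma ultra_swap (u v w x y z : laxv) : ultra u v w x y z -> ultra v u w y x z.
Proof.
case=> nd [s1 s2] [s3 s4]; split.
- by nodups; mknodup.
- by split=> //; exact: superbasis_swap.
- split=> //.
  exact: superbasis_swap'.
Qed.

Lemma ultra_rho (u v w x y z : laxv) : ultra u v w x y z -> ultra z x v w u y.
Proof.
case=> nd [s1 s2] [s3 s4]; split.
- by nodups; mknodup.
- split; last by apply: superbasis_rot; apply: superbasis_rot.
  by apply: superbasis_swap; apply: superbasis_rot.
- split; first exact: superbasis_swap.
  by apply: superbasis_rot.
Qed.

Lemma chamber_ultra (W : set (set laxv)) : chamber W <->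
  exists u v w x y z, ultra u v w x y z /\ W = walls u v w x y z.
Proof.
have E (u v w x y z : laxv) : [set u; v; w; x; y; z] =
    [set t | List.In t [:: u; v; w; x; y; z]].
  by apply/seteqP; split=> t /=; intuition.
split=> [[u [v [w [x [y [z [c s t ->]]]]]]]|[u [v [w [x [y [z [[nd s t] ->]]]]]]]];
  exists u, v, w, x, y, z; split=> //.
  by split=> //; apply/card_In_eq; rewrite -E.
by rewrite E; move/card_In_eq: nd.
Qed.

Lemma lax_third (a b : vec) (Z : laxv) : crs a b \is a GRing.unit ->
  lax_basis (lax a) Z -> lax_basis (lax b) Z ->
  exists2 e : gint, e \is a GRing.unit & Z = lax (a + e *: b).
Proof.
move=> uab az bz; have [_ /is_laxP[z eZ] _] := az.
move: az bz; rewrite {}eZ => /lax_basisP uaz /lax_basisP /unit_crsC uzb.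
exists (crs a z / crs z b); first by rewrite unitrM uaz unitrV.
have -> : a + (crs a z / crs z b) *: b = ((crs z b)^-1 * crs a b) *: z.
  rewrite -[RHS]scalerA crs_cramer scalerDr !scalerA mulVr // scale1r.
  by rewrite [_^-1 * _]mulrC.
by rewrite lax_scale // unitrM unitrV uzb.
Qed.

(** Each new edge is fixed by a unit [e1], [e2], [e3]. None is 1, since the edge would then repeat
    one of the wall, and the bases among [X], [Y], [Z] require [(e2 - 1) * e3 + 1] and its two
    analogues to be units. Of the 27 triples only the constant ones i and -i survive. *)
Lemma ultra_std (u v : vec) (X Y Z : laxv) (w := - u - v) :
  crs u v \is a GRing.unit -> ultra (lax u) (lax v) (lax w) X Y Z ->
  exists2 e, e = gi \/ e = - gi &
    [/\ X = lax (v + e *: w), Y = lax (w + e *: u) & Z = lax (u + e *: v)].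
Proof.
move=> uv [nd [s1 [uy yz uz]] [[vx xz vz] [wx xy wy]]].
have vw : crs v w \is a GRing.unit.
  by rewrite (_ : crs v w = crs u v) // /w; cring.
have wu : crs w u \is a GRing.unit.
  by rewrite (_ : crs w u = crs u v) // /w; cring.
have [e1 ue1 eX] := lax_third vw vx wx.
have [e2 ue2 eY] := lax_third wu wy uy.
have [e3 ue3 eZ] := lax_third uv uz vz.
have n1 : e1 <> 1.
  move=> e; have : X = lax u; last by nodups; dcong.
  by rewrite eX e; apply: (@lax_scaled (-1)) => //; rewrite /w; vring.
have n2 : e2 <> 1.
  move=> e; have : Y = lax v; last by nodups; dcong.
  by rewrite eY e; apply: (@lax_scaled (-1)) => //; rewrite /w; vring.
have n3 : e3 <> 1.
  move=> e; have : Z = lax w; last by nodups; dcong.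
  by rewrite eZ e; apply: (@lax_scaled (-1)) => //; rewrite /w; vring.
have m1 : (e2 - 1) * e3 + 1 \is a GRing.unit.
  move: yz; rewrite eY eZ => /lax_basisP.
  rewrite (_ : crs _ _ = ((e2 - 1) * e3 + 1) * crs u v); last by rewrite /w; cring.
  by rewrite unitrM => /andP[].
have m2 : (e1 - 1) * e2 + 1 \is a GRing.unit.
  move: xy; rewrite eX eY => /lax_basisP.
  rewrite (_ : crs _ _ = ((e1 - 1) * e2 + 1) * crs u v); last by rewrite /w; cring.
  by rewrite unitrM => /andP[].
have m3 : (e3 - 1) * e1 + 1 \is a GRing.unit.
  move: xz; rewrite eX eZ => /lax_basisP.
  rewrite (_ : crs _ _ = - ((e3 - 1) * e1 + 1) * crs u v); last by rewrite /w; cring.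
  by rewrite unitrM unitrN => /andP[].
have [//|e|e|e] := gunitP ue1; have [//|f|f|f] := gunitP ue2;
  have [//|g|g|g] := gunitP ue3; move: m1 m2 m3; rewrite e f g //= => _ _ _.
- by exists gi; [left | rewrite eX eY eZ e f g].
- by exists (- gi); [right | rewrite eX eY eZ e f g].
Qed.

(* All chambers are of this shape: by [right_left], a right standard chamber is a
   left one with two vectors exchanged. *)
Definition cw (u v : vec) : set (set laxv) := left_chamber u v (- u - v).

(* The corner labelled by [(u, gi *: v)]. *)
Definition corv (u v : vec) : corner := (cw u v, [set lax u; lax v; lax (u + gi *: v)]).

Lemma right_left (u v w : vec) : right_chamber u v w = left_chamber v u w.
Proof.
rewrite /right_chamber /left_chamber /std_walls walls_swap.
congr walls; apply: (@lax_scaled (- gi)) => //; vring.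
Qed.

Lemma left_cyc (u v w : vec) : left_chamber u v w = left_chamber v w u.
Proof. exact: walls_cyc. Qed.

Lemma cw_cyc (u v : vec) : cw u v = cw v (- u - v).
Proof. by rewrite /cw left_cyc; congr left_chamber; vring. Qed.

Lemma cw_right (u v : vec) : right_chamber u v (- u - v) = cw v u.
Proof. by rewrite right_left /cw; congr left_chamber; vring. Qed.

(** The same chamber read from its wall [u + gi *: v], [v + gi *: w], [v]: the vectors i(u + iv), v
    + iw and iv are representatives of these edges, and the last is minus the sum of the first
    two. *)
Lemma cw_rho (u v : vec) : cw u v = cw (gi *: u - v) (v + gi *: (- u - v)).
Proof.
rewrite /cw /left_chamber /std_walls walls_rho; congr walls.
- by apply: (@lax_scaled (- gi)) => //; vring.
- by apply: (@lax_scaled (- gi)) => //; vring.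
- by apply: (@lax_scaled (- gi)) => //; vring.
- by apply: (@lax_scaled (- 1)) => //; vring.
- by apply: (@lax_scaled gi) => //; vring.
Qed.

Lemma lax_comb_neq (u v : vec) (p q : gint * gint) : crs u v \is a GRing.unit ->
  p.1 * q.2 - p.2 * q.1 != 0 ->
  lax (p.1 *: u + p.2 *: v) <> lax (q.1 *: u + q.2 *: v).
Proof.
move=> uv /eqP pq /lax_crs; rewrite crs_comb => h; apply: pq.
by rewrite -[LHS](mulrK uv) h mul0r.
Qed.

(** Distinctness of edges is reduced to nonzero determinants of their coordinates, which are
    concrete Gaussian integers and settled by computation. *)
Lemma NoDup_comb (u v : vec) (l : seq (gint * gint)) : crs u v \is a GRing.unit ->
  pairwise (fun p q => p.1 * q.2 - p.2 * q.1 != 0) l ->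
  List.NoDup [seq lax (p.1 *: u + p.2 *: v) | p <- l].
Proof.
move=> uv; elim: l => [|p l IH] /=; first by constructor.
case/andP=> pl /IH nd; constructor=> // {IH nd}.
elim: l pl => [_ []//|q l IH /= /andP[pq pl] []]; last exact: (IH pl).
by move=> e; exact: (lax_comb_neq uv pq (esym e)).
Qed.

Lemma left_NoDup (u v : vec) (w := - u - v) : crs u v \is a GRing.unit ->
  List.NoDup [:: lax u; lax v; lax w; lax (v + gi *: w); lax (w + gi *: u);
                 lax (u + gi *: v)].
Proof.
move=> uv.
have := @NoDup_comb u v [:: (1, 0); (0, 1); (-1, -1); (- gi, 1 - gi);
  (gi - 1, -1); (1, gi)] uv erefl => /=.
rewrite (_ : 1 *: u + 0 *: v = u); last by vring.
rewrite (_ : 0 *: u + 1 *: v = v); last by vring.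
rewrite (_ : -1 *: u + -1 *: v = w); last by rewrite /w; vring.
rewrite (_ : - gi *: u + _ = v + gi *: w); last by rewrite /w; vring.
rewrite (_ : (gi - 1) *: u + _ = w + gi *: u); last by rewrite /w; vring.
by rewrite (_ : 1 *: u + gi *: v = u + gi *: v); last by vring.
Qed.

Lemma left_ultra (u v : vec) (w := - u - v) : crs u v \is a GRing.unit ->
  ultra (lax u) (lax v) (lax w) (lax (v + gi *: w)) (lax (w + gi *: u))
        (lax (u + gi *: v)).
Proof.
move=> uv; split; first exact: left_NoDup.
  split; first exact: superbasis_std.
  apply/superbasisP; rewrite /w; split.
  - by rewrite (_ : crs _ _ = - crs u v) ?unitrN //; cring.
  - by rewrite (_ : crs _ _ = - gi * crs u v) ?unitrM ?uv //; cring.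
  - by rewrite (_ : crs _ _ = gi * crs u v) ?unitrM ?uv //; cring.
split; apply/superbasisP; rewrite /w; split.
- by rewrite (_ : crs _ _ = gi * crs u v) ?unitrM ?uv //; cring.
- by rewrite (_ : crs _ _ = gi * crs u v) ?unitrM ?uv //; cring.
- by rewrite (_ : crs _ _ = - crs u v) ?unitrN //; cring.
- by rewrite (_ : crs _ _ = - crs u v) ?unitrN //; cring.
- by rewrite (_ : crs _ _ = - gi * crs u v) ?unitrM ?uv //; cring.
- by rewrite (_ : crs _ _ = gi * crs u v) ?unitrM ?uv //; cring.
Qed.

Lemma cw_chamber (u v : vec) : crs u v \is a GRing.unit -> chamber (cw u v).
Proof.
move=> uv; apply/chamber_ultra; do 6 eexists; split; first exact: left_ultra uv.
by [].
Qed.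

Lemma ultra_first (u v w x y z : laxv) (W F : set _) :
  ultra u v w x y z -> W = walls u v w x y z -> W F ->
  exists u' v' w' x' y' z', [/\ ultra u' v' w' x' y' z',
    W = walls u' v' w' x' y' z' & F = [set u'; v'; w']].
Proof.
move=> U eW; rewrite {1}eW /walls /= => -[[[->|->]|->]|->].
- by exists u, v, w, x, y, z.
- exists y, z, u, v, w, x; split.
  + by apply: ultra_rho; do 2 apply: ultra_cyc.
  + by rewrite eW walls_cyc walls_cyc walls_rho.
  + exact: set3_rot.
- exists z, x, v, w, u, y; split; first exact: ultra_rho.
    by rewrite eW; exact: walls_rho.
  by rewrite (set3_rot v x z) (set3_swap x z v).
- exists x, y, w, u, v, z; split.
  + by apply: ultra_rho; apply: ultra_cyc.
  + by rewrite eW walls_cyc walls_rho.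
  + exact: set3_rot.
Qed.

(** Symmetries of the tetrahedron bring the wall to the front with its edges in the order [u], [v],
    [w]. Then [ultra_std] leaves two signs, and the sign -i is the right chamber, a left one with
    [u] and [v] exchanged. *)
Lemma chamber_wall (u v : vec) (W : set (set laxv)) (w := - u - v) :
  crs u v \is a GRing.unit -> chamber W -> W [set lax u; lax v; lax w] ->
  W = cw u v \/ W = cw v u.
Proof.
move=> uv /chamber_ultra[U [V [T [X [Y [Z [ul eW]]]]]]] WF.
have {U V T X Y Z ul eW WF} [U [V [T [X [Y [Z [ul eW eF]]]]]]] := ultra_first ul eW WF.
wlog eU : U V T X Y Z ul eW eF / U = lax u => [wl|].
  have : [set U; V; T] (lax u) by rewrite -eF; left; left.
  case=> [[e|e]|e].
  - by apply: (wl U V T X Y Z).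
  - apply: (wl V T U Y Z X) => //; first exact: ultra_cyc.
      by rewrite eW; exact: walls_cyc.
    by rewrite eF; exact: set3_rot.
  - apply: (wl T U V Z X Y) => //; first by do 2 apply: ultra_cyc.
      by rewrite eW walls_cyc; exact: walls_cyc.
    by rewrite eF -set3_rot.
wlog eV : V T X Y Z ul eW eF / V = lax v => [wl|].
  have : [set U; V; T] (lax v) by rewrite -eF; left; right.
  case=> [[e|e]|e].
  - have [nd _ _] := left_ultra uv.
    by nodups; dcong.
  - exact: (wl V T X Y Z).
  - apply: (wl T V X Z Y) => //.
    + by apply: ultra_swap; do 2 apply: ultra_cyc.
    + by rewrite eW walls_cyc walls_cyc; exact: walls_swap.
    + by rewrite eF; exact: set3_swap'.
have eT : T = lax w.
  have : [set U; V; T] (lax w) by rewrite -eF; right.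
  have [nd _ _] := left_ultra uv.
  rewrite eU eV => -[[e|e]|e //]; by nodups; dcong.
move: ul eW; rewrite eU eV eT => ul eW.
have [e [e0|e0] [eX eY eZ]] := ultra_std uv ul.
  by left; rewrite eW eX eY eZ e0.
by right; rewrite eW eX eY eZ e0 -cw_right.
Qed.

Lemma chamberP (W : set (set laxv)) (F : set laxv) : chamber W -> W F ->
  exists u v, [/\ crs u v \is a GRing.unit, W = cw u v
                & F = [set lax u; lax v; lax (- u - v)]].
Proof.
move=> chW WF; have /chamber_ultra[U [V [T [X [Y [Z [ul eW]]]]]]] := chW.
have {U V T X Y Z ul eW} [U [V [T [X [Y [Z [ul eW eF]]]]]]] := ultra_first ul eW WF.
have [_ [sb _] _] := ul.
have [u [v [uv eU eV eT]]] := superbasis_reps sb.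
move: WF; rewrite eF eU eV eT => WF.
have [e|e] := chamber_wall uv chW WF; first by exists u, v.
exists v, u; split=> //; first exact: unit_crsC.
by rewrite set3_swap addrC.
Qed.

Lemma chamber_cw (W : set (set laxv)) : chamber W ->
  exists u v, crs u v \is a GRing.unit /\ W = cw u v.
Proof.
move=> chW; have /chamber_ultra[U [V [T [X [Y [Z [ul eW]]]]]]] := chW.
have [|u [v [uv e _]]] := @chamberP W [set U; V; T] chW.
  by rewrite eW; left; left; left.
by exists u, v.
Qed.

Lemma edges_walls (u v w x y z : laxv) :
  edges (walls u v w x y z) = [set u; v; w; x; y; z].
Proof.
apply/seteqP; split=> t.
  by case=> F [[[->|->]|->]|->] /=; tauto.
case=> [[[[[->|->]|->]|->]|->]|->].
- by exists [set u; v; w] => /=; rewrite /walls /=; tauto.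
- by exists [set u; v; w] => /=; rewrite /walls /=; tauto.
- by exists [set u; v; w] => /=; rewrite /walls /=; tauto.
- by exists [set v; x; z] => /=; rewrite /walls /=; tauto.
- by exists [set u; y; z] => /=; rewrite /walls /=; tauto.
- by exists [set u; y; z] => /=; rewrite /walls /=; tauto.
Qed.

Lemma walls_corner (u v w x y z : laxv) (T : set laxv) :
  List.NoDup [:: u; v; w; x; y; z] ->
  corner_of (walls u v w x y z) T <->
  [\/ T = [set u; v; z], T = [set v; w; x], T = [set w; u; y] | T = [set x; y; z]].
Proof.
move=> nd.
have E := edges_walls u v w x y z.
have D1 : edges (walls u v w x y z) `\` [set u; v; w] = [set x; y; z].
  rewrite E; apply/seteqP; split=> t /=; first by tauto.
  by case=> [[->|->]|->]; nodups; dcong.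
have D2 : edges (walls u v w x y z) `\` [set u; y; z] = [set v; w; x].
  rewrite E; apply/seteqP; split=> t /=; first by tauto.
  by case=> [[->|->]|->]; nodups; dcong.
have D3 : edges (walls u v w x y z) `\` [set v; x; z] = [set w; u; y].
  rewrite E; apply/seteqP; split=> t /=; first by tauto.
  by case=> [[->|->]|->]; nodups; dcong.
have D4 : edges (walls u v w x y z) `\` [set w; x; y] = [set u; v; z].
  rewrite E; apply/seteqP; split=> t /=; first by tauto.
  by case=> [[->|->]|->]; nodups; dcong.
split.
  case=> F [[[->|->]|->]|->] ->; rewrite ?D1 ?D2 ?D3 ?D4.
  - by constructor 4.
  - by constructor 2.
  - by constructor 3.
  - by constructor 1.
case=> ->.
- by exists [set w; x; y]; [right | rewrite D4].
- by exists [set u; y; z]; [left; left; right | rewrite D2].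
- by exists [set v; x; z]; [left; right | rewrite D3].
- by exists [set u; v; w]; [left; left; left | rewrite D1].
Qed.

(** * Labels of corners *)

(* [Form A B C D] stands for A |z|^2 - Im ((B + i C) z) + D: the circle is the zero
   set, the interior the set where the form is positive. *)
Record form (T : Type) := Form { fA : T; fB : T; fC : T; fD : T }.

Local Notation Re := complex.Re.
Local Notation Im := complex.Im.

(* The form of the image of the real line under the matrix [[a, b], [c, d]], that
   is z |-> - Im ((d z - b) conj (a - c z)). *)
Definition hermg (a b c d : gint) : form int :=
  Form (Re c * Im d - Im c * Re d)
       (Re a * Re d + Im a * Im d - Re b * Re c - Im b * Im c)
       (Re a * Im d - Im a * Re d - Re b * Im c + Im b * Re c)
       (Re a * Im b - Im a * Re b).

Definition herm (x y : vec) : form int :=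
  hermg (x ord0 ord0) (y ord0 ord0) (x ord_max ord0) (y ord_max ord0).

Definition hv (u v : vec) : form int := herm u (gi *: v).

Ltac hring u v :=
  rewrite /hv /herm !mxE;
  case: (u ord0 ord0) => ? ?; case: (u ord_max ord0) => ? ?;
  case: (v ord0 ord0) => ? ?; case: (v ord_max ord0) => ? ?;
  rewrite /hermg /=; congr Form; ring.

Lemma herm_unit (e : gint) (a b : vec) : e \is a GRing.unit ->
  herm (e *: a) (e *: b) = herm a b.
Proof. by move=> /gunitP[->|->|->|->]; hring a b. Qed.

Lemma hv_unit (e : gint) (a b : vec) : e \is a GRing.unit ->
  hv (e *: a) (e *: b) = hv a b.
Proof. by move=> ue; rewrite /hv scalerA mulrC -scalerA herm_unit. Qed.

(** On the basis (a, b) = (u, iv) the exchange is, up to the unit -i, the element (b, -a) of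
    SL2(Z). *)
Lemma hv_flip (u v : vec) : hv v u = hv u v.
Proof. by hring u v. Qed.

(** On the basis (a, b) = (u, iv) this is (b, -a - b), an element of order three. *)
Lemma hv_rot (u v : vec) : hv (gi *: v) (gi *: u - v) = hv u v.
Proof. by hring u v. Qed.

(* The form at the fourth vertex of [cw u v]. *)
Definition hv3 (u v : vec) : form int := hv (gi *: u - v) (v + gi *: (- u - v)).

Lemma hv3_cyc (u v : vec) : hv3 v (- u - v) = hv3 u v.
Proof. rewrite /hv3. by hring u v. Qed.

Lemma hv3_rho (u v : vec) :
  hv3 (gi *: u - v) (v + gi *: (- u - v)) = hv (- u - v) u.
Proof. by rewrite /hv3; hring u v. Qed.

Definition zi (p : int) : gint := Complex p 0.

(** A change of basis with rational integer entries multiplies every coefficient of the form by its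
    determinant. *)
Lemma herm_SL2 (a b : vec) (p q r s : int) : p * s - q * r = 1 ->
  herm (zi p *: a + zi q *: b) (zi r *: a + zi s *: b) = herm a b.
Proof.
move=> d1; rewrite /herm !mxE.
case: (a ord0 ord0) => a1 a2; case: (a ord_max ord0) => c1 c2.
case: (b ord0 ord0) => b1 b2; case: (b ord_max ord0) => e1 e2.
by rewrite /hermg /=; congr Form; rewrite -[RHS]mul1r -d1; ring.
Qed.

Lemma mulz_zi (a : vec) (p : int) : a *~ p = zi p *: a.
Proof.
rewrite -scaler_int; congr (_ *: _).
have nE (n : nat) : n%:R = zi n%:Z.
  by elim: n => // n IH; rewrite -addn1 natrD IH PoszD.
case: p => n; first by rewrite -nE.
by rewrite NegzE mulrNz -[_%:~R]/(_%:R) nE.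
Qed.

(** The label determines the circle: [(a, b)] is an oriented basis of one of the two lattices on the
    right, hence obtained from [(a', b')] by SL2(Z) and possibly the unit i. *)
Lemma lax_lattice_herm (a b a' b' : vec) :
  lax_lattice a b = lax_lattice a' b' -> herm a b = herm a' b'.
Proof.
move=> e; have : olattice a b (a, b).
  by exists 1, 0, 0, 1; split=> //; rewrite !mulr1z !mulr0z addr0 add0r.
have : lax_lattice a b (olattice a b) by left.
rewrite e => -[->|->] [p [q [r [s [d [-> ->]]]]]]; rewrite !mulz_zi herm_SL2 //.
by rewrite herm_unit.
Qed.

Lemma cw_unit (e : gint) (u v : vec) : e \is a GRing.unit ->
  cw (e *: u) (e *: v) = cw u v.
Proof.
move=> ue; rewrite /cw /left_chamber /std_walls.
by congr walls; apply: (lax_scaled ue); vring.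
Qed.

Lemma corv_unit (e : gint) (u v : vec) : e \is a GRing.unit ->
  corv (e *: u) (e *: v) = corv u v.
Proof.
move=> ue; rewrite /corv cw_unit // !lax_scale //; congr (_, [set _; _; _]).
by rewrite -[RHS](lax_scale _ ue); congr lax; vring.
Qed.

Lemma corv_rot (u v : vec) : corv u v = corv (gi *: v) (gi *: u - v).
Proof.
rewrite /corv; congr pair.
  by rewrite cw_rho cw_cyc cw_cyc; congr cw; vring.
rewrite set3_rot; congr [set _; _; _].
- by rewrite lax_scale.
- by apply: (@lax_scaled (- gi)) => //; vring.
- by apply: (@lax_scaled (- 1)) => //; vring.
Qed.

Lemma corner_cw (u v : vec) (T : set laxv) (w := - u - v) :
  crs u v \is a GRing.unit ->
  corner_of (cw u v) T <->
  [\/ (cw u v, T) = corv u v, (cw u v, T) = corv v w, (cw u v, T) = corv w u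
    | (cw u v, T) = corv (gi *: u - v) (v + gi *: w)].
Proof.
move=> uv; rewrite /cw {1}/left_chamber /std_walls (walls_corner _ (left_NoDup uv)).
rewrite -/w -/(left_chamber u v w) -/(cw u v).
have e1 : cw v w = cw u v by rewrite -cw_cyc.
have e2 : cw w u = cw u v.
  by rewrite -e1 (cw_cyc v w) (_ : - v - w = u) // /w; vring.
have e3 : cw (gi *: u - v) (v + gi *: w) = cw u v by rewrite -cw_rho.
have eT : [set lax (gi *: u - v); lax (v + gi *: w);
    lax (gi *: u - v + gi *: (v + gi *: w))] =
    [set lax (v + gi *: w); lax (w + gi *: u); lax (u + gi *: v)].
  rewrite set3_rot; congr [set _; _; _].
    by apply: (@lax_scaled (- gi)) => //; rewrite /w; vring.
  by apply: (@lax_scaled gi) => //; rewrite /w; vring.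
rewrite /corv e1 e2 e3 eT.
split=> -[h|h|h|h].
- by constructor 1; rewrite h.
- by constructor 2; rewrite h.
- by constructor 3; rewrite h.
- by constructor 4; rewrite h.
- by constructor 1; case: h.
- by constructor 2; case: h.
- by constructor 3; case: h.
- by constructor 4; case: h.
Qed.

Lemma unit_cyc (u v : vec) : crs u v \is a GRing.unit ->
  crs v (- u - v) \is a GRing.unit.
Proof. by rewrite (_ : crs v _ = crs u v) //; cring. Qed.

Lemma unit_cyc2 (u v : vec) : crs u v \is a GRing.unit ->
  crs (- u - v) u \is a GRing.unit.
Proof. by rewrite (_ : crs (_ - _) _ = crs u v) //; cring. Qed.

Lemma unit_rho (u v : vec) : crs u v \is a GRing.unit ->
  crs (gi *: u - v) (v + gi *: (- u - v)) \is a GRing.unit.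
Proof.
by move=> uv; rewrite (_ : crs _ _ = crs u v) //; cring.
Qed.

Lemma is_cornerP (c : corner) : is_corner c <->
  exists u v, crs u v \is a GRing.unit /\ c = corv u v.
Proof.
split=> [[]|[u [v [uv ->]]]].
  case: c => W T /= /chamber_cw[u [v [uv ->]]] /(corner_cw _ uv)[->|->|->|->].
  - by exists u, v.
  - by exists v, (- u - v); split=> //; exact: unit_cyc.
  - by exists (- u - v), u; split=> //; exact: unit_cyc2.
  - by do 2 eexists; split; last reflexivity; exact: unit_rho.
by split=> /=; [exact: cw_chamber | apply/corner_cw => //; constructor 1].
Qed.

Lemma std_repsP (u v w : vec) : std_reps u v w ->
  crs u v \is a GRing.unit /\ w = - u - v.
Proof.
case=> uvw /superbasisP[uv _ _]; split=> //.
by rewrite -opprD; apply/eqP; rewrite -addr_eq0 addrC uvw.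
Qed.

(** Reduces the eight labelling rules to one shape. Only the forms are compared, because [(a, b)]
    and [(u, gi *: v)] may differ by a unit and an element of SL2(Z). *)
Lemma carries_corv (c : corner) (a b : vec) : carries c a b ->
  exists u v, [/\ crs u v \is a GRing.unit, c = corv u v & herm a b = hv u v].
Proof.
case=> u v w /std_repsP[uv ->].
- by exists u, v.
- exists v, (- u - v); split=> //; first exact: unit_cyc.
  by rewrite /corv -cw_cyc.
- exists (- u - v), u; split=> //; first exact: unit_cyc2.
  rewrite /corv cw_cyc (_ : - (- u - v) - u = v) //; first by vring.
- exists (gi *: u - v), (v + gi *: (- u - v)); split.
  + exact: unit_rho.
  + rewrite /corv -cw_rho; congr pair; congr [set _; _; _].
    * by apply: (@lax_scaled (- gi)) => //; vring.
    * by apply: (@lax_scaled gi) => //; vring.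
  + by hring u v.
- exists v, u; split; first exact: unit_crsC.
    rewrite cw_right /corv; congr pair; rewrite set3_swap; congr [set _; _; _].
    by apply: (@lax_scaled (- gi)) => //; vring.
  by hring u v.
- exists (- u - v), v; split; first by apply: unit_crsC; exact: unit_cyc.
    rewrite cw_right /corv; congr pair.
      by rewrite cw_cyc cw_cyc; congr cw; vring.
    rewrite set3_swap; congr [set _; _; _].
    by apply: (@lax_scaled (- gi)) => //; vring.
  by hring u v.
- exists u, (- u - v); split; first by apply: unit_crsC; exact: unit_cyc2.
    rewrite cw_right /corv; congr pair.
      by rewrite cw_cyc; congr cw; vring.
    rewrite set3_swap; congr [set _; _; _].
    by apply: (@lax_scaled (- gi)) => //; vring.
  by hring u v.
- exists (gi *: v - u), (u + gi *: (- v - u)); split.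
  + by apply: unit_rho; exact: unit_crsC.
  + rewrite cw_right /corv -cw_rho; congr pair.
    rewrite set3_swap'; congr [set _; _; _].
    * by apply: (@lax_scaled (- 1)) => //; vring.
    * by apply: (@lax_scaled (- gi)) => //; vring.
    * by congr lax; vring.
  + by hring u v.
Qed.

Lemma corv_carries (u v : vec) : crs u v \is a GRing.unit ->
  carries (corv u v) u (gi *: v).
Proof.
move=> uv; apply: Left_uv; split; first by vring.
exact: superbasis_std.
Qed.

Lemma mul_unit_eq0 (R : comUnitRingType) (x c : R) :
  c \is a GRing.unit -> x * c = 0 -> x = 0.
Proof. by move=> uc h; rewrite -[x](mulrK uc) h mul0r. Qed.

Lemma unit_neq0 (x : gint) : x \is a GRing.unit -> x <> 0.
Proof. by move=> ux x0; move: ux; rewrite x0. Qed.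

Lemma NoDup7_last (T : Type) (a b c d e f g : T) :
  List.NoDup [:: a; b; c; d; e; f; g] -> ~ [set a; b; c; d; e; f] g.
Proof. by move=> nd [[[[[h|h]|h]|h]|h]|h]; nodups; dcong. Qed.

(** Rotating the corner makes the first edges agree. The other two edges then agree up to order, and
    determinants of pairs of equal edges tie the units together. *)
Lemma corv_hv (u v u' v' : vec) :
  crs u v \is a GRing.unit -> crs u' v' \is a GRing.unit ->
  corv u v = corv u' v' -> hv u v = hv u' v'.
Proof.
have rotu (a b : vec) : crs a b \is a GRing.unit ->
    crs (gi *: b) (gi *: a - b) \is a GRing.unit.
  by rewrite (_ : crs (gi *: b) _ = crs a b) //; cring.
move=> + uv'; wlog eu : u v / lax u = lax u' => [wl uv e|].
  have : (corv u v).2 (lax u') by rewrite e; left; left.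
  case=> [[e1|e1]|e1].
  - exact: wl.
  - rewrite -hv_rot; apply: wl; first by rewrite lax_scale.
      exact: rotu.
    by rewrite -corv_rot.
  - rewrite -hv_rot -hv_rot; apply: wl.
    + rewrite e1; apply: (@lax_scaled (-1)) => //; vring.
    + exact: (rotu _ _ (rotu _ _ uv)).
    + by rewrite -!corv_rot.
move=> uv e; have [eu0 ue0 eu'] := lax_inj eu.
have : (corv u v).2 (lax v') by rewrite e; left; right.
have : (corv u v).2 (lax (u' + gi *: v')) by rewrite e; right.
move=> hz [[ev|ev]|ev].
- case: (unit_neq0 uv'); rewrite eu'.
  rewrite (_ : crs _ _ = - eu0 * crs v' u); last by cring.
  by rewrite (lax_crs ev) mulr0.
- have [f uf ev'] := lax_inj (esym ev).
  move: hz => [[/esym hz|/esym hz]|/esym hz].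
  + case: (unit_neq0 uf); apply: (mul_unit_eq0 uv); apply: (mul_unit_eq0 unit_gi).
    by rewrite -(lax_crs hz) eu' ev'; cring.
  + case: (unit_neq0 ue0); apply: (mul_unit_eq0 (unit_crsC uv)).
    by rewrite -(lax_crs hz) eu' ev'; cring.
  + have fe : f = eu0.
      apply/eqP; rewrite -subr_eq0; apply/eqP; apply: (mul_unit_eq0 unit_gi).
      apply: (mul_unit_eq0 uv).
      by rewrite -(lax_crs hz) eu' ev'; cring.
    by rewrite eu' ev' fe hv_unit.
- have [f uf ev'] := lax_inj (esym ev).
  move: hz => [[/esym hz|/esym hz]|/esym hz].
  + case: (unit_neq0 uf); apply: (mul_unit_eq0 (unit_crsC uv)).
    by rewrite -(lax_crs hz) eu' ev'; cring.
  + have fe : f = gi * eu0.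
      apply/eqP; rewrite -subr_eq0; apply/eqP; apply: (mul_unit_eq0 unit_gi).
      apply: (mul_unit_eq0 (unit_crsC uv)).
      by rewrite -(lax_crs hz) eu' ev'; cring.
    have ev2 : v' = eu0 *: (gi *: u - v) by rewrite ev' fe; vring.
    (* Here the corners have the same three edges in opposite cyclic order. The chambers must
       differ: [- u' - v'] would be a seventh edge of [cw u v]. *)
    have : edges (cw u' v') (lax (- u' - v')).
      by rewrite edges_walls; do 3 left; right.
    rewrite -[cw u' v']/(corv u' v').1 -e /= edges_walls.
    rewrite (_ : - u' - v' = eu0 *: ((- gi - 1) *: u + 1 *: v)); last first.
      by rewrite eu' ev2; vring.
    rewrite lax_scale //.
    have nd := @NoDup_comb u v [:: (1, 0); (0, 1); (-1, -1); (- gi, 1 - gi);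
      (gi - 1, -1); (1, gi); (- gi - 1, 1)] uv erefl.
    simpl in nd; move: nd.
    rewrite (_ : 1 *: u + 0 *: v = u); last by vring.
    rewrite (_ : 0 *: u + 1 *: v = v); last by vring.
    rewrite (_ : -1 *: u + -1 *: v = - u - v); last by vring.
    rewrite (_ : - gi *: u + _ = v + gi *: (- u - v)); last by vring.
    rewrite (_ : (gi - 1) *: u + _ = - u - v + gi *: u); last by vring.
    rewrite (_ : 1 *: u + gi *: v = u + gi *: v); last by vring.
    by move=> nd; case/(NoDup7_last nd).
  + case: (unit_neq0 ue0); apply: (mul_unit_eq0 unit_Ngi); apply: (mul_unit_eq0 uv).
    by rewrite -(lax_crs hz) eu' ev'; cring.
Qed.

Lemma NoDup6_first (T : Type) (u v w x y z : T) :
  List.NoDup [:: u; v; w; x; y; z] -> [/\ u <> v, v <> w & u <> w].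
Proof. by move=> nd; nodups; split; dcong. Qed.

Lemma NoDup6_trace (T : Type) (u v w x y z : T) (F := [set u; v; w]) :
  List.NoDup [:: u; v; w; x; y; z] ->
  [/\ [set u; v; z] `&` F = [set u; v], [set v; w; x] `&` F = [set v; w],
      [set w; u; y] `&` F = [set w; u] & [set x; y; z] `&` F = set0].
Proof.
move=> nd; split; apply/seteqP; rewrite /F; split=> t /=; try tauto.
- by case=> [[[->|->]|->]]; nodups; dcong.
- by case=> [[[->|->]|->]]; nodups; dcong.
- by case=> [[[->|->]|->]]; nodups; dcong.
- by case=> [[[->|->]|->]]; nodups; dcong.
Qed.

Lemma corner_trace (u v : vec) (T : set laxv) (w := - u - v)
    (F := [set lax u; lax v; lax w]) :
  crs u v \is a GRing.unit -> corner_of (cw u v) T -> T `&` F !=set0 ->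
  exists a b, [/\ crs a b \is a GRing.unit, (cw u v, T) = corv a b,
    T `&` F = [set lax a; lax b] &
    [\/ a = u /\ b = v, a = v /\ b = w | a = w /\ b = u]].
Proof.
move=> uv cT ne; have nd := left_NoDup uv.
have [t0 t1 t2 t3] := NoDup6_trace nd.
move: cT => /(walls_corner _ nd)[] eT; rewrite eT.
- by exists u, v; split=> //; constructor 1.
- exists v, w; split=> //; [exact: unit_cyc| by rewrite /corv -cw_cyc |by constructor 2].
- exists w, u; split=> //; [exact: unit_cyc2| |by constructor 3].
  by rewrite /corv (cw_cyc w u) (_ : - w - u = v) // /w; vring.
- by case: ne => t; rewrite eT /F /w t3.
Qed.

Lemma set2_eq (T : Type) (a b c d : T) : [set a; b] = [set c; d] ->
  (a = c \/ a = d) /\ (b = c \/ b = d).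
Proof.
move=> e; have : [set c; d] a by rewrite -e; left.
have : [set c; d] b by rewrite -e; right.
by case=> ->; case=> ->; tauto.
Qed.

(** A corner meeting the wall is known from the two edges of the wall that it contains. Within one
    chamber glued corners therefore coincide; across the wall [corv a b] meets [corv b a], which has
    the same form. *)
Lemma glued_hv (c c' : corner) : glued c c' ->
  exists a b a' b', [/\ crs a b \is a GRing.unit, crs a' b' \is a GRing.unit,
    c = corv a b, c' = corv a' b' & hv a b = hv a' b'].
Proof.
case: c c' => W T [W' T'] [[/= cW cT] [/= cW' cT'] [F [WF WF' ne eTF]]].
have [u [v [uv eW eF]]] := chamberP cW WF.
subst W; subst F.
have [a [b [uab eab Tab ab]]] := corner_trace uv cT ne.
move: ne; rewrite eTF => ne.
have [n1 n2 n3] := NoDup6_first (left_NoDup uv).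
have [eW'|eW'] := chamber_wall uv cW' WF'; subst W'.
  have [a' [b' [uab' eab' Tab' ab']]] := corner_trace uv cT' ne.
  move: eTF; rewrite Tab Tab' => eTF; have [h1 h2] := set2_eq eTF.
  exists a, b, a', b'; split=> //.
  have : a = a' /\ b = b'; last by case=> -> ->.
  case: ab h1 h2 => [] [-> ->]; case: ab' => [] [-> ->] => h1 h2;
    first [by split | exfalso; dcong].
have vu := unit_crsC uv.
have eS : [set lax u; lax v; lax (- u - v)] = [set lax v; lax u; lax (- v - u)].
  by rewrite set3_swap (addrC (- u)).
rewrite eS in ne.
have [a' [b' [uab' eab' Tab' ab']]] := corner_trace vu cT' ne.
move: eTF; rewrite Tab eS Tab' => eTF; have [h1 h2] := set2_eq eTF.
exists a, b, a', b'; split=> //.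
have : a = b' /\ b = a'; last by case=> -> ->; rewrite hv_flip.
rewrite (addrC (- v)) in ab'.
case: ab h1 h2 => [] [-> ->]; case: ab' => [] [-> ->] => h1 h2;
  first [by split | exfalso; dcong].
Qed.

(** * Identification of corners and the action of SL2(Z) *)

Definition linked : corner -> corner -> Prop := clos_refl_sym_trans corner glued.

(** Both directions are carried along because the closure is symmetric, and every presentation of
    the corner is allowed so that the steps can be chained. *)
Lemma linked_hv (c c' : corner) : linked c c' ->
  (forall u v, crs u v \is a GRing.unit -> c = corv u v ->
    exists u' v', [/\ crs u' v' \is a GRing.unit, c' = corv u' v' & hv u v = hv u' v'])
  /\ (forall u v, crs u v \is a GRing.unit -> c' = corv u v ->
    exists u' v', [/\ crs u' v' \is a GRing.unit, c = corv u' v' & hv u v = hv u' v']).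
Proof.
elim=> {c c'} [c c' /glued_hv[a [b [a' [b' [uab uab' ec ec' h]]]]]|c|c c' _ [IH1 IH2]
  |c c' c'' _ [IH1 IH2] _ [IH3 IH4]].
- split=> u v uv e.
    exists a', b'; split=> //; rewrite -h; apply: corv_hv => //.
    by rewrite -e.
  exists a, b; split=> //; rewrite h; apply: corv_hv => //.
  by rewrite -e.
- by split=> u v uv e; exists u, v.
- by split.
- split=> u v uv e.
    have [u' [v' [uv' e' ->]]] := IH1 _ _ uv e.
    exact: IH3.
  have [u' [v' [uv' e' ->]]] := IH4 _ _ uv e.
  exact: IH2.
Qed.

Lemma glued_flip (u v : vec) : crs u v \is a GRing.unit ->
  glued (corv u v) (corv v u).
Proof.
move=> uv; have vu := unit_crsC uv.
split; [by apply/is_cornerP; exists u, v | by apply/is_cornerP; exists v, u|].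
have [t0 _ _ _] := NoDup6_trace (left_NoDup uv).
have [t1 _ _ _] := NoDup6_trace (left_NoDup vu).
have eS : [set lax u; lax v; lax (- u - v)] = [set lax v; lax u; lax (- v - u)].
  by rewrite set3_swap (addrC (- u)).
exists [set lax u; lax v; lax (- u - v)] => /=; split.
- by left; left; left.
- by rewrite eS; left; left; left.
- by exists (lax u) => /=; tauto.
- by rewrite t0 eS t1 setUC.
Qed.

Lemma kclass_eq (c c' : corner) : kclass c = kclass c' <-> linked c c'.
Proof.
split=> [e|l].
  by have : kclass c' c' by [exact: rst_refl]; rewrite -e.
apply/seteqP; split=> x h.
  by apply: rst_trans h; exact: rst_sym.
exact: rst_trans l h.
Qed.

(* The corner labelled by [(a, b)]. *)
Definition kcor (a b : vec) : corner := corv a (- gi *: b).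

Definition vpair (a b : vec) (p q : int) : vec := zi p *: a + zi q *: b.

Lemma unit_kcor (a b : vec) : crs a b \is a GRing.unit ->
  crs a (- gi *: b) \is a GRing.unit.
Proof.
by move=> ab; rewrite (_ : crs _ _ = - gi * crs a b) ?unitrM ?ab //; cring.
Qed.

Lemma linked_flip (a b : vec) : crs a b \is a GRing.unit ->
  linked (kcor a b) (kcor b (- a)).
Proof.
move=> ab; rewrite /kcor.
rewrite -(corv_unit b (- gi *: - a) unit_Ngi).
rewrite (_ : - gi *: (- gi *: - a) = a); last by vring.
by apply: rst_step; apply: glued_flip; exact: unit_kcor.
Qed.

Lemma kcor_rot (a b : vec) : kcor a b = kcor b (- a - b).
Proof. by rewrite /kcor corv_rot; congr corv; vring. Qed.

(** One flip followed by two rotations of the corner is a shear. *)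
Lemma linked_subl (a b : vec) : crs a b \is a GRing.unit ->
  linked (kcor a b) (kcor (a - b) b).
Proof.
move=> ab; have := linked_flip ab.
by rewrite (kcor_rot b) (kcor_rot (- a)); congr (linked _ (kcor _ _)); vring.
Qed.

Lemma linked_addl (a b : vec) : crs a b \is a GRing.unit ->
  linked (kcor a b) (kcor (a + b) b).
Proof.
move=> ab; apply: rst_sym; rewrite -{2}[a](addrK b); apply: linked_subl.
by rewrite (_ : crs _ _ = crs a b) //; cring.
Qed.

Lemma linked_addr (a b : vec) : crs a b \is a GRing.unit ->
  linked (kcor a b) (kcor a (b + a)).
Proof.
move=> ab; have ba : crs b (- a) \is a GRing.unit.
  by rewrite (_ : crs _ _ = crs a b) //; cring.
have l1 := linked_flip ab; have l2 := linked_subl ba.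
have l3 : linked (kcor (b - - a) (- a)) (kcor (- a) (- (b - - a))).
  by apply: linked_flip; rewrite (_ : crs _ _ = crs a b) //; cring.
have := rst_trans _ _ _ _ _ l1 (rst_trans _ _ _ _ _ l2 l3).
rewrite /linked /kcor.
rewrite -(corv_unit (- a) _ (unitrN1 _)).
by congr (clos_refl_sym_trans _ _ _ (corv _ _)); vring.
Qed.

Lemma linked_subr (a b : vec) : crs a b \is a GRing.unit ->
  linked (kcor a b) (kcor a (b - a)).
Proof.
move=> ab; apply: rst_sym; rewrite -{2}[b](subrK a); apply: linked_addr.
by rewrite (_ : crs _ _ = crs a b) //; cring.
Qed.

Lemma unit_SL2 (a b : vec) (p q r s : int) : crs a b \is a GRing.unit ->
  p * s - q * r = 1 ->
  crs (vpair a b p q) (vpair a b r s) \is a GRing.unit.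
Proof.
move=> ab d1; rewrite /vpair crs_comb.
rewrite (_ : _ - _ = 1) ?mul1r //.
have -> : zi p * zi s - zi q * zi r = zi (p * s - q * r) by congr Complex; ring.
by rewrite d1.
Qed.

Lemma zi0 : zi 0 = 0. Proof. by []. Qed.
Lemma zi1 : zi 1 = 1. Proof. by []. Qed.
Lemma ziN (p : int) : zi (- p) = - zi p. Proof. by congr Complex. Qed.

Lemma kcorN (a b : vec) : kcor (- a) (- b) = kcor a b.
Proof.
rewrite /kcor -(corv_unit a _ (unitrN1 _)).
by congr corv; vring.
Qed.

Lemma linked_shear (a b : vec) (k : int) : crs a b \is a GRing.unit ->
  linked (kcor a b) (kcor (a + zi k *: b) b).
Proof.
move=> ab; elim/int_rect: k => [|n IH|n IH].
- rewrite (_ : zi 0 = 0) // scale0r addr0; exact: rst_refl.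
- apply: rst_trans IH _; rewrite (_ : zi n.+1 = zi n + 1); last first.
    by rewrite -addn1 PoszD.
  rewrite scalerDl scale1r addrA; apply: linked_addl.
  by rewrite (_ : crs _ _ = crs a b) //; cring.
- apply: rst_trans IH _; rewrite (_ : zi (- n.+1%:Z) = zi (- n%:Z) - 1); last first.
    by rewrite -addn1 PoszD opprD.
  rewrite scalerDl scaleN1r addrA; apply: linked_subl.
  by rewrite (_ : crs _ _ = crs a b) //; cring.
Qed.

Lemma mulz_eq1 (p s : int) : p * s = 1 -> (p = 1 /\ s = 1) \/ (p = -1 /\ s = -1).
Proof.
move=> h; have : (`|p| * `|s|)%N == 1%N by rewrite -abszM h.
rewrite muln_eq1 => /andP[/eqP hp /eqP hs].
have [p1|p1] : p = 1 \/ p = -1 by lia.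
  by left; lia.
by right; lia.
Qed.

(** Euclid's algorithm on the coefficients [p], [r] of [a]: shears lower [|p| + |r|] until one of
    them vanishes. What is left is a shear up to sign, after a flip when [p] is zero. *)
Lemma linked_SL2 (a b : vec) (p q r s : int) : crs a b \is a GRing.unit ->
  p * s - q * r = 1 ->
  linked (kcor a b) (kcor (vpair a b p q) (vpair a b r s)).
Proof.
move=> ab.
have addE (p1 q1 p2 q2 : int) :
    vpair a b p1 q1 + vpair a b p2 q2 = vpair a b (p1 + p2) (q1 + q2).
  rewrite /vpair (_ : zi (p1 + p2) = zi p1 + zi p2) //.
  by rewrite (_ : zi (q1 + q2) = zi q1 + zi q2) //; vring.
have subE (p1 q1 p2 q2 : int) :
    vpair a b p1 q1 - vpair a b p2 q2 = vpair a b (p1 - p2) (q1 - q2).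
  rewrite /vpair (_ : zi (p1 - p2) = zi p1 - zi p2) //.
  by rewrite (_ : zi (q1 - q2) = zi q1 - zi q2) //; vring.
have base (p1 q1 s1 : int) : p1 * s1 = 1 ->
    linked (kcor a b) (kcor (vpair a b p1 q1) (vpair a b 0 s1)).
  move=> d1; have [[-> ->]|[-> ->]] : (p1 = 1 /\ s1 = 1) \/ (p1 = -1 /\ s1 = -1).
      exact: mulz_eq1.
    have := linked_shear q1 ab; rewrite /vpair zi0 zi1.
    by congr (linked _ (kcor _ _)); vring.
  have := linked_shear (- q1) ab; rewrite -(kcorN (_ + _)) /vpair.
  rewrite !ziN zi0 zi1.
  by congr (linked _ (kcor _ _)); vring.
have [n] := ubnP (`|p| + `|r|)%N.
elim: n p q r s => // n IH p q r s le_n d1.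
have U := unit_SL2 ab d1.
have [r0|rn0] := eqVneq r 0.
  by subst r; apply: base; lia.
have [p0|pn0] := eqVneq p 0.
  subst p; apply: rst_trans (rst_sym _ _ _ _ (linked_flip U)).
  rewrite (_ : - vpair a b 0 q = vpair a b 0 (- q)); last first.
    by rewrite /vpair ziN zi0; vring.
  by apply: base; lia.
have [le_rp|lt_pr] := leqP `|r| `|p|.
  have [pr|pr] : 0 < p * r \/ p * r < 0 by nia.
    apply: rst_trans (rst_sym _ _ _ _ (linked_subl U)); rewrite subE.
    by apply: IH; nia.
  apply: rst_trans (rst_sym _ _ _ _ (linked_addl U)); rewrite addE.
  by apply: IH; nia.
have [pr|pr] : 0 < p * r \/ p * r < 0 by nia.
  apply: rst_trans (rst_sym _ _ _ _ (linked_subr U)); rewrite subE.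
  by apply: IH; nia.
apply: rst_trans (rst_sym _ _ _ _ (linked_addr U)); rewrite addE.
by apply: IH; nia.
Qed.

(* With B = conj a * d - conj b * c = 1 and conj a * b, conj c * d real, every entry
   x satisfies x = conj x * (a d - b c); hence the matrix is real up to a unit. *)
Lemma hermg_one (a b c d : gint) : a * d - b * c \is a GRing.unit ->
  hermg a b c d = Form 0 1 0 0 ->
  exists (e : gint) (p q r s : int), [/\ e \is a GRing.unit, p * s - q * r = 1,
    a = e * zi p, b = e * zi r & (c = e * zi q /\ d = e * zi s)].
Proof.
case: a b c d => [a1 a2] [b1 b2] [c1 c2] [d1 d2] /gunitP D [/= hA hB hC hD].
pose t1 : int := a1 * d1 - a2 * d2 - (b1 * c1 - b2 * c2).
pose t2 : int := a1 * d2 + a2 * d1 - (b1 * c2 + b2 * c1).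
have eD : (Complex a1 a2 : gint) * (Complex d1 d2 : gint) -
  (Complex b1 b2 : gint) * (Complex c1 c2 : gint) = Complex t1 t2 :> gint by [].
(* In this identity and the seven after it, 1 and 0 are replaced by the left sides of [hB] and [hC];
   the surplus over the claim is a multiple of the left side of [hA] or [hD], hence zero. *)
have Ea1 : a1 = a1 * t1 + a2 * t2.
  have := erefl (a1 * 1 - a2 * 0); rewrite -{1}hB -{1}hC.
  have -> : a1 * (a1 * d1 + a2 * d2 - b1 * c1 - b2 * c2) -
    a2 * (a1 * d2 - a2 * d1 - b1 * c2 + b2 * c1) =
    a1 * t1 + a2 * t2 - 2 * c2 * (a1 * b2 - a2 * b1) by rewrite /t1 /t2; ring.
  by rewrite hD; lia.
have Ea2 : a2 = a1 * t2 - a2 * t1.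
  have := erefl (a1 * 0 + a2 * 1); rewrite -{1}hB -{1}hC.
  have -> : a1 * (a1 * d2 - a2 * d1 - b1 * c2 + b2 * c1) +
    a2 * (a1 * d1 + a2 * d2 - b1 * c1 - b2 * c2) =
    a1 * t2 - a2 * t1 + 2 * c1 * (a1 * b2 - a2 * b1) by rewrite /t1 /t2; ring.
  by rewrite hD; lia.
have Eb1 : b1 = b1 * t1 + b2 * t2.
  have := erefl (b1 * 1 - b2 * 0); rewrite -{1}hB -{1}hC.
  have -> : b1 * (a1 * d1 + a2 * d2 - b1 * c1 - b2 * c2) -
    b2 * (a1 * d2 - a2 * d1 - b1 * c2 + b2 * c1) =
    b1 * t1 + b2 * t2 - 2 * d2 * (a1 * b2 - a2 * b1) by rewrite /t1 /t2; ring.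
  by rewrite hD; lia.
have Eb2 : b2 = b1 * t2 - b2 * t1.
  have := erefl (b1 * 0 + b2 * 1); rewrite -{1}hB -{1}hC.
  have -> : b1 * (a1 * d2 - a2 * d1 - b1 * c2 + b2 * c1) +
    b2 * (a1 * d1 + a2 * d2 - b1 * c1 - b2 * c2) =
    b1 * t2 - b2 * t1 + 2 * d1 * (a1 * b2 - a2 * b1) by rewrite /t1 /t2; ring.
  by rewrite hD; lia.
have Ec1 : c1 = c1 * t1 + c2 * t2.
  have := erefl (c1 * 1 + c2 * 0); rewrite -{1}hB -{1}hC.
  have -> : c1 * (a1 * d1 + a2 * d2 - b1 * c1 - b2 * c2) +
    c2 * (a1 * d2 - a2 * d1 - b1 * c2 + b2 * c1) =
    c1 * t1 + c2 * t2 + 2 * a2 * (c1 * d2 - c2 * d1) by rewrite /t1 /t2; ring.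
  by rewrite hA; lia.
have Ec2 : c2 = c1 * t2 - c2 * t1.
  have := erefl (c2 * 1 - c1 * 0); rewrite -{1}hB -{1}hC.
  have -> : c2 * (a1 * d1 + a2 * d2 - b1 * c1 - b2 * c2) -
    c1 * (a1 * d2 - a2 * d1 - b1 * c2 + b2 * c1) =
    c1 * t2 - c2 * t1 - 2 * a1 * (c1 * d2 - c2 * d1) by rewrite /t1 /t2; ring.
  by rewrite hA; lia.
have Ed1 : d1 = d1 * t1 + d2 * t2.
  have := erefl (d1 * 1 + d2 * 0); rewrite -{1}hB -{1}hC.
  have -> : d1 * (a1 * d1 + a2 * d2 - b1 * c1 - b2 * c2) +
    d2 * (a1 * d2 - a2 * d1 - b1 * c2 + b2 * c1) =
    d1 * t1 + d2 * t2 + 2 * b2 * (c1 * d2 - c2 * d1) by rewrite /t1 /t2; ring.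
  by rewrite hA; lia.
have Ed2 : d2 = d1 * t2 - d2 * t1.
  have := erefl (d2 * 1 - d1 * 0); rewrite -{1}hB -{1}hC.
  have -> : d2 * (a1 * d1 + a2 * d2 - b1 * c1 - b2 * c2) -
    d1 * (a1 * d2 - a2 * d1 - b1 * c2 + b2 * c1) =
    d1 * t2 - d2 * t1 - 2 * b1 * (c1 * d2 - c2 * d1) by rewrite /t1 /t2; ring.
  by rewrite hA; lia.
move: D; rewrite eD; case=> -[T1 T2]; rewrite T1 T2 in Ea1 Ea2 Eb1 Eb2 Ec1 Ec2 Ed1 Ed2.
- have [a20 b20 c20 d20] : [/\ a2 = 0, b2 = 0, c2 = 0 & d2 = 0] by split; lia.
  subst a2 b2 c2 d2; exists 1, a1, c1, b1, d1; rewrite !mul1r; split=> //.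
  by move: hB; lia.
- have [a20 b20 c20 d20] : [/\ a1 = 0, b1 = 0, c1 = 0 & d1 = 0] by split; lia.
  subst a1 b1 c1 d1; exists gi, a2, c2, b2, d2; split=> //.
  + by move: hB; lia.
  + by congr Complex; ring.
  + by congr Complex; ring.
  + by split; congr Complex; ring.
(* With determinant i or -i every entry is an integer multiple of 1 + i or of 1 - i, which makes the
   imaginary part of the determinant even. *)
- have [a20 b20 c20 d20] : [/\ a2 = a1, b2 = b1, c2 = c1 & d2 = d1] by split; lia.
  by exfalso; move: T2; rewrite /t2 a20 b20 c20 d20; lia.
- have [a20 b20 c20 d20] : [/\ a2 = -a1, b2 = -b1, c2 = -c1 & d2 = -d1] by split; lia.
  by exfalso; move: T2; rewrite /t2 a20 b20 c20 d20; lia.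
Qed.

(** * Oriented circles as forms *)

Section Circles.
Variable R : realType.
Local Notation C := (complex R).
Local Notation "x %:C" := (real_complex R x).
Local Notation Re := complex.Re.
Local Notation Im := complex.Im.

(** The Hermitian form evaluated at the homogeneous coordinates (z, 1), and (1, 0) for infinity;
    another choice of coordinates changes it by a positive factor. *)
Definition hval (x : form R) (p : Cinf R) : R :=
  match p with
  | Some z => fA x * (Re z ^+ 2 + Im z ^+ 2) - (Re z * fC x + Im z * fB x) + fD x
  | None => fA x
  end.

Definition oc (x : form R) : ocircle R :=
  OCircle [set p | hval x p = 0] [set p | 0 < hval x p].

Definition disc (T : pzRingType) (x : form T) : T :=
  fB x ^+ 2 + fC x ^+ 2 - 4 * fA x * fD x.

(** The polarization of [disc], of signature (3, 1). *)
Definition form2 (T : pzRingType) (x y : form T) : T :=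
  fB x * fB y + fC x * fC y - 2 * (fA x * fD y + fD x * fA y).

Lemma ocP (c : ocircle R) (x : form R) :
  (forall p, pts c p <-> hval x p = 0) ->
  (forall p, interior c p <-> 0 < hval x p) -> c = oc x.
Proof.
case: c => P I /= hP hI; rewrite /oc; congr OCircle.
  by apply/seteqP; split=> p /hP.
by apply/seteqP; split=> p /hI.
Qed.

Lemma norm_cmp (z : C) (r : R) : 0 < r ->
  [/\ (`|z| = r%:C <-> Re z ^+ 2 + Im z ^+ 2 = r ^+ 2),
      (`|z| < r%:C) = (Re z ^+ 2 + Im z ^+ 2 < r ^+ 2) &
      (r%:C < `|z|) = (r ^+ 2 < Re z ^+ 2 + Im z ^+ 2)].
Proof.
move=> r0; set m := _ + _; have m0 : 0 <= m by rewrite addr_ge0 ?sqr_ge0.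
have nE : `|z| = (Num.sqrt m)%:C by case: z @m m0.
have sm : Num.sqrt m ^+ 2 = m by rewrite sqr_sqrtr.
have s0 := sqrtr_ge0 m.
rewrite nE !ltcR -{2 4 6}sm; split.
- split=> [[->//]|/eqP]; rewrite eqrXn2 // ?ltW // => /eqP ->//.
- by rewrite ltr_pXn2r // ?nnegrE // ltW.
- by rewrite ltr_pXn2r // ?nnegrE // ltW.
Qed.

(** The coefficients are those of (r^2 - |z - p|^2) / (2r); the denominator normalizes [disc] to
    1. *)
Lemma cw_oc (p : C) (r : R) : 0 < r -> cw_circle p r =
  oc (Form (- (2 * r)^-1) (- Im p / r) (- Re p / r)
           ((r ^+ 2 - Re p ^+ 2 - Im p ^+ 2) / (2 * r))).
Proof.
move=> r0; have rn : r != 0 by rewrite gt_eqF.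
have hE (z : C) : hval (Form (- (2 * r)^-1) (- Im p / r) (- Re p / r)
   ((r ^+ 2 - Re p ^+ 2 - Im p ^+ 2) / (2 * r))) (Some z) =
   (r ^+ 2 - (Re (z - p) ^+ 2 + Im (z - p) ^+ 2)) / (2 * r).
  case: z p => [x y] [a b] /=; field; rewrite rn //.
have r20 : 0 < (2 * r)^-1 by rewrite invr_gt0 mulr_gt0.
apply: ocP => -[z|] /=.
- split.
    move=> [t /= + [<-]]; have [-> _ _] := norm_cmp (t - p) r0 => h.
    by rewrite -[LHS]/(hval (Form _ _ _ _) (Some t)) hE h subrr mul0r.
  rewrite -[X in X = 0]/(hval (Form _ _ _ _) (Some z)) hE => /eqP.
  rewrite mulf_eq0 (gt_eqF r20) orbF subr_eq0 => /eqP h.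
  by exists z => //=; have [-> _ _] := norm_cmp (z - p) r0.
- by split=> [[t]//|/eqP]; rewrite oppr_eq0 gt_eqF.
- split.
    move=> [t /= + [<-]]; have [_ -> _] := norm_cmp (t - p) r0 => h.
    by rewrite -[ltRHS]/(hval (Form _ _ _ _) (Some t)) hE divr_gt0 ?mulr_gt0 ?subr_gt0.
  rewrite -[ltRHS]/(hval (Form _ _ _ _) (Some z)) hE pmulr_lgt0 // subr_gt0 => h.
  by exists z => //=; have [_ -> _] := norm_cmp (z - p) r0.
- by split=> [[t]//|]; rewrite oppr_gt0 ltNge (ltW r20).
Qed.

Lemma ccw_oc (p : C) (r : R) : 0 < r -> ccw_circle p r =
  oc (Form ((2 * r)^-1) (Im p / r) (Re p / r)
           (- (r ^+ 2 - Re p ^+ 2 - Im p ^+ 2) / (2 * r))).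
Proof.
move=> r0; have rn : r != 0 by rewrite gt_eqF.
have hE (z : C) : hval (Form ((2 * r)^-1) (Im p / r) (Re p / r)
   (- (r ^+ 2 - Re p ^+ 2 - Im p ^+ 2) / (2 * r))) (Some z) =
   ((Re (z - p) ^+ 2 + Im (z - p) ^+ 2) - r ^+ 2) / (2 * r).
  case: z p => [x y] [a b] /=; field; rewrite rn //.
have r20 : 0 < (2 * r)^-1 by rewrite invr_gt0 mulr_gt0.
apply: ocP => -[z|] /=.
- split.
    move=> [t /= + [<-]]; have [-> _ _] := norm_cmp (t - p) r0 => h.
    by rewrite -[LHS]/(hval (Form _ _ _ _) (Some t)) hE h subrr mul0r.
  rewrite -[X in X = 0]/(hval (Form _ _ _ _) (Some z)) hE => /eqP.
  rewrite mulf_eq0 (gt_eqF r20) orbF subr_eq0 => /eqP h.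
  by exists z => //=; have [-> _ _] := norm_cmp (z - p) r0.
- by split=> [[t]//|/eqP]; rewrite gt_eqF.
- split.
    move=> [//|[t /= + [<-]]]; have [_ _ ->] := norm_cmp (t - p) r0 => h.
    by rewrite -[ltRHS]/(hval (Form _ _ _ _) (Some t)) hE divr_gt0 ?mulr_gt0 ?subr_gt0.
  rewrite -[ltRHS]/(hval (Form _ _ _ _) (Some z)) hE pmulr_lgt0 // subr_gt0 => h.
  by right; exists z => //=; have [_ _ ->] := norm_cmp (z - p) r0.
- by split=> // _; left.
Qed.

Lemma oline_oc (p d : C) (n : R) : 0 < n -> n ^+ 2 = Re d ^+ 2 + Im d ^+ 2 ->
  oline p d = oc (Form 0 (Re d / n) (- Im d / n) ((Im p * Re d - Re p * Im d) / n)).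
Proof.
move=> n0 n2; have nn : n != 0 by rewrite gt_eqF.
have dn : d != 0.
  apply/eqP => d0; move: n2; rewrite d0 /= expr0n addr0 => /eqP.
  by rewrite expf_eq0 /= (negbTE nn).
set x := Form _ _ _ _.
have hE (w : C) : hval x (Some (p + w * d)) = - n * Im w.
  move: n2 @x {dn}; case: p d w => [p1 p2] [d1 d2] [w1 w2] /= n2.
  have -> : - n * w2 = - n ^+ 2 * w2 / n by field.
  by rewrite n2; field.
have zE (z : C) : z = p + (z - p) / d * d by rewrite divfK // addrC subrK.
apply: ocP => -[z|] /=.
- split.
    move=> [//|[t /= _ [<-]]]; rewrite -[LHS]/(hval x (Some (p + t%:C * d))) hE /=.
    by rewrite mulr0.
  rewrite -[X in X = 0]/(hval x (Some z)) {1}(zE z) hE => /eqP.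
  rewrite mulf_eq0 oppr_eq0 (negbTE nn) /= => /eqP h.
  right; exists (Re ((z - p) / d)) => //; congr Some; rewrite [RHS]zE.
  by congr (_ + _ * _); move: h; case: ((z - p) / d) => a b /= ->.
- by split=> // _; left.
- split.
    move=> [t /= h [<-]]; rewrite -[ltRHS]/(hval x (Some t)) (zE t) hE.
    by rewrite mulNr oppr_gt0 pmulr_rlt0.
  rewrite -[ltRHS]/(hval x (Some z)) {1}(zE z) hE mulNr oppr_gt0 pmulr_rlt0 // => h.
  by exists z.
- by split=> [[t]//|]; rewrite ltxx.
Qed.

Lemma is_ocircleP (c : ocircle R) :
  is_ocircle c <-> exists2 x, disc x = 1 & c = oc x.
Proof.
split.
  case=> [[p [r [r0 ->]]]|[p [r [r0 ->]]]|[p [d [d0 ->]]]].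
  - rewrite cw_oc //; eexists; last reflexivity.
    by rewrite /disc /=; field; rewrite gt_eqF.
  - rewrite ccw_oc //; eexists; last reflexivity.
    by rewrite /disc /=; field; rewrite gt_eqF.
  - pose m := Re d ^+ 2 + Im d ^+ 2.
    have m0 : 0 < m.
      rewrite lt_def addr_ge0 ?sqr_ge0 // andbT.
      apply/eqP => /eqP; rewrite paddr_eq0 ?sqr_ge0 // !expf_eq0 /= => /andP[].
      by move: d0; case: (d) => a b /= d0 /eqP h1 /eqP h2; rewrite h1 h2 eqxx in d0.
    have n0 : 0 < Num.sqrt m by rewrite sqrtr_gt0.
    have n2 : Num.sqrt m ^+ 2 = m by rewrite sqr_sqrtr ?ltW.
    rewrite (oline_oc p n0 n2); eexists; last reflexivity.
    rewrite /disc /= !exprMn exprVn sqrrN -mulrDl -/m n2 mulfV ?gt_eqF //.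
    by rewrite mulr0 mul0r subr0.
move=> [[A B D E]]; rewrite /disc /= => d1 ->.
have d1' : B ^+ 2 + D ^+ 2 = 1 + 4 * A * E.
  by move/eqP: d1; rewrite subr_eq => /eqP.
have [A0|A0|A0] := ltrgtP A 0.
- constructor 1; exists (Complex (D / (2 * A)) (B / (2 * A))), (- (2 * A)^-1).
  have An : A != 0 by rewrite lt_eqF.
  have r0 : 0 < - (2 * A)^-1 by rewrite oppr_gt0 invr_lt0 pmulr_rlt0.
  split=> //; rewrite cw_oc //=; congr oc; congr Form; try by field.
  have -> : E = (B ^+ 2 + D ^+ 2 - 1) / (4 * A) by rewrite d1'; field.
  by field.
- constructor 2; exists (Complex (D / (2 * A)) (B / (2 * A))), ((2 * A)^-1).
  have An : A != 0 by rewrite gt_eqF.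
  have r0 : 0 < (2 * A)^-1 by rewrite invr_gt0 mulr_gt0.
  split=> //; rewrite ccw_oc //=; congr oc; congr Form; try by field.
  have -> : E = (B ^+ 2 + D ^+ 2 - 1) / (4 * A) by rewrite d1'; field.
  by field.
- subst A; constructor 3; exists (Complex (E * D) (E * B)), (Complex B (- D)).
  have n2 : (1 : R) ^+ 2 = B ^+ 2 + (- D) ^+ 2.
    by rewrite expr1n sqrrN d1' mulr0 mul0r addr0.
  split.
    apply/eqP => -[B0 D0]; move: n2; rewrite B0 D0 expr0n addr0 expr1n => /eqP.
    by rewrite oner_eq0.
  rewrite (@oline_oc _ _ 1) //; congr oc; congr Form => /=; rewrite ?divr1 ?opprK //.
  have -> : E * B * B - E * D * - D = E * (B ^+ 2 + (- D) ^+ 2) by ring.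
  by rewrite -n2 expr1n mulr1.
Qed.

Definition form1 : form R := Form 0 1 0 0.

Lemma real_circle_oc : real_circle R = oc form1.
Proof.
rewrite /real_circle (@oline_oc _ _ 1) //=; last by rewrite expr0n addr0.
by rewrite divr1 oppr0 !mul0r subrr mul0r.
Qed.
End Circles.

(** * Moebius maps in homogeneous coordinates *)

Section Moebius.
Variable R : realType.
Local Notation C := (complex R).
Local Notation Re := complex.Re.
Local Notation Im := complex.Im.

Definition hom (p : Cinf R) : C * C := if p is Some z then (z, 1) else (1, 0).
Definition proj (z : C * C) : Cinf R :=
  if z.2 == 0 then None else Some (z.1 / z.2).

Definition cscale (k : C) (z : C * C) : C * C := (k * z.1, k * z.2).

Lemma projK (p : Cinf R) : proj (hom p) = p.
Proof. by case: p => [z|]; rewrite /proj /= ?eqxx // oner_eq0 divr1. Qed.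

Lemma hom_neq0 (p : Cinf R) : hom p != (0, 0).
Proof.
by case: p => [z|]; rewrite /= xpair_eqE oner_eq0 ?andbF.
Qed.

Lemma hom_proj (z : C * C) : z != (0, 0) ->
  exists2 k, k != 0 & z = cscale k (hom (proj z)).
Proof.
case: z => z1 z2; rewrite xpair_eqE /proj /=; case: (eqVneq z2 0) => /= [->|z20].
  by rewrite andbT => z10; exists z1; rewrite /cscale //= mulr1 mulr0.
by move=> _; exists z2; rewrite /cscale //= mulr1 mulrC divfK.
Qed.

Lemma proj_scale (k : C) (z : C * C) : k != 0 -> proj (cscale k z) = proj z.
Proof.
move=> k0; rewrite /proj /= mulf_eq0 (negbTE k0) /=.
by case: eqP => // _; rewrite -mulf_div divff // mul1r.
Qed.

Definition mulv (a b c d : C) (z : C * C) : C * C :=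
  (a * z.1 + b * z.2, c * z.1 + d * z.2).

Definition mob (a b c d : C) (p : Cinf R) : Cinf R := proj (mulv a b c d (hom p)).

Lemma moebius_mob (M : 'M[C]_2) (p : Cinf R) :
  moebius M p = mob (M ord0 ord0) (M ord0 ord_max) (M ord_max ord0) (M ord_max ord_max) p.
Proof.
case: p => [z|]; rewrite /mob /proj /= ?mulr1 ?mulr0 ?addr0 //.
Qed.

Lemma mob_proj (a b c d : C) (z : C * C) : z != (0, 0) ->
  mob a b c d (proj z) = proj (mulv a b c d z).
Proof.
move=> /hom_proj[k k0 e]; rewrite {2}e.
have -> : mulv a b c d (cscale k (hom (proj z))) =
  cscale k (mulv a b c d (hom (proj z))) by rewrite /mulv /cscale /=; congr pair; ring.
by rewrite proj_scale.
Qed.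

Lemma mulv_neq0 (a b c d : C) (z : C * C) : a * d - b * c != 0 -> z != (0, 0) ->
  mulv a b c d z != (0, 0).
Proof.
move=> D; apply: contraNN => /eqP[e1 e2]; case: z e1 e2 => z1 z2 /= e1 e2.
rewrite xpair_eqE; apply/andP; split; rewrite -(mulrI_eq0 _ (lregP D)); apply/eqP.
  have -> : (a * d - b * c) * z1 = d * (a * z1 + b * z2) - b * (c * z1 + d * z2) by ring.
  by rewrite e1 e2 !mulr0 subrr.
have -> : (a * d - b * c) * z2 = a * (c * z1 + d * z2) - c * (a * z1 + b * z2) by ring.
by rewrite e1 e2 !mulr0 subrr.
Qed.

Lemma mob_comp (a b c d a' b' c' d' : C) (p : Cinf R) : a' * d' - b' * c' != 0 ->
  mob a b c d (mob a' b' c' d' p) =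
  mob (a * a' + b * c') (a * b' + b * d') (c * a' + d * c') (c * b' + d * d') p.
Proof.
move=> D; rewrite {2}/mob mob_proj; last by rewrite mulv_neq0 ?hom_neq0.
by rewrite /mob; congr proj; rewrite /mulv /=; congr pair; ring.
Qed.

Lemma mob_scalar (k : C) (p : Cinf R) : k != 0 -> mob k 0 0 k p = p.
Proof.
move=> k0; rewrite -[RHS]projK -(proj_scale _ k0) /mob; congr proj.
by rewrite /mulv /cscale; congr pair; ring.
Qed.

Lemma mobK (a b c d : C) : a * d - b * c != 0 ->
  cancel (mob a b c d) (mob d (- b) (- c) a).
Proof.
move=> D p; rewrite mob_comp // -[RHS](mob_scalar _ D).
by congr mob; ring.
Qed.

Lemma det_adj (a b c d : C) : d * a - - b * - c = a * d - b * c.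
Proof. by ring. Qed.

Lemma mobVK (a b c d : C) : a * d - b * c != 0 ->
  cancel (mob d (- b) (- c) a) (mob a b c d).
Proof.
move=> D p; rewrite mob_comp ?det_adj // -[RHS](mob_scalar p D).
by congr mob; ring.
Qed.

Definition fH (x : form R) (z : C * C) : R :=
  fA x * (Re z.1 ^+ 2 + Im z.1 ^+ 2)
  - ((Re z.1 * Re z.2 + Im z.1 * Im z.2) * fC x
     + (Im z.1 * Re z.2 - Re z.1 * Im z.2) * fB x)
  + fD x * (Re z.2 ^+ 2 + Im z.2 ^+ 2).

Lemma hval_hom (x : form R) (p : Cinf R) : hval x p = fH x (hom p).
Proof. by case: p => [[a b]|]; rewrite /fH /=; ring. Qed.

Definition nsq (z : C) : R := Re z ^+ 2 + Im z ^+ 2.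

Lemma nsq_gt0 (z : C) : z != 0 -> 0 < nsq z.
Proof.
case: z => a b z0; rewrite lt_def /nsq addr_ge0 ?sqr_ge0 // andbT.
apply: contraNN z0; rewrite paddr_eq0 ?sqr_ge0 // !expf_eq0 /= => /andP[].
by move=> /eqP -> /eqP ->.
Qed.

Lemma fH_scale (x : form R) (k : C) (z : C * C) : fH x (cscale k z) = nsq k * fH x z.
Proof.
by case: k z => [k1 k2] [[a b] [c d]]; rewrite /fH /nsq /=; ring.
Qed.

(* Precomposition of the form with the adjugate matrix. *)
Definition act (a b c d : C) (x : form R) : form R :=
  let B := Complex (fB x) (fC x) in let Bc := Complex (fB x) (- fC x) in
  let cj z := Complex (Re z) (- Im z) in
  let B' := d * cj a * B - cj b * c * Bc
     + Complex 0 (2 * fA x) * (d * cj b) + Complex 0 (2 * fD x) * (c * cj a) in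
  Form (fA x * nsq d + Im (d * cj c * B) + fD x * nsq c)
       (Re B') (Im B')
       (fA x * nsq b + Im (b * cj a * B) + fD x * nsq a).

Lemma fH_act (a b c d : C) (x : form R) (z : C * C) :
  fH (act a b c d x) (mulv a b c d z) = nsq (a * d - b * c) * fH x z.
Proof.
case: a b c d x z => [a1 a2] [b1 b2] [c1 c2] [d1 d2] [x1 x2 x3 x4] [[z1 z2] [z3 z4]].
rewrite /fH /act /mulv /nsq /=; ring.
Qed.

Lemma disc_act (a b c d : C) (x : form R) :
  disc (act a b c d x) = nsq (a * d - b * c) * disc x.
Proof.
case: a b c d x => [a1 a2] [b1 b2] [c1 c2] [d1 d2] [x1 x2 x3 x4].
rewrite /disc /act /nsq /=; ring.
Qed.

(** Pairing with [form1] reads off [fB], so this is the invariance of [form2]: the pairing with an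
    image of the real line is computed after pulling [x] back. *)
Lemma form2_act (a b c d : C) (x : form R) :
  fB (act d (- b) (- c) a x) = form2 (act a b c d (form1 R)) x.
Proof.
case: a b c d x => [a1 a2] [b1 b2] [c1 c2] [d1 d2] [x1 x2 x3 x4].
rewrite /form2 /act /form1 /nsq /=; ring.
Qed.

Definition mobc (a b c d : C) (o : ocircle R) : ocircle R :=
  OCircle (mob a b c d @` pts o) (mob a b c d @` interior o).

(** Normalizing the homogeneous coordinates of the image costs a squared modulus. The factor is thus
    positive, and both the circle and its interior are transported. *)
Lemma hval_mob (a b c d : C) (x : form R) (p : Cinf R) : a * d - b * c != 0 ->
  exists2 k, 0 < k & hval x p = k * hval (act a b c d x) (mob a b c d p).
Proof.
move=> D; have [k k0 e] := hom_proj (mulv_neq0 D (hom_neq0 p)).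
have := fH_act a b c d x (hom p); rewrite {1}e fH_scale -!hval_hom => h.
have D0 := nsq_gt0 D.
exists (nsq k / nsq (a * d - b * c)); first by rewrite divr_gt0 // nsq_gt0.
by rewrite mulrAC h mulrAC mulfV ?mul1r // gt_eqF.
Qed.

Lemma mobc_oc (a b c d : C) (x : form R) : a * d - b * c != 0 ->
  mobc a b c d (oc x) = oc (act a b c d x).
Proof.
move=> D; apply: ocP => q /=.
  split=> [[p /= + <-]|h].
    have [k k0 ->] := hval_mob x p D.
    by move=> /eqP; rewrite mulf_eq0 gt_eqF //= => /eqP.
  exists (mob d (- b) (- c) a q); last by rewrite mobVK.
  by have [k k0 /= ->] := hval_mob x (mob d (- b) (- c) a q) D; rewrite mobVK // h mulr0.
split=> [[p /= + <-]|h].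
  by have [k k0 ->] := hval_mob x p D; rewrite pmulr_rgt0.
exists (mob d (- b) (- c) a q); last by rewrite mobVK.
by have [k k0 /= ->] := hval_mob x (mob d (- b) (- c) a q) D; rewrite mobVK // mulr_gt0.
Qed.

Definition TD (c d : ocircle R) : Prop :=
  tangent c d /\ interior c `&` interior d = set0.

Lemma TDC (c d : ocircle R) : TD c d -> TD d c.
Proof.
by case=> [[z e] i]; split; [exists z; rewrite setIC | rewrite setIC].
Qed.

Lemma TD_mob (a b c d : C) (o o' : ocircle R) : a * d - b * c != 0 ->
  TD o o' -> TD (mobc a b c d o) (mobc a b c d o').
Proof.
move=> D [[z e] i]; have inj := can_inj (mobK D).
have cap (A B : set (Cinf R)) :
    mob a b c d @` A `&` mob a b c d @` B = mob a b c d @` (A `&` B).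
  apply/seteqP; split=> p.
    by move=> [[x Ax <-] [y By /inj xy]]; exists x => //; split=> //; rewrite -xy.
  by move=> [x [Ax Bx] <-]; split; exists x.
split; last by rewrite /= cap i image_set0.
by exists (mob a b c d z); rewrite /= cap e image_set1.
Qed.

Lemma mobc_comp (a b c d a' b' c' d' : C) (o : ocircle R) : a' * d' - b' * c' != 0 ->
  mobc a b c d (mobc a' b' c' d' o) =
  mobc (a * a' + b * c') (a * b' + b * d') (c * a' + d * c') (c * b' + d * d') o.
Proof.
move=> D; rewrite /mobc /=; congr OCircle; apply/seteqP; split=> q.
- by move=> [_ [p hp <-] <-]; exists p; rewrite ?mob_comp.
- by move=> [p hp <-]; exists (mob a' b' c' d' p); [exists p | rewrite mob_comp].
- by move=> [_ [p hp <-] <-]; exists p; rewrite ?mob_comp.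
- by move=> [p hp <-]; exists (mob a' b' c' d' p); [exists p | rewrite mob_comp].
Qed.

Lemma mobc_scalar (k : C) (o : ocircle R) : k != 0 -> mobc k 0 0 k o = o.
Proof.
move=> k0; case: o => P I; rewrite /mobc /=; congr OCircle; apply/seteqP; split=> q.
- by move=> [p hp <-]; rewrite mob_scalar.
- by move=> hq; exists q; rewrite ?mob_scalar.
- by move=> [p hp <-]; rewrite mob_scalar.
- by move=> hq; exists q; rewrite ?mob_scalar.
Qed.

Lemma mobcK (a b c d : C) (o : ocircle R) : a * d - b * c != 0 ->
  mobc d (- b) (- c) a (mobc a b c d o) = o.
Proof.
move=> D; rewrite mobc_comp // -[RHS](mobc_scalar _ D).
by congr mobc; ring.
Qed.

Lemma mobcVK (a b c d : C) (o : ocircle R) : a * d - b * c != 0 ->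
  mobc a b c d (mobc d (- b) (- c) a o) = o.
Proof.
move=> D; rewrite mobc_comp ?det_adj // -[RHS](mobc_scalar o D).
by congr mobc; ring.
Qed.

(** The interior of [form1] is the lower half plane, so the other form is at most 0 there; this
    excludes [fB x = 1] and gives the signs. If [fA], [fC] and [fD] all vanished, the whole real
    line would be common. *)
Lemma TD_real (x : form R) : disc x = 1 -> TD (oc (form1 R)) (oc x) ->
  [/\ fB x = -1, fC x ^+ 2 = 4 * fA x * fD x, fA x <= 0, fD x <= 0
    & (fA x < 0) || (fD x < 0)].
Proof.
case: x => A B E D; rewrite /disc /= => d1 [[z ez] i0].
have onR (t : R) : pts (oc (form1 R)) (Some (Complex t 0)) by rewrite /=; ring.
have onI : pts (oc (form1 R)) None by [].
have uniq p q : pts (oc (form1 R)) p -> pts (oc (form1 R)) q ->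
    pts (oc (Form A B E D)) p -> pts (oc (Form A B E D)) q -> p = q.
  move=> h1 h2 h3 h4.
  have : [set z] p by rewrite -ez.
  have : [set z] q by rewrite -ez.
  by move=> -> ->.
have hz : [set z] z by []; rewrite -ez in hz; case: hz => zR zx.
have disj p : 0 < hval (form1 R) p -> 0 < hval (Form A B E D) p -> False.
  move=> h1 h2.
  have : (interior (oc (form1 R)) `&` interior (oc (Form A B E D))) p by [].
  by rewrite i0.
(* On the real line the form is A t^2 - E t + D. If A = 0 and E is nonzero, both infinity and D / E
   are common points; otherwise t and E / A - t are the two roots. Uniqueness forces a zero
   discriminant. *)
have hE : E ^+ 2 = 4 * A * D.
  have [A0|A0] := eqVneq A 0.
    subst A; have [->|E0] := eqVneq E 0; first by rewrite mulr0 mul0r expr0n.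
    have : None = Some (Complex (D / E) 0) :> Cinf R; last by [].
    by apply: uniq => //=; [ring | field].
  case: z zR zx {ez} => [[t y]|]; last by move=> _ /= h; rewrite h eqxx in A0.
  move=> /= yR zx; have y0 : y = 0 by move: yR; lra.
  subst y; have : Some (Complex t 0) = Some (Complex (E / A - t) 0) :> Cinf R.
    apply: uniq; [exact: onR | exact: onR | exact: zx |].
    by rewrite /= -[RHS]zx; field.
  case=> h; have e2 : E = 2 * A * t.
    have : A * t = A * (E / A - t) by rewrite -h.
    rewrite mulrBr mulrCA divff // mulr1 => h2.
    by rewrite -(subrK (A * t) E) -h2; ring.
  have eD : D = A * t ^+ 2 by move: zx; rewrite e2; lra.
  by rewrite e2 eD; ring.
have hB : B ^+ 2 = 1 by move: d1; rewrite hE; lra.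
have lower (s t : R) : 0 < t -> A * (s ^+ 2 + t ^+ 2) - s * E + t * B + D <= 0.
  move=> t0; rewrite leNgt; apply/negP => h.
  apply: (disj (Some (Complex s (- t)))) => /=; first by lra.
  by move: h; rewrite sqrrN; lra.
(* At the abscissa E / (2 A) of the double root only the terms in t remain. *)
have low (t : R) : 0 < t -> A != 0 -> A * t ^+ 2 + t * B <= 0.
  move=> t0 A0; have := lower (E / (2 * A)) t t0.
  have -> : D = E ^+ 2 / (4 * A) by rewrite hE; field.
  by have -> : A * ((E / (2 * A)) ^+ 2 + t ^+ 2) - E / (2 * A) * E + t * B +
    E ^+ 2 / (4 * A) = A * t ^+ 2 + t * B by field.
have low0 (t : R) : 0 < t -> A = 0 -> t * B + D <= 0.
  by move=> t0 A0; have := lower 0 t t0; rewrite A0; lra.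
have [B1|B1] : B = 1 \/ B = -1.
  have /eqP : (B - 1) * (B + 1) = 0.
    have -> : (B - 1) * (B + 1) = B ^+ 2 - 1 by ring.
    by rewrite hB subrr.
  by rewrite mulf_eq0 => /orP[/eqP h|/eqP h]; [left | right]; lra.
  exfalso; have [A0|A0|A0] := ltrgtP A 0.
  - have t0 : 0 < - (2 * A)^-1 by rewrite oppr_gt0 invr_lt0 pmulr_rlt0.
    have := low _ t0; rewrite lt_eqF // B1 => /(_ isT).
    have -> : A * (- (2 * A)^-1) ^+ 2 + - (2 * A)^-1 * 1 = - (2 * A)^-1 / 2.
      by field; rewrite lt_eqF.
    by rewrite leNgt divr_gt0.
  - have := low 1 ltr01; rewrite gt_eqF // B1 => /(_ isT).
    by rewrite expr1n !mulr1 => h; lra.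
  - have t0 : 0 < `|D| + 1 by rewrite ltr_wpDl.
    have := low0 _ t0 A0; rewrite B1 => h.
    by have := ler_norm (- D); rewrite normrN; lra.
have A0 : A <= 0.
  rewrite leNgt; apply/negP => A0.
  have t0 : 0 < 2 / A by rewrite divr_gt0.
  have := low _ t0; rewrite gt_eqF // B1 => /(_ isT).
  have -> : A * (2 / A) ^+ 2 + 2 / A * -1 = 2 / A by field; rewrite gt_eqF.
  by rewrite leNgt t0.
have D0 : D <= 0.
  rewrite leNgt; apply/negP => D0; have [Ae|An] := eqVneq A 0.
    have t0 : 0 < D / 2 by rewrite divr_gt0.
    by have := low0 _ t0 Ae; rewrite B1; lra.
  have An0 : A < 0 by rewrite lt_neqAle An.
  have : A * D < 0 by rewrite nmulr_rlt0.
  by have := sqr_ge0 E; rewrite hE; lra.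
split=> //; rewrite !lt_neqAle A0 D0 !andbT -negb_and.
apply/negP => /andP[/eqP Ae /eqP De].
have E0 : E = 0 by apply/eqP; rewrite -sqrf_eq0 hE Ae mulr0 mul0r.
have : Some (Complex (0 : R) 0) = Some (Complex 1 0) :> Cinf R.
  by apply: uniq; [exact: onR | exact: onR | |]; rewrite /= Ae De E0; ring.
by case=> /eqP; rewrite eq_sym oner_eq0.
Qed.

Lemma TD_form2 (a b c d : C) (x : form R) : nsq (a * d - b * c) = 1 ->
  disc x = 1 -> TD (oc (act a b c d (form1 R))) (oc x) ->
  form2 (act a b c d (form1 R)) x = -1.
Proof.
move=> n1 d1 td; have D : a * d - b * c != 0.
  apply/eqP => h; move: n1; rewrite h /nsq /= expr0n addr0 => /eqP.
  by rewrite eq_sym oner_eq0.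
have D' : d * a - - b * - c != 0 by rewrite det_adj.
rewrite -form2_act.
have := TD_mob D' td; rewrite -mobc_oc // mobcK // mobc_oc // => /TD_real[] //.
by rewrite disc_act det_adj n1 d1 mulr1.
Qed.

End Moebius.

(** * Gaussian circles in the frame of one of them *)

Section Gaussian.
Variable R : realType.
Local Notation C := (complex R).
Local Notation gc := (@gint_complex R).

Definition fZ (x : form int) : form R :=
  Form (fA x)%:~R (fB x)%:~R (fC x)%:~R (fD x)%:~R.

Lemma gcM (x y : gint) : gc (x * y) = gc x * gc y.
Proof.
case: x y => [a b] [c d]; rewrite /gint_complex /=.
by congr Complex; rewrite ?rmorphB ?rmorphD ?rmorphM.
Qed.

Lemma gcD (x y : gint) : gc (x + y) = gc x + gc y.
Proof. by case: x y => [a b] [c d]; rewrite /gint_complex /= !rmorphD. Qed.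

Lemma gcN (x : gint) : gc (- x) = - gc x.
Proof. by case: x => [a b]; rewrite /gint_complex /= !rmorphN. Qed.

Lemma gc_nsq (x : gint) : x \is a GRing.unit -> nsq (gc x) = 1.
Proof.
by move=> /gunitP[->|->|->|->]; rewrite /nsq /=; ring.
Qed.

Lemma nsq1_neq0 (z : C) : nsq z = 1 -> z != 0.
Proof.
move=> n1; apply/eqP => h; move: n1; rewrite h /nsq /= expr0n addr0 => /eqP.
by rewrite eq_sym oner_eq0.
Qed.

Definition circ (x y : vec) : ocircle R := circle_of R (row_mx x y).

Definition cmob (x y : vec) : ocircle R -> ocircle R :=
  mobc (gc (x ord0 ord0)) (gc (y ord0 ord0)) (gc (x ord_max ord0)) (gc (y ord_max ord0)).

Lemma row_mxE (T : Type) (x y : 'cV[T]_2) (k : 'I_2) :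
  row_mx x y k ord0 = x k ord0 /\ row_mx x y k ord_max = y k ord0.
Proof.
split.
  by rewrite (_ : ord0 = lshift 1 (ord0 : 'I_1)) ?row_mxEl //; apply: val_inj.
by rewrite (_ : ord_max = rshift 1 (ord0 : 'I_1)) ?row_mxEr //; apply: val_inj.
Qed.

Lemma circ_cmob (x y : vec) : circ x y = cmob x y (oc (form1 R)).
Proof.
rewrite /circ /circle_of real_circle_oc /cmob /mobc /moebius_circle.
have E (p : Cinf R) : moebius (map_mx gc (row_mx x y)) p =
  mob (gc (x ord0 ord0)) (gc (y ord0 ord0)) (gc (x ord_max ord0))
      (gc (y ord_max ord0)) p.
  have e k l : map_mx gc (row_mx x y) k l = gc (row_mx x y k l) by rewrite mxE.
  by rewrite moebius_mob !e !(row_mxE x y _).1 !(row_mxE x y _).2.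
congr OCircle; apply/seteqP; split=> q [p hp <-]; exists p; rewrite ?E //.
Qed.

Lemma gc_det (a b c d : gint) :
  gc a * gc d - gc b * gc c = gc (a * d - b * c).
Proof. by rewrite gcD gcN !gcM. Qed.

Lemma det_crs (x y : vec) :
  x ord0 ord0 * y ord_max ord0 - y ord0 ord0 * x ord_max ord0 = crs x y.
Proof. by cring. Qed.

Lemma act_hermg (a b c d : gint) :
  act (gc a) (gc b) (gc c) (gc d) (form1 R) = fZ (hermg a b c d).
Proof.
case: a b c d => [a1 a2] [b1 b2] [c1 c2] [d1 d2].
rewrite /act /form1 /fZ /hermg /nsq /=.
by congr Form; rewrite ?rmorphB ?rmorphD ?rmorphM /=; ring.
Qed.

Definition gcirc (a b c d : gint) : ocircle R := oc (fZ (hermg a b c d)).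

Lemma gcircE (a b c d : gint) : a * d - b * c \is a GRing.unit ->
  gcirc a b c d = mobc (gc a) (gc b) (gc c) (gc d) (oc (form1 R)).
Proof.
by move=> u; rewrite mobc_oc ?act_hermg // gc_det nsq1_neq0 // gc_nsq.
Qed.

Lemma circ_oc (x y : vec) : crs x y \is a GRing.unit ->
  circ x y = oc (fZ (herm x y)).
Proof. by move=> u; rewrite circ_cmob /cmob -gcircE // det_crs. Qed.

Lemma disc_gcirc (a b c d : gint) : a * d - b * c \is a GRing.unit ->
  disc (fZ (hermg a b c d)) = 1.
Proof.
move=> u; rewrite -act_hermg disc_act gc_det gc_nsq //.
by rewrite /disc /=; ring.
Qed.

Lemma circ_is_ocircle (x y : vec) : crs x y \is a GRing.unit ->
  is_ocircle (circ x y).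
Proof.
move=> u; rewrite circ_oc //; apply/is_ocircleP; eexists; last reflexivity.
by rewrite disc_gcirc // det_crs.
Qed.

(** Once [circ x y] is moved to the real line, a second circle becomes the one given by its
    coordinates in the basis [x], [y], again a Gaussian circle. *)
Lemma circ_comb (x y : vec) (a b c d : gint) : crs x y \is a GRing.unit ->
  a * d - b * c \is a GRing.unit ->
  circ (a *: x + c *: y) (b *: x + d *: y) = cmob x y (gcirc a b c d).
Proof.
move=> u u'; rewrite gcircE // /cmob mobc_comp; last first.
  by rewrite gc_det nsq1_neq0 // gc_nsq.
rewrite circ_cmob /cmob !mxE -!gcM -!gcD.
by congr mobc; congr gint_complex; ring.
Qed.

Lemma cmob_det (x y : vec) : crs x y \is a GRing.unit ->
  gc (x ord0 ord0) * gc (y ord_max ord0) - gc (y ord0 ord0) * gc (x ord_max ord0) != 0.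
Proof. by move=> u; rewrite gc_det det_crs nsq1_neq0 // gc_nsq. Qed.

Lemma TD_cmob (x y : vec) (c d : ocircle R) : crs x y \is a GRing.unit ->
  TD (cmob x y c) (cmob x y d) <-> TD c d.
Proof.
move=> /cmob_det u; split=> [h|]; last exact: TD_mob.
have u' : gc (y ord_max ord0) * gc (x ord0 ord0) -
    - gc (y ord0 ord0) * - gc (x ord_max ord0) != 0 by rewrite det_adj.
by have := TD_mob u' h; rewrite /cmob !mobcK.
Qed.

Lemma cmob_surj (x y : vec) (o : ocircle R) : crs x y \is a GRing.unit ->
  is_ocircle o -> exists2 f, disc f = 1 & o = cmob x y (oc f).
Proof.
move=> u /is_ocircleP[f f1 ->]; have D := cmob_det u.
exists (act (gc (y ord_max ord0)) (- gc (y ord0 ord0)) (- gc (x ord_max ord0))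
   (gc (x ord0 ord0)) f).
  by rewrite disc_act det_adj gc_det det_crs gc_nsq // mul1r.
by rewrite -mobc_oc ?det_adj // /cmob mobcVK.
Qed.

Lemma basis_comb (x y z t : vec) : crs x y \is a GRing.unit ->
  crs z t \is a GRing.unit ->
  exists a b c d, [/\ a * d - b * c \is a GRing.unit,
    z = a *: x + c *: y & t = b *: x + d *: y].
Proof.
move=> u u'; have [[a c] [/= ez _]] := (zibasisP x y).2 u z.
have [[b d] [/= et _]] := (zibasisP x y).2 u t.
exists a, b, c, d; split=> //; move: u'; rewrite ez et crs_comb unitrM => /andP[+ _].
by rewrite (mulrC c).
Qed.

Lemma TD_gcirc (a b c d : gint) (f : form R) : a * d - b * c \is a GRing.unit ->
  disc f = 1 -> TD (gcirc a b c d) (oc f) -> form2 (fZ (hermg a b c d)) f = -1.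
Proof.
move=> u f1; rewrite /gcirc -act_hermg; apply: TD_form2 => //.
by rewrite gc_det gc_nsq.
Qed.

Lemma gcirc1 : gcirc 1 0 0 1 = oc (form1 R).
Proof. by []. Qed.

Lemma TD_gcirc1 (a b c d : gint) (h := hermg a b c d) : a * d - b * c \is a GRing.unit ->
  TD (gcirc 1 0 0 1) (gcirc a b c d) ->
  [/\ fB h = -1, fC h ^+ 2 = 4 * fA h * fD h, fA h <= 0, fD h <= 0
    & (fA h < 0) || (fD h < 0)].
Proof.
move=> u; rewrite gcirc1 => /(TD_real (disc_gcirc u))[/= hB hC hA hD hN].
split.
- by apply: (@intr_inj R); rewrite hB rmorphN.
- by apply: (@intr_inj R); rewrite rmorphXn /= hC !rmorphM.
- by move: hA; rewrite lerz0.
- by move: hD; rewrite lerz0.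
- by move: hN; rewrite !ltrz0.
Qed.

Lemma circ_comb1 (x y : vec) : crs x y \is a GRing.unit ->
  circ x y = cmob x y (gcirc 1 0 0 1).
Proof. by move=> u; rewrite gcirc1 circ_cmob. Qed.

Definition cv (u v : vec) : ocircle R := circ u (gi *: v).
Definition cv3 (u v : vec) : ocircle R := cv (gi *: u - v) (v + gi *: (- u - v)).

Lemma unit_giv (u v : vec) : crs u v \is a GRing.unit ->
  crs u (gi *: v) \is a GRing.unit.
Proof.
by move=> uv; rewrite (_ : crs _ _ = gi * crs u v) ?unitrM ?uv //; cring.
Qed.

Lemma cv_oc (u v : vec) : crs u v \is a GRing.unit -> cv u v = oc (fZ (hv u v)).
Proof. by move=> uv; rewrite /cv circ_oc // unit_giv. Qed.

Lemma cv1E (u v : vec) : crs u v \is a GRing.unit ->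
  cv v (- u - v) = cmob u (gi *: v) (gcirc 0 (- gi) (- gi) (-1)).
Proof.
move=> /unit_giv uv; rewrite -circ_comb // /cv.
by congr circ; vring.
Qed.

Lemma cv2E (u v : vec) : crs u v \is a GRing.unit ->
  cv (- u - v) u = cmob u (gi *: v) (gcirc (-1) gi gi 0).
Proof.
move=> /unit_giv uv; rewrite -circ_comb // /cv.
by congr circ; vring.
Qed.

Lemma cv3E (u v : vec) : crs u v \is a GRing.unit ->
  cv3 u v = cmob u (gi *: v) (gcirc gi 1 gi (1 - gi)).
Proof.
move=> /unit_giv uv; rewrite -circ_comb // /cv3 /cv.
by congr circ; vring.
Qed.

Lemma cv3sE (u v : vec) : crs u v \is a GRing.unit ->
  cv3 v u = cmob u (gi *: v) (gcirc (-1) (1 + gi) 1 (- gi)).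
Proof.
move=> /unit_giv uv; rewrite -circ_comb // /cv3 /cv.
by congr circ; vring.
Qed.

Lemma fZ_id : fZ (hermg 1 0 0 1) = form1 R.
Proof. by []. Qed.

(** The model chamber over the real line: here the disc of diameter 1 above 0, in [fZ2] the half
    plane Im z > 1, in [fZ3] and [fZ3s] the discs of diameter 1 above 1 and -1. *)
Lemma fZ1 : fZ (hermg 0 (- gi) (- gi) (-1)) = Form (-1) (-1) 0 0.
Proof. by []. Qed.

Lemma fZ2 : fZ (hermg (-1) gi gi 0) = Form 0 (-1) 0 (-1).
Proof. by []. Qed.

Lemma fZ3 : fZ (hermg gi 1 gi (1 - gi)) = Form (-1) (-1) (- 2) (-1).
Proof. by []. Qed.

Lemma fZ3s : fZ (hermg (-1) (1 + gi) 1 (- gi)) = Form (-1) (-1) 2 (-1).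
Proof. by []. Qed.

Lemma TD_base (u v : vec) : crs u v \is a GRing.unit -> TD (cv u v) (cv (- u - v) u).
Proof.
move=> uv; rewrite cv2E // /cv circ_comb1 ?unit_giv //; apply/TD_cmob.
  exact: unit_giv.
rewrite /gcirc fZ_id fZ2; split.
  exists None; apply/seteqP; split=> [[[a b]|] //= [h1 h2]|p ->]; last by [].
  by exfalso; move: h1 h2; lra.
by apply/seteqP; split=> [[[a b]|] //= [h1 h2]|//]; move: h1 h2; lra.
Qed.

End Gaussian.

(** * Tangent Gaussian circles *)

(** A degenerate negative binary form is -k times the square of a primitive linear form. Dividing
    [A] and half of [E] by their gcd gives [p] and [q], and the Bezout coefficients complete them to
    a matrix of determinant 1. *)
Lemma rank1_form (A E D : int) : E ^+ 2 = 4 * A * D -> A <= 0 -> D <= 0 ->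
  (A < 0) || (D < 0) ->
  exists k p q r s : int, [/\ 1 <= k, A = - k * p ^+ 2, D = - k * q ^+ 2,
    E = - 2 * k * p * q & p * s - q * r = 1].
Proof.
move=> hE A0 D0 AD.
have [m Em] : exists m, E = 2 * m.
  exists (E %/ 2)%Z.
  have : E = 2 * (E %/ 2)%Z \/ E = 2 * (E %/ 2)%Z + 1 by lia.
  case=> // e; exfalso; move: hE; rewrite {1}e.
  by set t := (E %/ 2)%Z; rewrite expr2; lia.
have mAD : m ^+ 2 = A * D by move: hE; rewrite Em !expr2; lia.
have [A00|An0] := eqVneq A 0.
  have m0 : m = 0 by apply/eqP; rewrite -sqrf_eq0 mAD A00 mul0r.
  exists (- D), 0, 1, (-1), 0; rewrite Em m0 A00; split=> //; try by ring.
  by move: AD; rewrite A00; lia.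
have [u [v uv]] := Bezoutz A m.
set g := gcdz A m in uv.
have gn0 : g != 0 by rewrite /g gcdz_eq0 negb_and An0.
have [p Ap] := dvdzP (dvdz_gcdl A m); have [q mq] := dvdzP (dvdz_gcdr A m).
rewrite -/g in Ap mq.
have uv1 : u * p + v * q = 1.
  apply: (mulIf gn0); rewrite mul1r -{2}uv Ap mq; ring.
have pn0 : p != 0 by apply: contraNneq An0 => p0; rewrite Ap p0 mul0r.
have pD : p * D = g * q ^+ 2.
  apply: (mulIf gn0); rewrite mulrAC -Ap -mAD mq; ring.
(* Squaring the Bezout relation [u p + v q = 1] shows that [p] divides [g]. *)
pose t := g * u ^+ 2 * p + 2 * g * u * v * q + v ^+ 2 * D.
have gt : g = t * p.
  have -> : g = g * (u * p + v * q) ^+ 2 by rewrite uv1 expr1n mulr1.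
  have -> : g * (u * p + v * q) ^+ 2 = p * (g * u ^+ 2 * p + 2 * g * u * v * q)
    + v ^+ 2 * (g * q ^+ 2) by ring.
  by rewrite -pD /t; ring.
have Dt : D = t * q ^+ 2.
  by apply: (mulfI pn0); rewrite pD gt; ring.
have tn : t < 0.
  have : A < 0 by rewrite lt_neqAle An0.
  rewrite Ap gt mulrCA pmulr_llt0 // -expr2.
  by rewrite lt_def sqrf_eq0 pn0 sqr_ge0.
exists (- t), p, q, (- v), u; split.
- by move: tn; lia.
- by rewrite Ap gt; ring.
- by rewrite Dt; ring.
- by rewrite Em mq gt; ring.
- by rewrite -uv1; ring.
Qed.

Section Configurations.
Variable R : realType.
Local Notation gcirc := (gcirc R).
Local Notation circ := (circ R).
Local Notation cv := (cv R).
Local Notation cv3 := (cv3 R).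
Local Notation cmob := (@cmob R).

Lemma hermg_tangent (al be ga de : int) : al * de - be * ga = 1 ->
  hermg (- gi * zi be) (- gi * zi al - zi be) (- gi * zi de) (- gi * zi ga - zi de)
  = Form (- de ^+ 2) (-1) (- 2 * be * de) (- be ^+ 2).
Proof.
move=> d1; rewrite /hermg /=; congr Form; try ring.
by rewrite [RHS](_ : -1 = - (al * de - be * ga)); [ring | rewrite d1].
Qed.

Lemma hermg_tangent' (al be ga de : int) : al * de - be * ga = 1 ->
  hermg (gi * zi be - zi al) (gi * zi al) (gi * zi de - zi ga) (gi * zi ga)
  = Form (- ga ^+ 2) (-1) (- 2 * al * ga) (- al ^+ 2).
Proof.
move=> d1; rewrite /hermg /=; congr Form; try ring.
by rewrite [RHS](_ : -1 = - (al * de - be * ga)); [ring | rewrite d1].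
Qed.

Lemma zi_det (al be ga de : int) :
  zi al * zi de - zi be * zi ga = zi (al * de - be * ga).
Proof. by congr Complex; ring. Qed.

(** Changing the basis of [circ x y] by SL2(Z) moves its two neighbours to any Farey pair: in the
    frame they are the Ford discs Im z > |de z - be|^2 and Im z > |ga z - al|^2, touching the real
    line at be/de and al/ga. *)
Lemma SL2_frame (x y : vec) (al be ga de : int) (u := vpair x y al ga)
    (v := - gi *: vpair x y be de) (w := - u - v) :
  crs x y \is a GRing.unit -> al * de - be * ga = 1 ->
  [/\ crs u v \is a GRing.unit, cv u v = circ x y,
    cv v w = cmob x y (oc (fZ R (Form (- de ^+ 2) (-1) (- 2 * be * de) (- be ^+ 2)))) &
    cv w u = cmob x y (oc (fZ R (Form (- ga ^+ 2) (-1) (- 2 * al * ga) (- al ^+ 2))))].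
Proof.
move=> xy d1.
have d1' : al * de - ga * be = 1 by rewrite (mulrC ga).
have uv : crs u v \is a GRing.unit by apply: unit_kcor; exact: unit_SL2.
have dz : zi al * zi de - zi be * zi ga = 1 by rewrite zi_det d1.
split=> //.
- rewrite cv_oc // circ_oc //; congr oc; congr fZ.
  rewrite -(herm_SL2 x y d1') /hv; congr herm.
  by rewrite /v; vring.
- rewrite -(hermg_tangent d1) -/(gcirc _ _ _ _) -circ_comb //; last first.
    have : zi al * zi de - zi be * zi ga \is a GRing.unit by rewrite dz.
    by congr (_ \is a _); ring: gi2.
  by rewrite /w /v /u /vpair /cv; congr circ; vring.
- rewrite -(hermg_tangent' d1) -/(gcirc _ _ _ _) -circ_comb //; last first.
    have : zi al * zi de - zi be * zi ga \is a GRing.unit by rewrite dz.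
    by congr (_ \is a _); ring: gi2.
  by rewrite /w /v /u /vpair /cv; congr circ; vring.
Qed.

(* Seen from the first circle, moved to the real line, the other two have forms
   Im z - k |p z - q|^2 and Im z - k' |p' z - q'|^2; their tangency amounts to
   k k' (p q' - q p')^2 = 1. *)
Lemma TD_triple (x1 y1 x2 y2 x3 y3 : vec) :
  crs x1 y1 \is a GRing.unit -> crs x2 y2 \is a GRing.unit ->
  crs x3 y3 \is a GRing.unit ->
  TD (circ x1 y1) (circ x2 y2) -> TD (circ x1 y1) (circ x3 y3) ->
  TD (circ x2 y2) (circ x3 y3) ->
  exists u v, [/\ crs u v \is a GRing.unit, cv u v = circ x1 y1,
    cv v (- u - v) = circ x2 y2 & cv (- u - v) u = circ x3 y3].
Proof.
move=> u1 u2 u3.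
have [a [b [c [d [D2 -> ->]]]]] := basis_comb u1 u2.
have [a' [b' [c' [d' [D3 -> ->]]]]] := basis_comb u1 u3.
rewrite (circ_comb R u1 D2) (circ_comb R u1 D3) (circ_comb1 R u1) !TD_cmob //.
move=> t12 t13 t23.
have := TD_gcirc D2 (disc_gcirc R D3) t23.
have [B2 C2 A2 E2 N2] := TD_gcirc1 D2 t12.
have [B3 C3 A3 E3 N3] := TD_gcirc1 D3 t13.
have [k [p [q [_ [_ [k1 Ap Dq Cpq _]]]]]] := rank1_form C2 A2 E2 N2.
have [k' [p' [q' [_ [_ [k1' Ap' Dq' Cpq' _]]]]]] := rank1_form C3 A3 E3 N3.
rewrite /gcirc; case: (hermg a b c d) B2 Ap Dq Cpq {t12 t13 t23 C2 A2 E2 N2}.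
move=> A2 B2 C2 E2 /= eB eA eD eC.
case: (hermg a' b' c' d') B3 Ap' Dq' Cpq' {C3 A3 E3 N3}.
move=> A3 B3 C3 E3 /= eB' eA' eD' eC' f2.
have {}f2 : B2 * B3 + C2 * C3 - 2 * (A2 * E3 + E2 * A3) = -1.
  apply: (@intr_inj R); move: f2; rewrite /form2 /= => f2.
  by rewrite [RHS]mulrNz -[RHS]f2 !(intrD, intrM, mulrNz).
have kk : k * (k' * (p * q' - q * p') ^+ 2) = 1.
  have : 2 * (k * (k' * (p * q' - q * p') ^+ 2)) = 2 * 1.
    move: f2; rewrite eB eB' eA eA' eC eC' eD eD' => f2.
    have -> : 2 * (k * (k' * (p * q' - q * p') ^+ 2)) = 1 -
      (-1 * -1 + - 2 * k * p * q * (- 2 * k' * p' * q') -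
      2 * (- k * p ^+ 2 * (- k' * q' ^+ 2) + - k * q ^+ 2 * (- k' * p' ^+ 2))) by ring.
    by rewrite f2.
  by move/mulfI; apply.
have [[k_1 kk']|[k_1 _]] := mulz_eq1 kk; last by lia.
have [[k_1' dd]|[k_1' _]] := mulz_eq1 kk'; last by lia.
have : (p * q' - q * p') * (p * q' - q * p') = 1 by rewrite -expr2.
move: eA eA' eC eC' eD eD'; rewrite eB eB' k_1 k_1' => eA eA' eC eC' eD eD' dd1.
(* The sign makes the determinant +1; replacing (p', q') by its opposite does not change the
   form. *)
have [s [hs d1]] : exists s : int, s ^+ 2 = 1 /\ s * q' * p - q * (s * p') = 1.
  have [[h _]|[h _]] := mulz_eq1 dd1.
    by exists 1; split=> //; rewrite -[RHS]h; ring.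
  by exists (-1); split=> //; apply: (@oppr_inj int); rewrite -[RHS]h; ring.
have [uv e1 e2 e3] := SL2_frame u1 d1.
do 2 eexists; split; first exact: uv.
- by rewrite e1 (circ_comb1 R u1).
- by rewrite e2; congr (cmob _ _ (oc (fZ R (Form _ _ _ _)))); rewrite ?eA ?eC ?eD; ring.
- rewrite e3; congr (cmob _ _ (oc (fZ R (Form _ _ _ _)))).
  + by rewrite eA' exprMn hs; ring.
  + rewrite eC' (_ : - 2 * (s * q') * (s * p') = - 2 * s ^+ 2 * q' * p'); last by ring.
    by rewrite hs; ring.
  + by rewrite eD' exprMn hs; ring.
Qed.

(** In the frame, tangency to the real line gives B = -1, the other two pairings are linear and give
    A = D = -1, and the zero discriminant leaves 2 and -2 for the last coefficient. *)
Lemma TD_fourth (u v : vec) (o : ocircle R) : crs u v \is a GRing.unit ->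
  is_ocircle o -> TD (cv u v) o -> TD (cv v (- u - v)) o -> TD (cv (- u - v) u) o ->
  o = cv3 u v \/ o = cv3 v u.
Proof.
move=> uv oo; have uv' := unit_giv uv.
have [f f1 ->] := cmob_surj uv' oo.
rewrite (cv1E R uv) (cv2E R uv) /cv (circ_comb1 R uv') !TD_cmob //.
move=> t0 t1 t2.
have := TD_gcirc _ f1 t1; have := TD_gcirc _ f1 t2.
rewrite fZ1 fZ2 => /(_ isT) h2 /(_ isT) h1.
have [hB hC _ _ _] := TD_real f1 t0.
rewrite (cv3E R uv) (cv3sE R uv) /gcirc fZ3 fZ3s.
case: f f1 h1 h2 hB hC {t0 t1 t2} => A B E D; rewrite /form2 /= => _ h1 h2 hB hC.
have D1 : D = -1 by move: h1; rewrite hB; lra.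
have A1 : A = -1 by move: h2; rewrite hB; lra.
have : (E - 2) * (E + 2) = 0.
  have -> : (E - 2) * (E + 2) = E ^+ 2 - 4 by ring.
  by rewrite hC A1 D1; ring.
move/eqP; rewrite mulf_eq0 hB A1 D1 => /orP[/eqP h|/eqP h]; [right|left].
  by congr (cmob _ _ (oc (Form _ _ _ _))); lra.
by congr (cmob _ _ (oc (Form _ _ _ _))); lra.
Qed.

End Configurations.

(** * The circles of a chamber and the neighbours of a circle *)

Section Kingdom.
Variable R : realType.
Local Notation gcirc := (gcirc R).
Local Notation circ := (circ R).
Local Notation cv := (cv R).
Local Notation cv3 := (cv3 R).
Local Notation cmob := (@cmob R).

Lemma eq_cv (u v u' v' : vec) : crs u v \is a GRing.unit ->
  crs u' v' \is a GRing.unit -> hv u v = hv u' v' -> cv u v = cv u' v'.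
Proof. by move=> uv uv' e; rewrite !cv_oc // e. Qed.

Lemma cv_flip (u v : vec) : crs u v \is a GRing.unit -> cv v u = cv u v.
Proof. by move=> uv; apply: eq_cv; [exact: unit_crsC | | exact: hv_flip]. Qed.

Lemma cv3_cyc (u v : vec) : crs u v \is a GRing.unit ->
  cv3 v (- u - v) = cv3 u v.
Proof.
move=> uv; apply: eq_cv; last exact: hv3_cyc.
  by apply: unit_rho; exact: unit_cyc.
exact: unit_rho.
Qed.

Lemma cv3_rho (u v : vec) : crs u v \is a GRing.unit ->
  cv3 (gi *: u - v) (v + gi *: (- u - v)) = cv (- u - v) u.
Proof.
move=> uv; apply: eq_cv; last exact: hv3_rho.
  by apply: unit_rho; exact: unit_rho.
exact: unit_cyc2.
Qed.

Lemma cv2_rho (u v : vec) (a := gi *: u - v) (b := v + gi *: (- u - v)) :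
  crs u v \is a GRing.unit -> cv (- a - b) a = cv u v.
Proof.
move=> uv; apply: eq_cv => //; last by rewrite /a /b; hring u v.
by apply: unit_cyc2; exact: unit_rho.
Qed.

(** The six tangencies all come from [TD_base] by rotating the tetrahedron. *)
Lemma chamber_TD (u v : vec) (w := - u - v) : crs u v \is a GRing.unit ->
  [/\ TD (cv u v) (cv v w), TD (cv u v) (cv w u), TD (cv v w) (cv w u) &
   [/\ TD (cv u v) (cv3 u v), TD (cv v w) (cv3 u v) & TD (cv w u) (cv3 u v)]].
Proof.
have tb (a b : vec) : crs a b \is a GRing.unit -> TD (cv a b) (cv b (- a - b)).
  move=> ab; have := TD_base R (unit_cyc ab); rewrite (_ : - b - _ = a); last by vring.
  exact: TDC.
have t3 (a b : vec) : crs a b \is a GRing.unit -> TD (cv a b) (cv3 a b).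
  by move=> ab; have := TD_base R (unit_rho ab); rewrite cv2_rho // => /TDC.
have e1 : - v - w = u by rewrite /w; vring.
move=> uv; have vw := unit_cyc uv; have wu := unit_cyc2 uv.
split; [exact: tb | exact: TD_base | by have := tb _ _ vw; rewrite e1|split].
- exact: t3.
- by rewrite -cv3_cyc //; exact: t3.
- by rewrite -cv3_cyc // -cv3_cyc // e1; exact: t3.
Qed.

Lemma tangent_irrefl (x y : vec) : crs x y \is a GRing.unit ->
  ~ tangent (circ x y) (circ x y).
Proof.
move=> xy [z]; rewrite setIid circ_cmob /= => e.
have inj := can_inj (mobK (cmob_det R xy)).
have h (t : R) : mob (gint_complex R (x ord0 ord0)) (gint_complex R (y ord0 ord0))
   (gint_complex R (x ord_max ord0)) (gint_complex R (y ord_max ord0))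
   (Some (Complex t 0)) = z.
  suff : [set z] (mob (gint_complex R (x ord0 ord0)) (gint_complex R (y ord0 ord0))
   (gint_complex R (x ord_max ord0)) (gint_complex R (y ord_max ord0))
   (Some (Complex t 0))) by [].
  by rewrite -e; exists (Some (Complex t 0)) => //=; ring.
have : Some (Complex (0 : R) 0) = Some (Complex 1 0).
  by apply: inj; rewrite !h.
by case=> /eqP; rewrite eq_sym oner_eq0.
Qed.

(** The zeros at infinity, 0 and 1 leave only [fB], the normalization makes it 1 or -1, and the
    point -i of the interior decides the sign. *)
Lemma oc_form1 (f : form R) : disc f = 1 -> oc f = oc (form1 R) -> f = form1 R.
Proof.
case: f => A B E D; rewrite /disc /= => d1 e.
have hp p : hval (form1 R) p = 0 -> hval (Form A B E D) p = 0.
  move=> h; have : pts (oc (Form A B E D)) p by rewrite e.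
  by [].
have hi p : 0 < hval (form1 R) p -> 0 < hval (Form A B E D) p.
  move=> h; have : interior (oc (Form A B E D)) p by rewrite e.
  by [].
have A0 : A = 0 by apply: (hp None).
have D0 : D = 0 by have := hp (Some (Complex 0 0)); rewrite /= A0; lra.
have E0 : E = 0 by have := hp (Some (Complex 1 0)); rewrite /= A0 D0; lra.
have B0 : 0 < B by have := hi (Some (Complex 0 (-1))); rewrite /= A0 D0 E0; lra.
have : (B - 1) * (B + 1) = 0.
  have -> : (B - 1) * (B + 1) = B ^+ 2 - 1 by ring.
  by move: d1; rewrite A0 E0; lra.
move/eqP; rewrite mulf_eq0 => /orP[/eqP h|/eqP h]; last by exfalso; lra.
by rewrite /form1; congr Form; lra.
Qed.

Lemma cmob_inj (x y : vec) (o o' : ocircle R) : crs x y \is a GRing.unit ->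
  cmob x y o = cmob x y o' -> o = o'.
Proof.
move=> /(cmob_det R) D e; rewrite -(mobcK o D) -(mobcK o' D).
by congr mobc; exact: e.
Qed.

Lemma circ_linked (x y x' y' : vec) : crs x y \is a GRing.unit ->
  crs x' y' \is a GRing.unit -> circ x y = circ x' y' ->
  linked (kcor x y) (kcor x' y').
Proof.
move=> xy xy'; have [a [b [c [d [D -> ->]]]]] := basis_comb xy xy'.
rewrite circ_comb // circ_cmob => /(cmob_inj xy) /esym /(oc_form1 (disc_gcirc R D)).
case=> hA hB hC hD.
have /(hermg_one D)[e [p [q [r [s [ue d1 -> -> [-> ->]]]]]]] :
    hermg a b c d = Form 0 1 0 0.
  rewrite /hermg; congr Form; apply: (@intr_inj R);
    by [exact: hA | exact: hB | exact: hC | exact: hD].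
set c1 := kcor (_ + _) _.
have -> : c1 = kcor (vpair x y p q) (vpair x y r s).
  rewrite /c1 /kcor -(corv_unit (vpair x y p q) _ ue) /vpair.
  by congr (corv _ _); vring.
exact: linked_SL2.
Qed.

Lemma cv_linked (u v u' v' : vec) : crs u v \is a GRing.unit ->
  crs u' v' \is a GRing.unit -> cv u v = cv u' v' -> linked (corv u v) (corv u' v').
Proof.
move=> uv uv' /(circ_linked (unit_giv uv) (unit_giv uv')); rewrite /kcor.
by congr (linked (corv _ _) (corv _ _)); vring.
Qed.

(* With the first circle moved to the real line, the neighbour touching it at the
   same point and the second circle have the forms [Im z - n] and [Im z - k n]
   with [0 <= n] and [1 <= k], so the former interior contains the latter. *)
Lemma TD_neighbour (x y x' y' : vec) : crs x y \is a GRing.unit ->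
  crs x' y' \is a GRing.unit -> TD (circ x y) (circ x' y') ->
  exists u v, [/\ crs u v \is a GRing.unit, cv u v = circ x y
    & cv v (- u - v) = circ x' y' \/
      interior (cv v (- u - v)) `&` interior (circ x' y') !=set0].
Proof.
move=> xy xy'; have [a [b [c [d [D -> ->]]]]] := basis_comb xy xy'.
rewrite (circ_comb R xy D) (circ_comb1 R xy) TD_cmob // => t.
have [B2 C2 A2 E2 N2] := TD_gcirc1 D t.
have [k [p [q [r [s [k1 Ap Dq Cpq d1]]]]]] := rank1_form C2 A2 E2 N2.
have d1' : s * p - q * r = 1 by rewrite -d1; ring.
have [uv e1 e2 _] := SL2_frame R xy d1'.
do 2 eexists; split; [exact: uv | by rewrite e1 (circ_comb1 R xy) | rewrite e2].
rewrite /gcirc.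
case: (hermg a b c d) B2 Ap Dq Cpq {t C2 A2 E2 N2} => A B E F /= -> -> -> ->.
have [->|kn1] := eqVneq k 1.
  by left; congr (cmob _ _ (oc (fZ R (Form _ _ _ _)))); ring.
right; rewrite /cmob /mobc /=.
have kR : 1 <= k%:~R :> R by rewrite ler1z.
(* The smaller interior Im z > k |p z - q|^2 is nonempty: it is a half plane if p = 0, and otherwise
   a disc with centre q/p + i / (2 k p^2). *)
have [z hz] : exists z : Cinf R, 0 < hval (fZ R (Form (- k * p ^+ 2) (-1)
    (- 2 * k * p * q) (- k * q ^+ 2))) z.
  have [p0|p0] := eqVneq p 0.
    exists (Some (Complex 0 (k%:~R * q%:~R ^+ 2 + 1))) => /=.
    by rewrite p0 !(intrM, mulrNz, expr0n) /=; lra.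
  have pR : p%:~R != 0 :> R by rewrite intr_eq0.
  have e0 : 0 < (2 * k%:~R * p%:~R ^+ 2)^-1 :> R.
    have k0 : 0 < k%:~R :> R by lra.
    have p20 : 0 < p%:~R ^+ 2 :> R by rewrite lt_def sqrf_eq0 pR sqr_ge0.
    by rewrite invr_gt0; apply: mulr_gt0 => //; apply: mulr_gt0.
  exists (Some (Complex (q%:~R / p%:~R) ((2 * k%:~R * p%:~R ^+ 2)^-1))) => /=.
  rewrite !(intrM, mulrNz) /=.
  have kn0 : k%:~R != 0 :> R by rewrite gt_eqF //; lra.
  set X := (X in 0 < X).
  have -> : X = (2 * k%:~R * p%:~R ^+ 2)^-1 / 2.
    by rewrite /X; field; rewrite pR kn0.
  by rewrite divr_gt0.
eexists; split; exists z => //=.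
apply: lt_le_trans hz _; case: z => [[s1 s2]|] /=.
  rewrite !(intrM, mulrNz) /= -subr_ge0.
  set X := (X in 0 <= X).
  have -> : X = (k%:~R - 1) * ((p%:~R * s1 - q%:~R) ^+ 2 + (p%:~R * s2) ^+ 2).
    by rewrite /X; ring.
  by apply: mulr_ge0; [rewrite subr_ge0 | rewrite addr_ge0 ?sqr_ge0].
rewrite !(intrM, mulrNz) /= -subr_ge0.
set X := (X in 0 <= X).
have -> : X = (k%:~R - 1) * p%:~R ^+ 2 by rewrite /X; ring.
by apply: mulr_ge0; [rewrite subr_ge0 | exact: sqr_ge0].
Qed.

End Kingdom.

(** * The kingdom and the packings *)

Lemma hv3_sum (u v : vec) (w := - u - v) :
  [/\ fA (hv3 v u) = 2 * (fA (hv u v) + fA (hv v w) + fA (hv w u)) - fA (hv3 u v),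
      fB (hv3 v u) = 2 * (fB (hv u v) + fB (hv v w) + fB (hv w u)) - fB (hv3 u v),
      fC (hv3 v u) = 2 * (fC (hv u v) + fC (hv v w) + fC (hv w u)) - fC (hv3 u v) &
      fD (hv3 v u) = 2 * (fD (hv u v) + fD (hv v w) + fD (hv w u)) - fD (hv3 u v)].
Proof.
rewrite /w /hv3 /hv /herm !mxE.
case: (u ord0 ord0) => ? ?; case: (u ord_max ord0) => ? ?;
case: (v ord0 ord0) => ? ?; case: (v ord_max ord0) => ? ?;
by rewrite /hermg /=; split; ring.
Qed.

Lemma set4E (T : Type) (a b c d : T) :
  [set a; b; c; d] = [set x | List.In x [:: a; b; c; d]].
Proof. by apply/seteqP; split=> t /=; intuition. Qed.

Lemma card_set4 (T : Type) (a b c d : T) :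
  [set a; b; c; d] #= `I_4 <-> List.NoDup [:: a; b; c; d].
Proof. by rewrite set4E; exact: (card_In_eq [:: a; b; c; d]). Qed.

Lemma card4_set4 (T : Type) (A : set T) : A #= `I_4 ->
  exists a b c d, A = [set a; b; c; d].
Proof.
have D (B : set T) x : B x -> B = x |` (B `\ x) by move=> Bx; rewrite setD1K.
move=> /eq_cardSP[a Aa /eq_cardSP[b Bb /eq_cardSP[c Cc /eq_cardSP[d Dd]]]].
rewrite II0 card_eq0 => /eqP E.
exists a, b, c, d.
by rewrite (D _ _ Aa) (D _ _ Bb) (D _ _ Cc) (D _ _ Dd) E setU0 !setUA.
Qed.

Lemma det_mx22 (T : comNzRingType) (M : 'M[T]_2) :
  \det M = M ord0 ord0 * M ord_max ord_max - M ord0 ord_max * M ord_max ord0.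
Proof.
rewrite (expand_det_row _ ord0) big_ord_recl big_ord_recl big_ord0 addr0.
rewrite /cofactor !det_mx11 !mxE.
rewrite (_ : lift ord0 0 = ord_max :> 'I_2); last exact: val_inj.
rewrite (_ : lift ord_max 0 = ord0 :> 'I_2); last exact: val_inj.
by rewrite /= expr0 expr1; ring.
Qed.

(** * The vertex map and Descartes quadruples *)

Section Vertices.
Variable R : realType.
Local Notation circ := (circ R).
Local Notation cv := (cv R).
Local Notation cv3 := (cv3 R).

Definition kv (u v : vec) : set corner := kclass (corv u v).

Lemma kvertexP (P : set corner) : kvertex P <->
  exists u v, crs u v \is a GRing.unit /\ P = kv u v.
Proof.
split=> [[c /is_cornerP[u [v [uv ->]]] <-]|[u [v [uv ->]]]]; first by exists u, v.
by exists (corv u v) => //; apply/is_cornerP; exists u, v.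
Qed.

Lemma kv_cv (u v u' v' : vec) : crs u v \is a GRing.unit ->
  crs u' v' \is a GRing.unit -> kv u v = kv u' v' <-> cv u v = cv u' v'.
Proof.
move=> uv uv'; split=> [/kclass_eq l|e]; last by apply/kclass_eq; exact: cv_linked e.
have [u1 [v1 [uv1 e h]]] := (linked_hv l).1 _ _ uv erefl.
by apply: eq_cv => //; rewrite h; apply/esym; exact: corv_hv.
Qed.

(** A presentation of the vertex is chosen; [PhiE] shows that the choice does not matter.
    [real_circle] is a default outside [kvertex]. *)
Definition Phi (P : set corner) : ocircle R :=
  if pselect (exists uv : vec * vec, crs uv.1 uv.2 \is a GRing.unit /\ P = kv uv.1 uv.2)
    is left h then cv (projT1 (cid h)).1 (projT1 (cid h)).2 else real_circle R.

Lemma PhiE (u v : vec) : crs u v \is a GRing.unit -> Phi (kv u v) = cv u v.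
Proof.
move=> uv; rewrite /Phi; case: pselect => [h|[]]; last by exists (u, v).
by case: cid => -[a b] /= [ab e]; apply/kv_cv.
Qed.

Lemma Phi_inj (P Q : set corner) : kvertex P -> kvertex Q -> Phi P = Phi Q -> P = Q.
Proof.
move=> /kvertexP[u [v [uv ->]]] /kvertexP[u' [v' [uv' ->]]].
by rewrite !PhiE // => /kv_cv; apply.
Qed.

Definition cvs (u v : vec) : set (ocircle R) :=
  [set cv u v; cv v (- u - v); cv (- u - v) u; cv3 u v].

Lemma chamber_verticesE (u v : vec) (w := - u - v) : crs u v \is a GRing.unit ->
  chamber_vertices (cw u v) =
  [set kv u v; kv v w; kv w u; kv (gi *: u - v) (v + gi *: w)].
Proof.
move=> uv; apply/seteqP; split=> P.
  by case=> T /(corner_cw _ uv)[] e <-; rewrite e /=; rewrite -/w; tauto.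
have e1 : cw v w = cw u v by rewrite -cw_cyc.
have e2 : cw w u = cw u v.
  by rewrite -e1 (cw_cyc v w) (_ : - v - w = u) // /w; vring.
have e3 : cw (gi *: u - v) (v + gi *: w) = cw u v by rewrite -cw_rho.
case=> [[[->|->]|->]|->].
- by exists (corv u v).2 => //; apply/corner_cw => //; constructor 1.
- exists (corv v w).2; last by rewrite -e1.
  by apply/corner_cw => //; constructor 2; rewrite -e1.
- exists (corv w u).2; last by rewrite -e2.
  by apply/corner_cw => //; constructor 3; rewrite -e2.
- exists (corv (gi *: u - v) (v + gi *: w)).2; last by rewrite -e3.
  by apply/corner_cw => //; constructor 4; rewrite -e3.
Qed.

Definition Dc (W : set (set laxv)) : set (ocircle R) := Phi @` chamber_vertices W.

Lemma DcE (u v : vec) : crs u v \is a GRing.unit -> Dc (cw u v) = cvs u v.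
Proof.
move=> uv; rewrite /Dc chamber_verticesE // !image_setU !image_set1.
have vw := unit_cyc uv; have wu := unit_cyc2 uv; have rh := unit_rho uv.
by rewrite !PhiE.
Qed.

Lemma chamber_vertices_kvertex (W : set (set laxv)) : chamber W ->
  chamber_vertices W `<=` kvertex.
Proof. by move=> cW P [T cT <-]; exists (W, T). Qed.

Lemma gaussianP (c : ocircle R) : gaussian_circle c <->
  exists u v, crs u v \is a GRing.unit /\ c = cv u v.
Proof.
have det2 (x y : vec) : \det (row_mx x y : 'M_2) = crs x y.
  rewrite det_mx22 !(row_mxE x y _).1 !(row_mxE x y _).2; exact: det_crs.
split=> [[M uM <-]|[u [v [uv ->]]]].
  pose x : vec := lsubmx (M : 'M_(2, 1 + 1)).
  pose y : vec := rsubmx (M : 'M_(2, 1 + 1)).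
  have eM : M = row_mx x y by rewrite hsubmxK.
  have xy : crs x y \is a GRing.unit by rewrite -det2 -eM; exact: uM.
  exists x, (- gi *: y); split; first exact: unit_kcor.
  by rewrite eM /cv /circ (_ : gi *: (- gi *: y) = y) //; vring.
exists (row_mx u (gi *: v)) => //.
rewrite /= unitmxE det2; exact: unit_giv.
Qed.

Lemma kv_gaussian (P : set corner) : kvertex P -> gaussian_circle (Phi P).
Proof.
by move=> /kvertexP[u [v [uv ->]]]; apply/gaussianP; exists u, v; rewrite PhiE.
Qed.

Lemma TD_neq (u v : vec) (d : ocircle R) : crs u v \is a GRing.unit ->
  TD (cv u v) d -> cv u v <> d.
Proof.
move=> uv [t _] e; rewrite -e in t.
exact: (tangent_irrefl (unit_giv uv) t).
Qed.

Lemma cvs_NoDup (u v : vec) : crs u v \is a GRing.unit ->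
  List.NoDup [:: cv u v; cv v (- u - v); cv (- u - v) u; cv3 u v].
Proof.
move=> uv; have [t01 t02 t12 [t03 t13 t23]] := chamber_TD R uv.
have vw := unit_cyc uv; have wu := unit_cyc2 uv.
have := TD_neq uv t01; have := TD_neq uv t02; have := TD_neq vw t12.
have := TD_neq uv t03; have := TD_neq vw t13; have := TD_neq wu t23.
move: (cv u v) (cv v _) (cv _ u) (cv3 u v) => a b c d *.
by repeat (constructor; simpl); intuition.
Qed.

Lemma cvs_TD (u v : vec) (c d : ocircle R) : crs u v \is a GRing.unit ->
  cvs u v c -> cvs u v d -> c <> d -> TD c d.
Proof.
move=> uv; have [] := chamber_TD R uv; rewrite /cvs.
move: (cv u v) (cv v _) (cv _ u) (cv3 u v) => c0 c1 c2 c3 t01 t02 t12 [t03 t13 t23].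
by move=> [[[->|->]|->]|->] [[[->|->]|->]|->] h //; exact: TDC.
Qed.

Lemma cvs_descartes (u v : vec) : crs u v \is a GRing.unit ->
  gaussian_descartes (cvs u v).
Proof.
move=> uv; have vw := unit_cyc uv; have wu := unit_cyc2 uv; have rh := unit_rho uv.
split; last first.
  move=> c [[[->|->]|->]|->]; apply/gaussianP;
    by do 2 eexists; split; last reflexivity.
split; first by apply/card_set4; exact: cvs_NoDup.
  by move=> c [[[->|->]|->]|->]; apply: circ_is_ocircle; exact: unit_giv.
by move=> c d hc hd cd; have [] := cvs_TD uv hc hd cd.
Qed.

Lemma cvs_swap (u v : vec) : crs u v \is a GRing.unit ->
  cvs v u = [set cv u v; cv v (- u - v); cv (- u - v) u; cv3 v u].
Proof.
move=> uv; rewrite /cvs (addrC (- v)) cv_flip // (cv_flip R (unit_cyc uv)).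
rewrite (cv_flip R (unit_cyc2 uv)).
by apply/seteqP; split=> t /=; tauto.
Qed.

(** The fourth circle is not assumed Gaussian: the other three leave only two candidates. This is
    the form needed for a stage of a packing, where nothing is known about the added circle. *)
Lemma triple_chamber (a b c d : ocircle R) :
  gaussian_circle a -> gaussian_circle b -> gaussian_circle c ->
  descartes [set a; b; c; d] ->
  exists u v, crs u v \is a GRing.unit /\ [set a; b; c; d] = cvs u v.
Proof.
move=> /gaussianP[u1 [v1 [uv1 ea]]] /gaussianP[u2 [v2 [uv2 eb]]].
move=> /gaussianP[u3 [v3 [uv3 ec]]] [/card_set4 nd oc0 td].
have td' x y : [set a; b; c; d] x -> [set a; b; c; d] y -> x <> y -> TD x y.
  by move=> hx hy xy; have := td _ _ hx hy xy.
have [ab ac ad [bc bd cd]] : [/\ a <> b, a <> c, a <> d & [/\ b <> c, b <> d & c <> d]].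
  by nodups; repeat split; dcong.
have [ma mb mc md] : [/\ [set a; b; c; d] a, [set a; b; c; d] b, [set a; b; c; d] c
    & [set a; b; c; d] d] by split=> /=; tauto.
have tab : TD (cv u1 v1) (cv u2 v2) by rewrite -ea -eb; apply: td'.
have tac : TD (cv u1 v1) (cv u3 v3) by rewrite -ea -ec; apply: td'.
have tbc : TD (cv u2 v2) (cv u3 v3) by rewrite -eb -ec; apply: td'.
have [u [v [uv e1 e2 e3]]] :=
  TD_triple (unit_giv uv1) (unit_giv uv2) (unit_giv uv3) tab tac tbc.
have {}e1 : cv u v = a by rewrite e1 ea.
have {}e2 : cv v (- u - v) = b by rewrite e2 eb.
have {}e3 : cv (- u - v) u = c by rewrite e3 ec.
have [|||h|h] := TD_fourth uv (oc0 _ md).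
- by rewrite e1; apply: td'.
- by rewrite e2; apply: td'.
- by rewrite e3; apply: td'.
- by exists u, v; split=> //; rewrite /cvs e1 e2 e3 -h.
- by exists v, u; split; [exact: unit_crsC | rewrite cvs_swap // e1 e2 e3 -h].
Qed.

Lemma gaussian_descartes_cvs (D : set (ocircle R)) : gaussian_descartes D ->
  exists u v, crs u v \is a GRing.unit /\ D = cvs u v.
Proof.
case=> dD gD; have [/card4_set4[a [b [c [d eD]]]] _ _] := dD.
rewrite eD in dD gD *.
by apply: triple_chamber => //; apply: gD => /=; tauto.
Qed.

End Vertices.

(** * Recovering a chamber from its circles *)

Section Chambers.
Variable R : realType.
Local Notation cv := (cv R).
Local Notation cv3 := (cv3 R).
Local Notation cvs := (@cvs R).
Local Notation Dc := (@Dc R).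
Local Notation gc := (@gint_complex R).

Lemma reframe (u v : vec) (d : ocircle R) : crs u v \is a GRing.unit -> cvs u v d ->
  exists u' v', [/\ crs u' v' \is a GRing.unit, cw u v = cw u' v' & d = cv3 u' v'].
Proof.
have base (a b : vec) : crs a b \is a GRing.unit ->
    exists u' v', [/\ crs u' v' \is a GRing.unit, cw a b = cw u' v'
      & cv (- a - b) a = cv3 u' v'].
  move=> ab; exists (gi *: a - b), (b + gi *: (- a - b)); split.
  - exact: unit_rho.
  - exact: cw_rho.
  - by rewrite cv3_rho.
move=> uv [[[->|->]|->]|->].
- have := base _ _ (unit_cyc uv); rewrite -cw_cyc (_ : - v - _ = u) //; vring.
- have := base _ _ (unit_cyc2 uv); rewrite (_ : - _ - u = v); last by vring.
  by rewrite (cw_cyc (- u - v)) (_ : - _ - u = v) //; vring.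
- exact: base.
- by exists u, v.
Qed.

Lemma cvs_cv3 (u v : vec) : cvs u v (cv3 u v).
Proof. by right. Qed.

Definition pt (a : vec) : Cinf R := proj (gc (a ord0 ord0), gc (a ord_max ord0)).

Lemma gc_eq0 (x : gint) : gc x = 0 -> x = 0.
Proof.
case: x => a b [/= h1 h2]; congr Complex; apply: (@intr_inj R); [exact: h1|exact: h2].
Qed.

(** Equal points mean a vanishing determinant, so [a'] is a multiple of [a]; the factor divides the
    unit [crs a' b']. *)
Lemma pt_inj (a b a' b' : vec) : crs a b \is a GRing.unit ->
  crs a' b' \is a GRing.unit -> pt a = pt a' -> lax a = lax a'.
Proof.
move=> ab ab' e; have c0 : crs a a' = 0.
  apply: gc_eq0; rewrite /crs gcD gcN !gcM; move: e; rewrite /pt /proj /=.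
  move: (gc (a ord0 ord0)) (gc (a ord_max ord0)) (gc (a' ord0 ord0))
    (gc (a' ord_max ord0)) => z1 z2 t1 t2.
  have [->|z20] := eqVneq z2 0; have [->|t20] := eqVneq t2 0 => //.
    by rewrite mul0r mulr0 subrr.
  move=> /(congr1 (odflt 0)); rewrite [LHS]/= [RHS]/= => /eqP.
  by rewrite eqr_div // => /eqP ->; rewrite mulrC subrr.
have eE := crs_cramer a b a'; rewrite c0 scale0r addr0 in eE.
have {}eE : a' = (crs a' b / crs a b) *: a.
  by rewrite mulrC -scalerA -eE scalerA mulVr ?scale1r.
move: ab'; set s := _ / _ in eE; rewrite {1}eE.
rewrite (_ : crs _ _ = s * crs a b'); last by cring.
by rewrite unitrM => /andP[us _]; apply/esym; exact: lax_scaled us eE.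
Qed.

Lemma pt_cv (u v : vec) : crs u v \is a GRing.unit ->
  pts (cv u v) (pt u) /\ pts (cv u v) (pt v).
Proof.
move=> uv; rewrite /cv circ_cmob /=; split.
  exists None => //; rewrite /mob /=; congr proj.
  by rewrite /mulv /= !mulr1 !mulr0 !addr0.
exists (Some 0); first by rewrite /=; ring.
rewrite /mob /pt /= /mulv /= !mulr1 !mulr0 !add0r !mxE !gcM.
by rewrite (proj_scale (gc (v ord0 ord0), gc (v ord_max ord0))) // nsq1_neq0 // gc_nsq.
Qed.

(* The edges of a wall are recovered as the tangency points of the circles at its
   vertices. *)
Definition touching (X : set (ocircle R)) : set laxv :=
  [set L | exists a b c c', [/\ crs a b \is a GRing.unit, L = lax a,
    X c /\ X c', c <> c' & pts c (pt a) /\ pts c' (pt a)]].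

Lemma touching_wall (u v : vec) (w := - u - v) : crs u v \is a GRing.unit ->
  touching [set cv u v; cv v w; cv w u] = [set lax u; lax v; lax w].
Proof.
move=> uv; have vw : crs v w \is a GRing.unit by exact: unit_cyc.
have wu : crs w u \is a GRing.unit by exact: unit_cyc2.
have [t01 t02 t12 _] := chamber_TD R uv.
have n01 := TD_neq uv t01; have n02 := TD_neq uv t02; have n12 := TD_neq vw t12.
have [p0u p0v] := pt_cv uv; have [p1v p1w] := pt_cv vw; have [p2w p2u] := pt_cv wu.
have one (c c' : ocircle R) (a b a' b' : vec) : TD c c' ->
    crs a b \is a GRing.unit -> crs a' b' \is a GRing.unit ->
    pts c (pt a) -> pts c' (pt a) -> pts c (pt a') -> pts c' (pt a') -> lax a = lax a'.
  move=> [[z e] _] ab ab' h1 h2 h3 h4; apply: (pt_inj ab ab').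
  have : [set z] (pt a) by rewrite -e.
  have : [set z] (pt a') by rewrite -e.
  by move=> -> ->.
apply/seteqP; split=> L.
  move=> [a [b [c [c' [ab -> [hc hc'] cc' [pc pc']]]]]].
  have e01 : pts (cv u v) (pt a) -> pts (cv v w) (pt a) -> lax a = lax v.
    by move=> h1 h2; apply: (one _ _ _ _ _ _ t01 ab vw).
  have e02 : pts (cv u v) (pt a) -> pts (cv w u) (pt a) -> lax a = lax u.
    by move=> h1 h2; apply: (one _ _ _ _ _ _ t02 ab uv).
  have e12 : pts (cv v w) (pt a) -> pts (cv w u) (pt a) -> lax a = lax w.
    by move=> h1 h2; apply: (one _ _ _ _ _ _ t12 ab wu).
  move: hc hc' cc' pc pc' e01 e02 e12.
  move: (cv u v) (cv v w) (cv w u) => c0 c1 c2 /=.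
  by move=> [[->|->]|->] [[->|->]|->] cc' *; first [case: (cc' erefl) | tauto].
case=> [[->|->]|->].
- by exists u, v, (cv u v), (cv w u); split=> //; split=> /=; tauto.
- by exists v, w, (cv u v), (cv v w); split=> //; split=> /=; tauto.
- by exists w, u, (cv v w), (cv w u); split=> //; split=> /=; tauto.
Qed.

Lemma cv3_neq (u v : vec) : crs u v \is a GRing.unit -> cv3 u v <> cv3 v u.
Proof.
move=> uv; rewrite (cv3E R uv) (cv3sE R uv) => /(cmob_inj (unit_giv uv)).
rewrite /gcirc fZ3 fZ3s => e.
(* The centre of the first disc, which lies outside the second. *)
have : interior (oc (Form (-1) (-1) (- 2) (-1))) (Some (Complex (1 : R) 2^-1)).
  by rewrite /=; lra.
by rewrite e /=; lra.
Qed.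

(** Both chambers are framed so that the same circle is the fourth one. The other three then agree
    as a set, their tangency points give a common wall, and the chamber across it is excluded
    because its fourth circle differs. *)
Lemma Dc_inj (W W' : set (set laxv)) : chamber W -> chamber W' -> Dc W = Dc W' -> W = W'.
Proof.
move=> /chamber_cw[u [v [uv ->]]] cW'; rewrite DcE // => eD.
have [u1 [v1 [uv1 eW1]]] := chamber_cw cW'.
have : cvs u1 v1 (cv3 u v) by rewrite -DcE // -eW1 -eD; exact: cvs_cv3.
move=> /(reframe uv1)[u' [v' [uv' eW2 e3]]].
have eW' : W' = cw u' v' := etrans eW1 eW2.
have {}eD : cvs u v = cvs u' v' by rewrite eD eW' DcE.
have cvsD (a b : vec) : crs a b \is a GRing.unit -> cvs a b `\ cv3 a b =
    [set cv a b; cv b (- a - b); cv (- a - b) a].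
  move=> ab; have := cvs_NoDup R ab; rewrite /cvs.
  move: (cv a b) (cv b _) (cv _ a) (cv3 a b) => c0 c1 c2 c3 nd.
  apply/seteqP; split=> t /=; first by tauto.
  by case=> [[->|->]|->]; nodups; split; dcong.
have eF : [set lax u; lax v; lax (- u - v)] = [set lax u'; lax v'; lax (- u' - v')].
  rewrite -(touching_wall uv) -(touching_wall uv'); congr touching.
  by rewrite -(cvsD _ _ uv) -(cvsD _ _ uv') eD e3.
have WF : W' [set lax u; lax v; lax (- u - v)].
  by rewrite eF eW'; left; left; left.
have [<-|e] := chamber_wall uv cW' WF; first by [].
have m := cvs_cv3 u v.
have d1 : Dc W' = cvs v u by rewrite e; apply: DcE; exact: unit_crsC.
have d2 : Dc W' = cvs u v by rewrite eW' eD; apply: DcE.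
exfalso; move: m; have -> : cvs u v = cvs v u := etrans (esym d2) d1.
rewrite (cvs_swap R uv); have := cvs_NoDup R uv; have := cv3_neq uv.
move: (cv u v) (cv v _) (cv _ u) (cv3 u v) (cv3 v u) => c0 c1 c2 c3 c4 n34 nd.
by move=> [[[h|h]|h]|h]; nodups; dcong.
Qed.

End Chambers.

(** * Components and packings *)

Section Packing.
Variable R : realType.
Local Notation cv := (cv R).
Local Notation cv3 := (cv3 R).
Local Notation cvs := (@cvs R).
Local Notation Phi := (Phi R).
Local Notation Dc := (@Dc R).

(** A property of chambers that passes through walls is constant on the chambers around a vertex;
    [reach_inv] extends this to a whole component. *)
Lemma linked_inv (Pr : set (set (set laxv))) :
  (forall W W' F, Pr W -> chamber W -> chamber W' -> W F -> W' F -> Pr W') ->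
  forall c c', linked c c' -> (Pr c.1 <-> Pr c'.1).
Proof.
move=> step c c'; elim=> {c c'} [c c' [[cc _] [cc' _] [F [h1 h2 _ _]]]|//|c c' _ <-//|].
  by split=> h; [exact: (step c.1 c'.1 F) | exact: (step c'.1 c.1 F)].
by move=> c c' c'' _ -> _ ->.
Qed.

Definition reach : set corner -> set corner -> Prop :=
  clos_refl_sym_trans (set corner) kedge.

Lemma reach_inv (Pr : set (set (set laxv))) :
  (forall W W' F, Pr W -> chamber W -> chamber W' -> W F -> W' F -> Pr W') ->
  forall P Q, reach P Q ->
  (forall c, P c -> Pr c.1) <-> (forall c, Q c -> Pr c.1).
Proof.
move=> step P Q; elim=> {P Q} [P Q|//|P Q _ <-//|P Q S _ -> _ -> //].
move=> [W [T [T' [cW _ _ -> ->]]]].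
have E (T0 : set laxv) : (forall c, kclass (W, T0) c -> Pr c.1) <-> Pr W.
  split=> [h|h c l]; first by apply: (h (W, T0)); exact: rst_refl.
  by apply/(linked_inv step l).
by rewrite !E.
Qed.

Lemma kedge_kvertex (P Q : set corner) : kedge P Q -> kvertex P /\ kvertex Q.
Proof.
by move=> [W [T [T' [cW [cT cT'] _ -> ->]]]]; split; [exists (W, T) | exists (W, T')].
Qed.

Lemma reach_kvertex (P Q : set corner) : reach P Q -> (kvertex P <-> kvertex Q).
Proof.
elim=> {P Q} [P Q /kedge_kvertex[]|//|P Q _ <-//|P Q S _ -> _ -> //].
by split.
Qed.

Lemma chamber_reach (W : set (set laxv)) (P Q : set corner) : chamber W ->
  chamber_vertices W P -> chamber_vertices W Q -> reach P Q.
Proof.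
move=> cW [T cT <-] [T' cT' <-]; have [->|ne] := pselect (T = T').
  exact: rst_refl.
by apply: rst_step; exists W, T, T'.
Qed.

Lemma corner_Phi_inj (u v : vec) (T T' : set laxv) : crs u v \is a GRing.unit ->
  corner_of (cw u v) T -> corner_of (cw u v) T' ->
  Phi (kclass (cw u v, T)) = Phi (kclass (cw u v, T')) -> T = T'.
Proof.
move=> uv; pose w := - u - v.
have vals (S : set laxv) (c := Phi (kclass (cw u v, S))) : corner_of (cw u v) S ->
    [\/ c = cv u v /\ S = (corv u v).2, c = cv v w /\ S = (corv v w).2,
       c = cv w u /\ S = (corv w u).2 |
       c = cv3 u v /\ S = (corv (gi *: u - v) (v + gi *: w)).2].
  rewrite /c => /(corner_cw _ uv)[] e; rewrite e -/(kv _ _).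
  - by constructor 1; split; [exact: PhiE | exact: (congr1 snd e)].
  - by constructor 2; split; [apply: PhiE; exact: unit_cyc | exact: (congr1 snd e)].
  - by constructor 3; split; [apply: PhiE; exact: unit_cyc2 | exact: (congr1 snd e)].
  - by constructor 4; split; [apply: PhiE; exact: unit_rho | exact: (congr1 snd e)].
have := cvs_NoDup R uv; move=> nd /vals cT /vals cT'; move: nd cT cT'.
rewrite -/w; move: (cv u v) (cv v w) (cv w u) (cv3 u v) => c0 c1 c2 c3.
move: (Phi _) (Phi _) (corv u v).2 (corv v w).2 (corv w u).2 (corv _ _).2.
move=> p p' T0 T1 T2 T3 nd; nodups.
by case=> [[-> ->]|[-> ->]|[-> ->]|[-> ->]] [[-> ->]|[-> ->]|[-> ->]|[-> ->]] // h;
  dcong.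
Qed.

(** * Disjoint interiors within a component *)

Section Disjoint.
Variables (a : ocircle R) (p : Cinf R).

(** With this sign the value is nonnegative exactly when [p] is outside the interior. *)
Definition pval (u v : vec) : R := - hval (fZ R (hv u v)) p.
Definition pval3 (u v : vec) : R := - hval (fZ R (hv3 u v)) p.

Lemma pval3_swap (u v : vec) :
  pval3 v u = 2 * (pval u v + pval v (- u - v) + pval (- u - v) u) - pval3 u v.
Proof.
rewrite /pval3 /pval; have [] := hv3_sum u v.
move: (hv3 v u) (hv3 u v) (hv u v) (hv v _) (hv _ u).
move=> [A B E D] [A1 B1 E1 D1] [A2 B2 E2 D2] [A3 B3 E3 D3] [A4 B4 E4 D4] /= -> -> -> ->.
case: p => [[x y]|] /=; rewrite !(intrD, mulrNz, intrM); ring.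
Qed.

(* Away from the chambers containing [a], the value grows along every walk that
   does not turn back: the value at the vertex just reached is at least the sum
   of the other three. *)
Inductive good : set (set laxv) -> Prop :=
| good_start W : chamber W -> Dc W a -> good W
| good_step u v : crs u v \is a GRing.unit ->
    0 <= pval u v -> 0 <= pval v (- u - v) -> 0 <= pval (- u - v) u ->
    pval u v + pval v (- u - v) + pval (- u - v) u <= pval3 u v ->
    good (cw v u) -> good (cw u v).

Lemma interior_val (u v : vec) : crs u v \is a GRing.unit ->
  interior (cv u v) p <-> pval u v < 0.
Proof. by move=> uv; rewrite cv_oc // /pval oppr_lt0. Qed.

Lemma interior_val3 (u v : vec) : crs u v \is a GRing.unit ->
  interior (cv3 u v) p <-> pval3 u v < 0.
Proof. by move=> uv; rewrite interior_val; last exact: unit_rho. Qed.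

Lemma pval_flip (u v : vec) : pval v u = pval u v.
Proof. by rewrite /pval hv_flip. Qed.

Lemma pval3_cyc (u v : vec) : pval3 v (- u - v) = pval3 u v.
Proof. by rewrite /pval3 hv3_cyc. Qed.

(** The walk leaves through a wall containing the vertex just reached, of value d >= a + b + c.
    Trading c for its reflection gives 2(a + b + d) - c, which is at least a + b + d. *)
Lemma good_rho (u v : vec) (W : set (set laxv)) (x := gi *: u - v)
    (y := v + gi *: (- u - v)) :
  crs u v \is a GRing.unit ->
  0 <= pval u v -> 0 <= pval v (- u - v) -> 0 <= pval (- u - v) u ->
  pval u v + pval v (- u - v) + pval (- u - v) u <= pval3 u v ->
  good (cw u v) -> chamber W -> W [set lax x; lax y; lax (- x - y)] -> good W.
Proof.
move=> uv v0 v1 v2 v3 gW cW WF; have xy : crs x y \is a GRing.unit by exact: unit_rho.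
have e0 : pval x y = pval3 u v by [].
have e1 : pval y (- x - y) = pval v (- u - v).
  by rewrite /pval; congr (- hval (fZ R _) p); rewrite /x /y; hring u v.
have e2 : pval (- x - y) x = pval u v.
  by rewrite /pval; congr (- hval (fZ R _) p); rewrite /x /y; hring u v.
have e3 : pval3 x y = pval (- u - v) u by rewrite /pval3 hv3_rho.
have [->|->] := chamber_wall xy cW WF; first by rewrite -cw_rho.
apply: good_step.
- exact: unit_crsC.
- rewrite pval_flip e0; move: v0 v1 v2 v3 {e0 e1 e2 e3}.
  by move: (pval u v) (pval v _) (pval _ u) (pval3 u v) => *; lra.
- by rewrite (addrC (- y)) pval_flip e2.
- by rewrite (addrC (- y)) pval_flip e1.
- rewrite pval3_swap (addrC (- y)) (pval_flip x y) (pval_flip (- x - y) x).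
  rewrite (pval_flip y (- x - y)).
  rewrite e0 e1 e2 e3; move: v0 v1 v2 v3 {e0 e1 e2 e3}.
  by move: (pval u v) (pval v _) (pval _ u) (pval3 u v) => *; lra.
- by rewrite -cw_rho.
Qed.

Lemma good_closed (W W' F : set _) : interior a p -> good W -> chamber W -> chamber W' ->
  W F -> W' F -> good W'.
Proof.
move=> ap gW; case: gW W' F => {W} [W cW Wa|u v uv v0 v1 v2 v3 gW] W' F _ cW' WF WF'.
  have [u [v [uv eW eF]]] := chamberP cW WF.
  rewrite eF in WF'.
  have [eW'|eW'] := chamber_wall uv cW' WF'.
    by apply: good_start; [exact: cW' | rewrite eW' -eW; exact: Wa].
  have vu := unit_crsC uv.
  have da : cvs u v a by rewrite -DcE // -eW.
  (* Unless [a] is opposite to the wall crossed, the new chamber still contains it. If it is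
     opposite, its negative value only increases the new one. *)
  have [a3|na3] := pselect (a = cv3 u v); last first.
    apply: good_start; first exact: cW'.
    rewrite eW' (DcE R vu) (cvs_swap R uv).
    by case: da => [da|da]; [left; exact: da | case: na3].
  rewrite a3 in ap.
  have [_ _ _ [t0 t1 t2]] := chamber_TD R uv.
  have vw := unit_cyc uv; have wu := unit_cyc2 uv.
  have ge0 (x y : vec) : crs x y \is a GRing.unit -> TD (cv x y) (cv3 u v) -> 0 <= pval x y.
    move=> xy [_ i0]; rewrite leNgt; apply/negP => /(interior_val xy) h.
    by have : (interior (cv x y) `&` interior (cv3 u v)) p by []; rewrite i0.
  have f0 := ge0 _ _ uv t0; have f1 := ge0 _ _ vw t1; have f2 := ge0 _ _ wu t2.
  have /(interior_val3 uv) f3 := ap.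
  rewrite eW'; apply: good_step.
  - exact: vu.
  - by rewrite pval_flip.
  - by rewrite (addrC (- v)) pval_flip.
  - by rewrite (addrC (- v)) pval_flip.
  - rewrite pval3_swap (addrC (- v)) (pval_flip u v) (pval_flip (- u - v) u).
    rewrite (pval_flip v (- u - v)); move: f0 f1 f2 f3.
    by move: (pval u v) (pval v _) (pval _ u) (pval3 u v) => *; lra.
  - by apply: good_start; [exact: cw_chamber | rewrite -eW; exact: Wa].
have gW0 : good (cw u v) by exact: good_step.
have vw := unit_cyc uv; have wu := unit_cyc2 uv.
have e1 : - v - (- u - v) = u by vring.
have e2 : - (- u - v) - u = v by vring.
move: WF WF'; rewrite {1}/cw {1}/left_chamber /std_walls {1}/walls.
case=> [[[->|->]|->]|->] WF'.
(* The wall of entry: turning back leads to the chamber already known to be good. *)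
- by have [->|->] := chamber_wall uv cW' WF'.
- have g2 : good (cw (- u - v) u) by rewrite cw_cyc e2.
  apply: (good_rho wu _ _ _ _ g2 cW'); rewrite ?e2 //.
  + rewrite -(pval3_cyc (- u - v)) e2; move: v3.
    by move: (pval u v) (pval v _) (pval _ u) (pval3 u v) => *; lra.
  + move: WF'; congr W'; rewrite set3_rot; congr [set _; _; _].
    * by apply: (@lax_scaled (- gi)) => //; vring.
    * by rewrite -[LHS](lax_scale _ unit_gi); congr lax; vring.
- apply: (good_rho uv _ _ _ _ gW0 cW') => //.
  move: WF'; congr W'; rewrite set3_rot set3_swap; congr [set _; _; _].
  * by apply: (@lax_scaled (- gi)) => //; vring.
  * by apply: (@lax_scaled (- gi)) => //; vring.
- have g1 : good (cw v (- u - v)) by rewrite -cw_cyc.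
  apply: (good_rho vw _ _ _ _ g1 cW'); rewrite ?e1 //.
  + rewrite pval3_cyc; move: v3.
    by move: (pval u v) (pval v _) (pval _ u) (pval3 u v) => *; lra.
  + move: WF'; congr W'; rewrite set3_rot; congr [set _; _; _].
    * by apply: (@lax_scaled (- gi)) => //; vring.
    * by apply: (@lax_scaled (- gi)) => //; vring.
Qed.

Lemma good_sound (W : set (set laxv)) (b : ocircle R) : interior a p -> good W ->
  Dc W b -> b <> a -> ~ interior b p.
Proof.
move=> ap gW; case: gW => {W} [W /chamber_cw[u [v [uv ->]]]|u v uv v0 v1 v2 v3 _].
  rewrite DcE // => ha hb ba pb.
  have [_ i0] := cvs_TD uv hb ha ba.
  by have : (interior b `&` interior a) p by []; rewrite i0.
have vw := unit_cyc uv; have wu := unit_cyc2 uv.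
rewrite DcE // => -[[[->|->]|->]|->] _.
- by move/(interior_val uv); rewrite ltNge v0.
- by move/(interior_val vw); rewrite ltNge v1.
- by move/(interior_val wu); rewrite ltNge v2.
- move/(interior_val3 uv); move: v0 v1 v2 v3.
  by move: (pval u v) (pval v _) (pval _ u) (pval3 u v) => *; lra.
Qed.
End Disjoint.

Lemma Phi_Dc (P : set corner) (c : corner) : kvertex P -> P c ->
  chamber c.1 /\ Dc c.1 (Phi P).
Proof.
move=> /kvertexP[u [v [uv ->]]] l.
have [u' [v' [uv' -> h]]] := (linked_hv l).1 _ _ uv erefl.
split; first exact: cw_chamber.
rewrite DcE // PhiE // (eq_cv R uv uv' h).
by left; left; left.
Qed.

Lemma reach_disjoint (P Q : set corner) : kvertex P -> reach P Q -> Phi P <> Phi Q ->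
  interior (Phi P) `&` interior (Phi Q) = set0.
Proof.
move=> kP r PQ; apply/seteqP; split=> // p [pP pQ].
have /kvertexP[u [v [uv eQ]]] := (reach_kvertex r).1 kP.
have := (reach_inv (fun W W' F g cW cW' => good_closed pP g cW cW') r).1.
move=> /(_ _ (corv u v)) h.
have g : good (Phi P) p (cw u v).
  apply: h; last by rewrite eQ; exact: rst_refl.
  by move=> c Pc; have [cc dc] := Phi_Dc kP Pc; exact: good_start.
have dQ : Dc (cw u v) (Phi Q).
  by rewrite eQ (PhiE R uv) (DcE R uv); left; left; left.
exact: (good_sound pP g dQ (fun e => PQ (esym e)) pQ).
Qed.

Lemma packing_mono (D : set (ocircle R)) (m n : nat) : (m <= n)%N ->
  packing_stage D m `<=` packing_stage D n.
Proof.
move=> /subnK <-; elim: (n - m)%N => [//|k IH] c /IH h.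
by rewrite addSn; left.
Qed.

Lemma packing_closed (D : set (ocircle R)) (a b c d : ocircle R) :
  packing D a -> packing D b -> packing D c -> descartes [set a; b; c; d] ->
  packing D d.
Proof.
move=> [i _ ha] [j _ hb] [k _ hc] dd.
exists (i + j + k).+1 => //; right; exists a, b, c; split=> //.
- by apply: packing_mono ha; lia.
- by apply: packing_mono hb; lia.
- by apply: packing_mono hc; lia.
Qed.

(** The invariant of one inclusion is that the whole quadruple of the current chamber lies in the
    packing, since crossing a wall keeps three circles and completes them anew. The other inclusion
    is an induction on the stage. *)
Lemma reach_packing (u v : vec) : crs u v \is a GRing.unit ->
  Phi @` [set Q | reach (kv u v) Q] = packing (cvs u v).
Proof.
move=> uv; have kP : kvertex (kv u v) by apply/kvertexP; exists u, v.
apply/seteqP; split.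
  move=> _ [Q /= r <-]; have kQ := (reach_kvertex r).1 kP.
  have step (W W' F : set _) : Dc W `<=` packing (cvs u v) -> chamber W -> chamber W' ->
      W F -> W' F -> Dc W' `<=` packing (cvs u v).
    move=> h cW cW' WF WF'; have [x [y [xy eW eF]]] := chamberP cW WF.
    rewrite eF in WF'; rewrite eW (DcE R xy) in h.
    have [->|->] := chamber_wall xy cW' WF'; first by rewrite (DcE R xy).
    have [h0 h1 h2] : [/\ packing (cvs u v) (cv x y), packing (cvs u v) (cv y (- x - y))
        & packing (cvs u v) (cv (- x - y) x)].
      by split; apply: h; [left; left; left | left; left; right | left; right].
    have [dd _] := cvs_descartes R (unit_crsC xy).
    rewrite (DcE R (unit_crsC xy)); rewrite (cvs_swap R xy) in dd *.
    move=> c [[[->|->]|->]|->] //.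
    exact: packing_closed h0 h1 h2 dd.
  have := (@reach_inv [set W | Dc W `<=` packing (cvs u v)] step _ _ r).1.
  have /kvertexP[u' [v' [uv' eQ]]] := kQ.
  move=> h; have /h {}h : forall c, kv u v c -> Dc c.1 `<=` packing (cvs u v).
    move=> c l; apply/(linked_inv step l).
    by rewrite /= (DcE R uv) => o ho; exists 0%N.
  have Qc : Q (corv u' v') by rewrite eQ; exact: rst_refl.
  exact: (h _ Qc _ (Phi_Dc kQ Qc).2).
have start (W : set (set laxv)) (P Q : set corner) : chamber W -> chamber_vertices W P ->
  chamber_vertices W Q -> reach (kv u v) P -> reach (kv u v) Q.
  by move=> cW hP hQ r; apply: rst_trans r _; exact: chamber_reach hP hQ.
have cW := cw_chamber uv.
have hP : chamber_vertices (cw u v) (kv u v).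
  by rewrite chamber_verticesE //; left; left; left.
move=> c [n _]; elim: n c => [|n IH] c /=.
  rewrite -(DcE R uv) => -[Q hQ <-]; exists Q => //.
  by apply: (start _ _ _ cW hP hQ); exact: rst_refl.
case=> [/IH//|[x [y [z [/IH[P rP <-] /IH[P' rP' <-] /IH[P'' rP'' <-] dd]]]]].
have kP1 := (reach_kvertex rP).1 kP; have kP2 := (reach_kvertex rP').1 kP.
have kP3 := (reach_kvertex rP'').1 kP.
(* The three old circles and the new one belong to a single chamber; by injectivity of [Phi] it has
   the reached vertex [P], so all its vertices are reached. *)
have [a [b [ab e]]] := triple_chamber (kv_gaussian R kP1) (kv_gaussian R kP2)
  (kv_gaussian R kP3) dd.
have cab := cw_chamber ab.
have : Dc (cw a b) (Phi P) by rewrite (DcE R ab) -e; left; left; left.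
have : Dc (cw a b) c by rewrite (DcE R ab) -e; right.
move=> [Q hQ <-] [P0 hP0 e0]; exists Q => //.
have eP : P0 = P.
  by apply: (Phi_inj (chamber_vertices_kvertex cab hP0) kP1 e0).
by apply: (start _ _ _ cab _ hQ rP); rewrite -eP.
Qed.

(** If [Q] were not the neighbour of [P] at the tangency point, the interiors of the two would meet,
    although both lie in one component. *)
Lemma tangent_kedge (P Q : set corner) : kvertex P -> reach P Q ->
  tangent (Phi P) (Phi Q) -> kedge P Q.
Proof.
move=> kP r t; have kQ := (reach_kvertex r).1 kP.
have /kvertexP[x [y [xy eP]]] := kP; have /kvertexP[x' [y' [xy' eQ]]] := kQ.
have ne : Phi P <> Phi Q.
  move=> e; rewrite -e eP PhiE // in t.
  exact: (tangent_irrefl (unit_giv xy) t).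
have td : TD (cv x y) (cv x' y').
  have := reach_disjoint kP r ne; move: t; rewrite eP eQ (PhiE R xy) (PhiE R xy') => t0 i0.
  exact: (conj t0 i0).
have [u [v [uv e1 h]]] := TD_neighbour (unit_giv xy) (unit_giv xy') td.
have vw := unit_cyc uv.
have ePu : P = kv u v by rewrite eP; apply/(kv_cv R xy uv); rewrite e1.
pose Q' := kv v (- u - v).
have kQ' : kvertex Q' by apply/kvertexP; exists v, (- u - v).
have PQ' : kedge P Q'.
  exists (cw u v), (corv u v).2, (corv v (- u - v)).2; split.
  - exact: cw_chamber.
  - by split; apply/(corner_cw _ uv); [constructor 1 | constructor 2; rewrite cw_cyc].
  - move=> eT; have [t01 _ _ _] := chamber_TD R uv.
    apply: (TD_neq uv t01); apply/(kv_cv R uv vw); congr kclass.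
    by rewrite /corv in eT *; congr pair; [exact: cw_cyc | exact: eT].
  - exact: ePu.
  - by rewrite cw_cyc.
suff -> : Q = Q' by [].
apply: (@Phi_inj R _ _ kQ kQ').
have pQ : Phi Q = cv x' y' by rewrite eQ; exact: PhiE.
have pQ' : Phi Q' = cv v (- u - v) by exact: PhiE.
case: h => [h|[z [z1 z2]]]; first by rewrite pQ pQ' h.
apply: contrapT => neq.
have rQ : reach Q' Q.
  exact: rst_trans (rst_sym _ _ _ _ (rst_step _ _ _ _ PQ')) r.
have i0 := reach_disjoint kQ' rQ (fun e => neq (esym e)).
have : (interior (Phi Q') `&` interior (Phi Q)) z by rewrite pQ pQ'; exact: (conj z1 z2).
by rewrite i0.
Qed.
End Packing.

Theorem theorem6p4 (R : realType) :
  exists Phi : set corner -> ocircle R,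
    [/\ (* Phi is the map determined by the labels, and it is a bijection *)
        (forall P, kvertex P -> forall c : ocircle R,
           Phi P = c <->
           exists a b : vec, [/\ zibasis a b, labelled P (lax_lattice a b)
                               & c = circle_of R (row_mx a b)]) /\
        set_bij kvertex (@gaussian_circle R) Phi,
        (* (i) *)
        (forall S : set (set corner), S `<=` kvertex -> S #= `I_4 ->
           ((exists2 W, chamber W & S = chamber_vertices W) <->
            descartes (Phi @` S))) /\
        set_bij chamber (@gaussian_descartes R)
          (fun W => Phi @` chamber_vertices W),
        (* (ii) *)
        (forall P Q, kvertex P -> kvertex Q ->
           (gedge kingdom P Q <->
            tangent (Phi P) (Phi Q) /\
            exists D, [/\ gaussian_descartes D, D (Phi P) & D (Phi Q)]))
      & (* (iii) *)
        [/\ set_bij (component kingdom)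
              [set palace A | A in @gaussian_packing R]
              (fun K => palace (Phi @` gvert K)),
            (forall K, component kingdom K ->
               gaussian_packing (Phi @` gvert K) /\
               graph_iso Phi K (palace (Phi @` gvert K)))
          & (forall A, gaussian_packing A ->
               exists! K, component kingdom K /\ Phi @` gvert K = A)]].
Proof.
have gau (K : graph (set corner)) : component kingdom K -> exists u v,
    crs u v \is a GRing.unit /\ K = induced kingdom [set Q | reach (kv u v) Q].
  by move=> [P /kvertexP[u [v [uv ->]]] <-]; exists u, v.
have comp (u v : vec) : crs u v \is a GRing.unit ->
    component kingdom (induced kingdom [set Q | reach (kv u v) Q]).
  by move=> uv; exists (kv u v) => //; apply/kvertexP; exists u, v.
have compV (K : graph (set corner)) : component kingdom K -> gvert K `<=` kvertex.
  move=> /gau[u [v [uv ->]]] Q /= r; apply/(reach_kvertex r).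
  by apply/kvertexP; exists u, v.
have imI (S S' : set (set corner)) : S `<=` kvertex -> S' `<=` kvertex ->
    Phi R @` S = Phi R @` S' -> S = S'.
  move=> kS kS' e; apply/seteqP; split=> P SP.
    have [Q SQ eQ] : (Phi R @` S') (Phi R P) by rewrite -e; exists P.
    by rewrite -(Phi_inj (kS' _ SQ) (kS _ SP) eQ).
  have [Q SQ eQ] : (Phi R @` S) (Phi R P) by rewrite e; exists P.
  by rewrite -(Phi_inj (kS _ SQ) (kS' _ SP) eQ).
have compI (K K' : graph (set corner)) : component kingdom K -> component kingdom K' ->
    Phi R @` gvert K = Phi R @` gvert K' -> K = K'.
  move=> cK cK' /(imI _ _ (compV _ cK) (compV _ cK')) e.
  have [u [v [uv eK]]] := gau _ cK; have [u' [v' [uv' eK']]] := gau _ cK'.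
  by move: e; rewrite eK eK' /= => ->.
have compP (K : graph (set corner)) : component kingdom K ->
    gaussian_packing (Phi R @` gvert K).
  move=> cK; split; last by move=> c [Q KQ <-]; exact: kv_gaussian (compV _ cK _ KQ).
  have [u [v [uv ->]]] := gau _ cK; exists (@cvs R u v); last exact: reach_packing.
  by case: (cvs_descartes R uv).
(* The generating quadruple is stage zero of the packing, hence consists of Gaussian circles and
   comes from a chamber. *)
have packK (A : set (ocircle R)) : gaussian_packing A ->
    exists2 K, component kingdom K & Phi R @` gvert K = A.
  move=> [[D dD eA] gA].
  have [|u [v [uv eD]]] := @gaussian_descartes_cvs R D.
    by split=> // c Dc; apply: gA; rewrite eA; exists 0%N.
  exists (induced kingdom [set Q | reach (kv u v) Q]); first exact: comp.
  by rewrite /= reach_packing // eA eD.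
have edgeT (P Q : set corner) : kedge P Q -> tangent (Phi R P) (Phi R Q) /\
    exists D, [/\ gaussian_descartes D, D (Phi R P) & D (Phi R Q)].
  move=> [W [T [T' [cW [cT cT'] TT' -> ->]]]].
  have [u [v [uv eW]]] := chamber_cw cW.
  have DP : @Dc R W (Phi R (kclass (W, T))) by exists (kclass (W, T)) => //; exists T.
  have DQ : @Dc R W (Phi R (kclass (W, T'))) by exists (kclass (W, T')) => //; exists T'.
  split; last by exists (@Dc R W); split=> //; rewrite eW (DcE R uv); exact: cvs_descartes.
  have ne : Phi R (kclass (W, T)) <> Phi R (kclass (W, T')).
    by rewrite eW in cT cT' *; move=> /(corner_Phi_inj uv cT cT').
  by move: DP DQ; rewrite eW (DcE R uv) -eW => DP DQ; case: (cvs_TD uv DP DQ ne).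
exists (Phi R); split.
- split.
    move=> P kP c; have /kvertexP[u [v [uv eP]]] := kP.
    have pP : Phi R P = cv R u v by rewrite eP; exact: PhiE.
    split=> [<-|[a [b [/zibasisP ab [c1 [a1 [b1 [Pc1 car eL]]]] ->]]]].
      exists u, (gi *: v); split.
      - by apply/zibasisP; exact: unit_giv.
      - exists (corv u v), u, (gi *: v); split=> //; last exact: corv_carries.
        by rewrite eP; exact: rst_refl.
      - exact: pP.
    (* The label may be carried by any corner of the class; that corner presents the same vertex,
       with the form of the label. *)
    have [u1 [v1 [uv1 ec1 h1]]] := carries_corv car.
    have eP1 : P = kv u1 v1.
      rewrite eP; apply/kclass_eq; rewrite -ec1.
      by move: Pc1; rewrite eP.
    rewrite eP1 (PhiE R uv1) (cv_oc R uv1) -[RHS]/(circ R a b) (circ_oc R ab).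
    by rewrite (lax_lattice_herm eL) h1.
  split.
  - by move=> P kP; exact: kv_gaussian.
  - by move=> P Q /set_mem kP /set_mem kQ; exact: Phi_inj.
  - move=> c /gaussianP[u [v [uv ->]]]; exists (kv u v); last exact: PhiE.
    by apply/kvertexP; exists u, v.
- split.
    move=> S kS cS; split=> [[W cW ->]|dS].
      have [u [v [uv eW]]] := chamber_cw cW.
      rewrite -[X in descartes X]/(@Dc R W) eW (DcE R uv).
      by case: (cvs_descartes R uv).
    have [|u [v [uv e]]] := @gaussian_descartes_cvs R (Phi R @` S).
      by split=> // c [P SP <-]; exact: kv_gaussian (kS _ SP).
    have cW := cw_chamber uv.
    exists (cw u v) => //; apply: imI => //; first exact: chamber_vertices_kvertex.
    by rewrite e -(DcE R uv).
  split.
  - move=> W /chamber_cw[u [v [uv ->]]]; rewrite -/(@Dc R _) (DcE R uv).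
    exact: cvs_descartes.
  - by move=> W W' /set_mem cW /set_mem cW'; exact: Dc_inj.
  - move=> D /gaussian_descartes_cvs[u [v [uv ->]]]; exists (cw u v).
      exact: cw_chamber.
    exact: DcE.
- move=> P Q kP kQ; split=> [|[t [D [gD DP DQ]]]]; first exact: edgeT.
  have [u [v [uv eD]]] := gaussian_descartes_cvs gD.
  have cW := cw_chamber uv.
  move: DP DQ; rewrite eD -(DcE R uv) => -[P' hP' eP] [Q' hQ' eQ].
  have <- := Phi_inj (chamber_vertices_kvertex cW hP') kP eP.
  have <- := Phi_inj (chamber_vertices_kvertex cW hQ') kQ eQ.
  rewrite -eP -eQ in t; case: hP' hQ' t => [T cT <-] [T' cT' <-] t.
  (* Equal corners would make a circle tangent to itself. *)
  exists (cw u v), T, T'; split=> // eT; rewrite eT in t.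
  have /kvertexP[x [y [xy e]]] : kvertex (kclass (cw u v, T')).
    by apply: (chamber_vertices_kvertex cW); exists T'.
  by move: t; rewrite e (PhiE R xy); exact: tangent_irrefl (unit_giv xy).
- split.
  + split.
    * by move=> K cK /=; exists (Phi R @` gvert K) => //; exact: compP.
    * by move=> K K' /set_mem cK /set_mem cK' [e _]; exact: compI.
    * by move=> G [A /packK[K cK eK] <-]; exists K; rewrite //= eK.
  + move=> K cK; split; first exact: compP.
    have [u [v [uv eK]]] := gau _ cK.
    split; first split.
    * by move=> Q KQ; exists Q.
    * move=> P Q /set_mem KP /set_mem KQ; apply: Phi_inj; exact: compV cK _ _.
    * by move=> c.
    move=> P Q KP KQ; have kP := compV _ cK _ KP.
    have ge : gedge K P Q <-> [/\ gvert K P, gvert K Q & kedge P Q] by rewrite eK.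
    split=> [/ge[_ _ e]|[_ _ t]].
      by split; [exists P | exists Q | case: (edgeT _ _ e)].
    apply/ge; split=> //; apply: tangent_kedge kP _ t.
    move: KP KQ; rewrite eK /= => rP rQ.
    exact: rst_trans (rst_sym _ _ _ _ rP) rQ.
  + move=> A /packK[K cK eK]; exists K; split=> // K' [cK' eK'].
    by apply: compI => //; rewrite eK eK'.
Qed.
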